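(* Let $n\ge 2$. For all $1\le p<\infty$, $s\in\mathbb{R}$ and $t>-n/p$, there holds $$\|f\|_{S^{s,p}_t(\mathbb{R}^n)}=\|Rf\|_{R^{s+(n-1)/p,\,p}_{t+(n-1)/p}(\mathbb{R}\times S^{n-1})}\qquad\text{for all } f\in S^{s,p}_t(\mathbb{R}^n).$$
   Context: The Radon transform of $f:\mathbb{R}^n\to\mathbb{R}$ is $Rf(\sigma,\theta)=\int_{x\cdot\theta=\sigma}f(x)\,dx$ for $(\sigma,\theta)\in\mathbb{R}\times S^{n-1}$ (integration over the hyperplane with respect to $(n-1)$-dimensional Lebesgue measure). The Fourier transform is $\mathcal{F}f(\xi)=(2\pi)^{-n/2}\int_{\mathbb{R}^n}e^{ix\cdot\xi}f(x)\,dx$. The one-dimensional Fourier transform $\mathcal{F}_1$ acts on the offset variable of functions $g(\sigma,\theta)$ on $\mathbb{R}\times S^{n-1}$ and is normalized so that the Fourier slice theorem reads $\mathcal{F}_1(Rf)(\sigma,\theta)=\mathcal{F}f(\sigma\theta)$, i.e. $\mathcal{F}_1g(\sigma,\theta)=(2\pi)^{-n/2}\int_{\mathbb{R}}e^{i\sigma\tau}g(\tau,\theta)\,d\tau$. Weights: for $s,t\in\mathbb{R}$ and $\xi\in\mathbb{R}^d$, $v_{s,t}(\xi)=(1+|\xi|^2)^{s/2}\left(\frac{|\xi|}{(1+|\xi|^2)^{1/2}}\right)^t$ (used with $d=n$ and with $d=1$). For $1\le p<\infty$, $s\in\mathbb{R}$, $t>-n/p$, the space $S^{s,p}_t(\mathbb{R}^n)$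 is the completion of the Schwartz space $\mathcal{S}(\mathbb{R}^n)$ under $\|f\|_{S^{s,p}_t(\mathbb{R}^n)}=\|v_{s,t}\,\mathcal{F}(f)\|_{L^p(\mathbb{R}^n)}$. For $1\le p<\infty$, $s\in\mathbb{R}$, $t>-1/p$, the space $R^{s,p}_t(\mathbb{R}\times S^{n-1})$ is the completion of $\mathcal{S}(\mathbb{R}\times S^{n-1})$ under $$\|g\|_{R^{s,p}_t(\mathbb{R}\times S^{n-1})}=\left(\frac12\int_{S^{n-1}}\int_{\mathbb{R}}|v_{s,t}(\sigma)|^p\,|\mathcal{F}_1g(\sigma,\theta)|^p\,d\sigma\,d\theta\right)^{1/p},$$ where $d\theta$ is the surface measure on $S^{n-1}$. For $f$ in the completion $S^{s,p}_t(\mathbb{R}^n)$, $Rf$ is understood via continuous extension of $R$ from $\mathcal{S}(\mathbb{R}^n)$. *)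

(* Defs.v *)
From HB Require Import structures.
From mathcomp Require Import all_boot all_order all_algebra complex.
From mathcomp Require Import all_classical all_reals all_analysis measurable_realfun.

Set Implicit Arguments.
Unset Strict Implicit.
Unset Printing Implicit Defensive.

Import Order.TTheory GRing.Theory Num.Theory numFieldNormedType.Exports.

Local Open Scope classical_set_scope.
Local Open Scope ring_scope.

(* The library norm on 'rV[R]_n is the sup norm, hence [enorm]. *)
Definition dotp (R : realType) (n : nat) (x y : 'rV[R]_n) : R :=
  \sum_(i < n) x ord0 i * y ord0 i.

Definition enorm (R : realType) (n : nat) (x : 'rV[R]_n) : R :=
  Num.sqrt (dotp x x).

Definition rV_display : measure_display.
Proof. exact. Qed.

Section measurable_rV.
Context (R : realType) (n : nat).

Let coords (i : 'I_n) (x : 'rV[R]_n) : measurableTypeR R := x ord0 i.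

Let rV_set0 : g_sigma_preimage coords set0.
Proof. exact: sigma_algebra0. Qed.

Let rV_setC A : g_sigma_preimage coords A -> g_sigma_preimage coords (~` A).
Proof. exact: sigma_algebraC. Qed.

Let rV_bigcup (F : _^nat) : (forall i, g_sigma_preimage coords (F i)) ->
  g_sigma_preimage coords (\bigcup_i (F i)).
Proof. exact: sigma_algebra_bigcup. Qed.

(* The product (= Borel) sigma-algebra of R^n. *)
HB.instance Definition _ := @isMeasurable.Build rV_display
  'rV[R]_n (g_sigma_preimage coords) rV_set0 rV_setC rV_bigcup.

Lemma measurable_coord (i : 'I_n) :
  measurable_fun [set: 'rV[R]_n] (fun x => x ord0 i : measurableTypeR R).
Proof.
move=> _ Y mY; rewrite setTI; apply: sub_sigma_algebra => /=.
rewrite -bigcup_seq/=; exists i => /=; first by rewrite mem_index_enum.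
by exists Y => //; rewrite setTI.
Qed.

Lemma measurable_fun_rVP d (T : measurableType d) (f : T -> 'rV[R]_n) :
  (forall i, measurable_fun [set: T]
     (fun x => f x ord0 i : measurableTypeR R)) ->
  measurable_fun [set: T] f.
Proof.
move=> mf _ A mA; rewrite setTI.
suff : g_sigma_preimage coords `<=` [set B | measurable (f @^-1` B)] by exact.
apply: smallest_sub.
  split => /=.
  - by rewrite preimage_set0.
  - by move=> B mB; rewrite setTD -preimage_setC; exact: measurableC.
  - by move=> F mF; rewrite preimage_bigcup; exact: bigcup_measurable.
rewrite -bigcup_seq => B [i _ [C mC <-]] /=.
by rewrite setTI; have := mf i measurableT C mC; rewrite setTI.
Qed.

Lemma measurable_dotp d (T : measurableType d) (f g : T -> 'rV[R]_n) :
  measurable_fun [set: T] f -> measurable_fun [set: T] g ->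
  measurable_fun [set: T] (fun x => dotp (f x) (g x)).
Proof.
move=> mf mg; apply: measurable_sum => i.
by apply: measurable_funM;
  apply: (measurableT_comp (measurable_coord i)).
Qed.

Lemma enorm_powR (x : 'rV[R]_n) : enorm x = dotp x x `^ (2^-1).
Proof.
rewrite powR12_sqrt// /dotp; apply: sumr_ge0 => i _.
by rewrite -expr2 sqr_ge0.
Qed.

Lemma measurable_enorm : measurable_fun [set: 'rV[R]_n] (@enorm R n).
Proof.
rewrite (_ : @enorm R n = fun x => dotp x x `^ (2^-1)); last first.
  by apply/funext => x; rewrite enorm_powR.
by apply: (measurableT_comp (measurable_powR _)); exact: measurable_dotp.
Qed.

Lemma measurable_normalize :
  measurable_fun [set: 'rV[R]_n] (fun x => (enorm x)^-1 *: x).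
Proof.
apply: measurable_fun_rVP => i; under eq_fun do rewrite mxE.
apply: measurable_funM; last exact: measurable_coord.
rewrite (_ : (fun x => _) = fun x : 'rV[R]_n => enorm x `^ (-1)); last first.
  by apply/funext => x; rewrite powR_inv1// sqrtr_ge0.
exact: (measurableT_comp (measurable_powR _) measurable_enorm).
Qed.

End measurable_rV.

Definition rV_cons (R : realType) (n : nat) (z : measurableTypeR R * 'rV[R]_n)
    : 'rV[R]_n.+1 := row_mx (z.1)%:M z.2.

Section lebesgue_rV.
Context (R : realType).

Lemma measurable_rV_cons n : measurable_fun setT (@rV_cons R n).
Proof.
apply: measurable_fun_rVP => i; rewrite /rV_cons.
pose s := @fintype.split 1 n i.
rewrite (_ : (fun _ => _) = fun z : measurableTypeR R * 'rV[R]_n =>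
  match s with inl j => z.1%:M ord0 j | inr j => z.2 ord0 j end); last first.
  by apply/funext => z; rewrite mxE.
case: s => j.
- under eq_fun do rewrite mxE !ord1 eqxx mulr1n.
  exact: measurable_fst.
- exact: (measurableT_comp (measurable_coord j)).
Qed.


Section step.
Local Open Scope ereal_scope.
Context (n : nat) (mu : {sigma_finite_measure set 'rV[R]_n -> \bar R}).

Definition lebesgue_rV_step : set 'rV[R]_n.+1 -> \bar R :=
  pushforward (@lebesgue_measure R \x mu) (@rV_cons R n).

Let step0 : lebesgue_rV_step set0 = 0.
Proof. by rewrite /lebesgue_rV_step /pushforward preimage_set0 measure0. Qed.

Let step_ge0 A : 0 <= lebesgue_rV_step A.
Proof. by rewrite /lebesgue_rV_step /pushforward measure_ge0. Qed.

Let step_sigma_additive : semi_sigma_additive lebesgue_rV_step.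
Proof.
rewrite /lebesgue_rV_step; apply: measure_semi_sigma_additive.
exact: measurable_rV_cons.
Qed.

HB.instance Definition _ := isMeasure.Build _ _ _ lebesgue_rV_step
  step0 step_ge0 step_sigma_additive.

Let step_sigma_finite : sigma_finite setT lebesgue_rV_step.
Proof.
have /sigma_finiteP[F [FT ndF Foo]] := sigma_finiteT (@lebesgue_measure R).
have /sigma_finiteP[G [GT ndG Goo]] := sigma_finiteT mu.
pose uncons (x : 'rV[R]_n.+1) : measurableTypeR R * 'rV[R]_n :=
  (x ord0 ord0, @rsubmx _ 1 1 n x).
have consK : cancel (@rV_cons R n) uncons.
  move=> [a y]; rewrite /uncons /rV_cons; congr (_, _); last first.
    by rewrite row_mxKr.
  rewrite (_ : ord0 = @lshift 1 n ord0); last exact/val_inj.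
  by rewrite (row_mxEl a%:M y) mxE eqxx mulr1n.
have muncons : measurable_fun setT uncons.
  apply: measurable_fun_pair; first exact: measurable_coord.
  apply: measurable_fun_rVP => i; under eq_fun do rewrite mxE.
  exact: measurable_coord.
exists (fun i => uncons @^-1` (F i `*` G i)).
  apply/esym; rewrite -subTset => x _.
  have [i _ Fi] : (\bigcup_i F i) (uncons x).1 by rewrite -FT.
  have [j _ Gj] : (\bigcup_i G i) (uncons x).2 by rewrite -GT.
  exists (maxn i j) => //=; split.
  - by move: Fi; exact/subsetPset/ndF/leq_maxl.
  - by move: Gj; exact/subsetPset/ndG/leq_maxr.
move=> i; have [mF Fi] := Foo i; have [mG Gi] := Goo i.
have mFG : measurable (F i `*` G i) by exact: measurableX.
split; first by rewrite -[X in measurable X]setTI; exact: muncons.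
rewrite /lebesgue_rV_step /pushforward -comp_preimage.
rewrite (_ : uncons \o _ = id) ?preimage_id; last exact/funext.
by rewrite product_measure1E// lte_mul_pinfty// ge0_fin_numE.
Qed.

HB.instance Definition _ := Measure_isSigmaFinite.Build _ _ _
  lebesgue_rV_step step_sigma_finite.

End step.

Fixpoint lebesgue_rV (n : nat) : {sigma_finite_measure set 'rV[R]_n -> \bar R} :=
  match n with
  | 0 => \d_(0 : 'rV[R]_0)
  | m.+1 => lebesgue_rV_step (lebesgue_rV m)
  end.

End lebesgue_rV.

Section sphere_measure.
Local Open Scope ereal_scope.
Context (R : realType) (n : nat).

Let punctured_ball : set 'rV[R]_n := [set x | 0 < enorm x <= 1]%R.

Let measurable_punctured_ball : measurable punctured_ball.
Proof.
have -> : punctured_ball = @enorm R n @^-1` `]0%R, 1%R]%classic.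
  by apply/seteqP; split => x; rewrite /= in_itv.
by rewrite -[X in measurable X]setTI; exact: measurable_enorm.
Qed.

(* Surface measure of S^(n-1), as a measure on R^n concentrated on the sphere:
   n times the volume of the cone {r theta : 0 < r <= 1, theta in A}. *)
Definition sphere_measure (A : set 'rV[R]_n) : \bar R :=
  n%:R%:E * lebesgue_rV R n
    ((fun x => (enorm x)^-1 *: x)%R @^-1` A `&` [set x | 0 < enorm x <= 1]%R).

Let cone_measure := pushforward
  (mrestr (lebesgue_rV R n) measurable_punctured_ball)
  (fun x : 'rV[R]_n => (enorm x)^-1 *: x)%R.

Let sphere_measure0 : sphere_measure set0 = 0.
Proof. by rewrite /sphere_measure preimage_set0 set0I measure0 mule0. Qed.

Let sphere_measure_ge0 A : 0 <= sphere_measure A.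
Proof. by rewrite /sphere_measure mule_ge0// lee_fin. Qed.

Let sphere_measure_sigma_additive : semi_sigma_additive sphere_measure.
Proof.
move=> F mF tF mUF.
have -> : (fun k => \sum_(0 <= i < k) sphere_measure (F i)) =
    (fun k => n%:R%:E * \sum_(0 <= i < k) cone_measure (F i)).
  apply/funext => k; rewrite ge0_sume_distrr// => i _.
  by rewrite /cone_measure /pushforward measure_ge0.
apply: cvgeZl => //; rewrite -/(cone_measure _) /cone_measure.
by apply: measure_semi_sigma_additive => //; exact: measurable_normalize.
Qed.

HB.instance Definition _ := isMeasure.Build _ _ _ sphere_measure
  sphere_measure0 sphere_measure_ge0 sphere_measure_sigma_additive.

End sphere_measure.

Definition cintegral d (T : measurableType d) (R : realType)
    (mu : {measure set T -> \bar R}) (f : T -> R[i]) : R[i] :=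
  Complex (\int[mu]_x complex.Re (f x)) (\int[mu]_x complex.Im (f x)).

Definition cis (R : realType) (a : R) : R[i] := Complex (cos a) (sin a).

Definition cmod (R : realType) (z : R[i]) : R := ComplexField.Normc.normc z.

Section fourier.
Context (R : realType) (n : nat).

Definition fourier_const : R[i] := ((2 * pi) `^ (- (n%:R / 2)) : R)%:C%C.

Definition fourier (f : 'rV[R]_n -> R[i]) (xi : 'rV[R]_n) : R[i] :=
  fourier_const * cintegral (lebesgue_rV R n) (fun x => cis (dotp x xi) * f x).

(* One-dimensional transform in the offset variable, with the constant of R^n so
   that fourier1 (radon f) (sigma, theta) = fourier f (sigma theta). *)
Definition fourier1 (g : R * 'rV[R]_n -> R[i]) (z : R * 'rV[R]_n) : R[i] :=
  fourier_const *
  cintegral (@lebesgue_measure R) (fun tau => cis (z.1 * tau) * g (tau, z.2)).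

End fourier.

(* [weight s t `|xi|] is v_(s,t)(xi).  For t < 0 the value at r = 0 is not the
   mathematical one (+oo); the singleton {0} is negligible. *)
Definition weight (R : realType) (s t r : R) : R :=
  (1 + r ^+ 2) `^ (s / 2) * (r / (1 + r ^+ 2) `^ (1 / 2)) `^ t.

Section radon.
Context (R : realType) (n : nat).

(* An orthonormal basis (b_1, ..., b_(n-1)) of the orthogonal complement of
   theta, given by the rows of a matrix. *)
Definition orthonormal_frame (theta : 'rV[R]_n) : 'M[R]_(n.-1, n) :=
  xget 0 [set B | B *m B^T = 1%:M /\ B *m theta^T = 0].

(* A function on R x S^(n-1) is represented by a function on R x R^n which
   vanishes off R x S^(n-1).  The (n-1)-dimensional Lebesgue measure of the
   hyperplane {x | x . theta = sigma} is the image of that of R^(n-1) under the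
   isometry y |-> sigma theta + sum_j y_j b_j. *)
Definition radon (f : 'rV[R]_n -> R[i]) (z : R * 'rV[R]_n) : R[i] :=
  if enorm z.2 == 1 then
    cintegral (lebesgue_rV R n.-1)
      (fun y => f (z.1 *: z.2 + y *m orthonormal_frame z.2))
  else 0.

End radon.

Section smooth.
Context (R : realType) (V : normedModType R).

Definition iter_derive (f : V -> R) (vs : seq V) : V -> R :=
  foldr (fun v h x => 'D_v h x) f vs.

(* C^oo on the open set U; E is the set of coordinate directions, and the
   sequences over E play the role of multi-indices. *)
Definition smooth_on (E U : set V) (f : V -> R) : Prop :=
  forall vs, {in vs, forall v, E v} -> forall x, U x ->
    {for x, continuous (iter_derive f vs)} /\
    (forall v, E v -> derivable (iter_derive f vs) x v).

End smooth.

Section schwartz.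
Context (R : realType) (n : nat).

Definition rV_dirs : set 'rV[R]_n := range (delta_mx ord0).

Definition schwartz_real (f : 'rV[R]_n -> R) : Prop :=
  smooth_on rV_dirs setT f /\
  forall vs, {in vs, forall v, rV_dirs v} -> forall k : nat,
    exists C : R, forall x, enorm x ^+ k * `|iter_derive f vs x| <= C.

Definition schwartz : set ('rV[R]_n -> R[i]) :=
  [set f : 'rV[R]_n -> R[i] |
    schwartz_real (@complex.Re R \o f) /\ schwartz_real (@complex.Im R \o f)].

Definition cyl_dirs : set (R * 'rV[R]_n) :=
  [set v | v = (1, 0) \/ exists i, v = (0, delta_mx ord0 i)].

(* Extension of a function on R x S^(n-1) to R x (R^n \ 0), homogeneous of
   degree 0 in the second variable.  Its x-derivatives at points of the sphere
   realize all the differential operators on S^(n-1). *)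
Definition homog0 (g : R * 'rV[R]_n -> R) (z : R * 'rV[R]_n) : R :=
  g (z.1, (enorm z.2)^-1 *: z.2).

Definition cyl_schwartz_real (g : R * 'rV[R]_n -> R) : Prop :=
  smooth_on cyl_dirs [set z | z.2 != 0] (homog0 g) /\
  forall vs, {in vs, forall v, cyl_dirs v} -> forall k : nat,
    exists C : R, forall sigma theta, enorm theta = 1 ->
      `|sigma| ^+ k * `|iter_derive (homog0 g) vs (sigma, theta)| <= C.

Definition cyl_schwartz : set (R * 'rV[R]_n -> R[i]) :=
  [set g : R * 'rV[R]_n -> R[i] |
    [/\ cyl_schwartz_real (@complex.Re R \o g),
        cyl_schwartz_real (@complex.Im R \o g) &
        forall z, enorm z.2 != 1 -> g z = 0]].

End schwartz.

(* Completion of the subspace S of V under the norm N, by classes of Cauchy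
   sequences modulo null sequences.  N may take the value +oo off S. *)
Section completion.
Context (R : realType) (V : zmodType) (S : set V) (N : V -> \bar R).

Definition cauchy_seq (u : nat -> V) : Prop :=
  (forall k, S (u k)) /\
  forall e : R, 0 < e -> exists K : nat, forall i j,
    (K <= i)%N -> (K <= j)%N -> (N (u i - u j) < e%:E)%E.

Definition cauchy_class (u : nat -> V) : set (nat -> V) :=
  [set v | cauchy_seq v /\ (fun k => N (u k - v k)) @ \oo --> 0%E].

Record completion := Completion {
  class : set (nat -> V) ;
  classP : exists2 u, cauchy_seq u & class = cauchy_class u }.

Definition representative (x : completion) : nat -> V := sval (cid2 (classP x)).

Definition completion_norm (x : completion) : \bar R :=
  limn (fun k => N (representative x k)).

Definition completion_dist (x y : completion) : \bar R :=
  limn (fun k => N (representative x k - representative y k)).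

(* [x] is the image of [f] under the embedding of S in its completion. *)
Definition is_embedding (f : V) (x : completion) : Prop := class x (fun=> f).

End completion.

(* [T] is a continuous map between the completions which extends [A]; in
   particular [A] maps S to S'. *)
Definition continuous_extension (R : realType) (V W : zmodType)
    (S : set V) (N : V -> \bar R) (S' : set W) (N' : W -> \bar R)
    (A : V -> W) (T : completion S N -> completion S' N') : Prop :=
  (forall x (e : R), 0 < e -> exists2 d : R, 0 < d & forall y,
    (completion_dist x y < d%:E)%E -> (completion_dist (T x) (T y) < e%:E)%E) /\
  (forall f x, is_embedding f x -> is_embedding (A f) (T x)).

Section spaces.
Local Open Scope ereal_scope.
Context (R : realType) (n : nat) (p s t : R).

Definition S_norm (f : 'rV[R]_n -> R[i]) : \bar R :=
  Lnorm (lebesgue_rV R n) p%:E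
    (fun xi => (weight s t (enorm xi) * cmod (fourier f xi))%R%:E).

Definition R_norm (g : R * 'rV[R]_n -> R[i]) : \bar R :=
  ((2^-1)%:E * \int[@sphere_measure R n]_theta \int[@lebesgue_measure R]_sigma
     (weight s t `|sigma| `^ p * cmod (fourier1 g (sigma, theta)) `^ p)%R%:E)
  `^ p^-1.

Definition S_space := completion (@schwartz R n) S_norm.

Definition R_space := completion (@cyl_schwartz R n) R_norm.

End spaces.

(* Main.v *)
Require Import Defs.
From HB Require Import structures.
From mathcomp Require Import all_boot all_order all_algebra complex.
From mathcomp Require Import all_classical all_reals all_analysis.
From mathcomp Require Import measurable_realfun ring lra.
Import Order.TTheory GRing.Theory Num.Theory numFieldNormedType.Exports.
Local Open Scope classical_set_scope.
Local Open Scope ring_scope.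
Set Implicit Arguments.
Unset Strict Implicit.
Unset Printing Implicit Defensive.

(** The theorem is an identity of norms on Schwartz functions, extended to the
    completions.

    For a Schwartz function f, integrating first over the hyperplanes orthogonal
    to theta and then over their offset tau against exp(i sigma tau) amounts to
    integrating exp(i sigma x.theta) f(x) over the space. This is the slice theorem
    [fourier_slice]: the Fourier transform of R f in the offset, at (sigma, theta),
    is the Fourier transform of f at sigma theta. Polar coordinates [polar], in
    which every point is reached twice, as (sigma, theta) and as (-sigma, -theta),
    turn the integral of v^p |F f|^p over R^n into half the integral of
    |sigma|^(n-1) v^p |F f(sigma theta)|^p over the cylinder. The two shifts of the
    exponents of the weight by (n-1)/p are such that the new weight, raised to the
    power p, is |sigma|^(n-1) times the old one ([weight_shift]). Hence
    [radon_norm]: R is isometric for the two norms.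

    To pass to the completions, both norms must satisfy the triangle inequality
    and R must map Schwartz functions to Schwartz functions of the cylinder. Then
    [isometric_extension] applies: an isometric map of a dense subspace has a unique
    continuous extension to the completions, and it preserves norms.

    The triangle inequality is Minkowski's; for the norm on the cylinder the
    integral over the sphere is first written as an integral over the unit ball
    ([R_normE]).

    That R f is a Schwartz function of the cylinder ([radon_cyl_schwartz]) is the
    longest part, because an orthonormal frame of the hyperplane orthogonal to theta
    cannot, in general, be chosen continuously in theta. Where the i-th coordinate of
    the normal does not vanish, the hyperplane is a graph over a coordinate
    hyperplane ([radon_real_chart]), and one can differentiate under the integral
    sign in this chart. The local formulas for all i combine into a global one
    ([is_derive_hradon]), in which derivatives of R f, extended homogeneously to all
    nonzero normals, are combinations of transforms of x_j d_i f and d_i f, with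
    coefficients that are polynomials in the offset, the coordinates of the normal
    and the inverse of its norm. So the class of all such combinations is
    stable under derivatives ([hclass_derive]), and its elements decay rapidly in
    the offset, because on the hyperplane the offset is a linear function of x.

    The measure on R^n is an iterated product of Lebesgue measures. Its rotation
    invariance, needed for the slice theorem, is proved by comparison with a
    Gaussian ([ge0_integral_rV_orthogonal]). *)

(** * Euclidean algebra of row vectors and orthonormal frames *)

Section euclidean.
Context (R : realType).

Lemma dotpE n (x y : 'rV[R]_n) : dotp x y = (x *m y^T) ord0 ord0.
Proof. by rewrite mxE; apply: eq_bigr => i _; rewrite mxE. Qed.

Lemma dotp_mx n (x y : 'rV[R]_n) : x *m y^T = (dotp x y)%:M.
Proof. by rewrite dotpE -mx11_scalar. Qed.

Lemma dotpC n (x y : 'rV[R]_n) : dotp x y = dotp y x.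
Proof. by apply: eq_bigr => i _; rewrite mulrC. Qed.

Lemma dotpDl n (x y z : 'rV[R]_n) : dotp (x + y) z = dotp x z + dotp y z.
Proof. by rewrite !dotpE mulmxDl mxE. Qed.

Lemma dotpZl n a (x y : 'rV[R]_n) : dotp (a *: x) y = a * dotp x y.
Proof. by rewrite !dotpE -scalemxAl mxE. Qed.

Lemma dotpDr n (x y z : 'rV[R]_n) : dotp x (y + z) = dotp x y + dotp x z.
Proof. by rewrite dotpC dotpDl !(dotpC x). Qed.

Lemma dotpZr n a (x y : 'rV[R]_n) : dotp x (a *: y) = a * dotp x y.
Proof. by rewrite dotpC dotpZl dotpC. Qed.

Lemma dotpBr n (x y z : 'rV[R]_n) : dotp x (y - z) = dotp x y - dotp x z.
Proof. by rewrite -scaleN1r dotpDr dotpZr mulN1r. Qed.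

Lemma dotpBl n (x y z : 'rV[R]_n) : dotp (x - y) z = dotp x z - dotp y z.
Proof. by rewrite dotpC dotpBr !(dotpC z). Qed.

Lemma dotp0l n (x : 'rV[R]_n) : dotp 0 x = 0.
Proof. by rewrite -(scale0r 0) dotpZl mul0r. Qed.

Lemma dotp_mull m n (x : 'rV[R]_m) (B : 'M[R]_(m, n)) (y : 'rV[R]_n) :
  dotp (x *m B) y = dotp x (y *m B^T).
Proof. by rewrite !dotpE trmx_mul trmxK mulmxA. Qed.

Lemma dotp_ge0 n (x : 'rV[R]_n) : 0 <= dotp x x.
Proof. by apply: sumr_ge0 => i _; rewrite -expr2 sqr_ge0. Qed.

Lemma dotp_delta n (x : 'rV[R]_n) i : dotp x (delta_mx ord0 i) = x ord0 i.
Proof.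
rewrite /dotp (bigD1 i)//= mxE !eqxx mulr1 big1 ?addr0// => j ji.
by rewrite mxE eqxx (negbTE ji) mulr0.
Qed.

Lemma enorm_ge0 n (x : 'rV[R]_n) : 0 <= enorm x.
Proof. exact: sqrtr_ge0. Qed.

Lemma enorm_sqr n (x : 'rV[R]_n) : enorm x ^+ 2 = dotp x x.
Proof. by rewrite sqr_sqrtr// dotp_ge0. Qed.

Lemma enormZ n a (x : 'rV[R]_n) : enorm (a *: x) = `|a| * enorm x.
Proof.
by rewrite /enorm dotpZl dotpZr mulrA -expr2 sqrtrM ?sqr_ge0// sqrtr_sqr.
Qed.

Lemma coord_le_enorm n (x : 'rV[R]_n) i : `|x ord0 i| <= enorm x.
Proof.
rewrite -sqrtr_sqr ler_sqrt ?dotp_ge0// /dotp (bigD1 i)//= -expr2 lerDl.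
by apply: sumr_ge0 => j _; rewrite -expr2 sqr_ge0.
Qed.

Lemma enorm_eq0 n (x : 'rV[R]_n) : (enorm x == 0) = (x == 0).
Proof.
apply/eqP/eqP => [x0|->]; last by rewrite /enorm dotp0l sqrtr0.
apply/rowP => i; rewrite mxE; apply/eqP; rewrite -normr_le0 -x0.
exact: coord_le_enorm.
Qed.

Lemma enorm_gt0 n (x : 'rV[R]_n) : (0 < enorm x) = (x != 0).
Proof. by rewrite lt_neqAle enorm_ge0 andbT eq_sym enorm_eq0. Qed.

Lemma enorm_normalize n (x : 'rV[R]_n) :
  x != 0 -> enorm ((enorm x)^-1 *: x) = 1.
Proof.
move=> x0; rewrite enormZ ger0_norm ?invr_ge0 ?enorm_ge0//.
by rewrite mulVf ?enorm_eq0.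
Qed.

Lemma enorm1_neq0 n (x : 'rV[R]_n) : enorm x = 1 -> x != 0.
Proof. by move=> x1; rewrite -enorm_eq0 x1 oner_neq0. Qed.

Lemma enorm1_dotp n (x : 'rV[R]_n) : enorm x = 1 -> dotp x x = 1.
Proof. by rewrite -enorm_sqr => ->; rewrite expr1n. Qed.

Lemma enorm_delta n (i : 'I_n) : enorm (delta_mx ord0 i : 'rV[R]_n) = 1.
Proof. by rewrite /enorm dotp_delta mxE !eqxx sqrtr1. Qed.

(** The Householder reflection in the bisector of two unit vectors exchanges
    them. *)
Lemma unit_vectors_orthogonal n (u w : 'rV[R]_n) :
  enorm u = 1 -> enorm w = 1 ->
  exists2 H : 'M[R]_n, H *m H^T = 1%:M & u *m H = w.
Proof.
move=> u1 w1; pose v : 'rV[R]_n := u - w; pose c := 2 / dotp v v.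
have vv : dotp v v = 2 * dotp u v.
  rewrite /v !(dotpBl, dotpBr) !enorm1_dotp// (dotpC w u); ring.
exists (1%:M - c *: (v^T *m v)).
  have -> : (1%:M - c *: (v^T *m v))^T = 1%:M - c *: (v^T *m v).
    by rewrite raddfB /= linearZ /= trmx1 trmx_mul trmxK.
  have PP : v^T *m v *m (v^T *m v) = dotp v v *: (v^T *m v).
    by rewrite mulmxA -(mulmxA v^T) dotp_mx mul_mx_scalar -scalemxAl.
  move: (v^T *m v) PP => P PP.
  rewrite mulmxBl mul1mx mulmxBr mulmx1 -scalemxAl -scalemxAr PP !scalerA.
  have -> : c * c * dotp v v = c + c.
    have [v0|v0] := eqVneq (dotp v v) 0; last by rewrite -mulrA /c divfK//; ring.
    by rewrite v0 /c v0 invr0 !mulr0 addr0.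
  by rewrite scalerDl opprB addrK subrK.
rewrite mulmxBr mulmx1 -scalemxAr mulmxA dotp_mx mul_scalar_mx scalerA.
have [v0|v0] := eqVneq (dotp v v) 0.
  have /eqP : v == 0 by rewrite -enorm_eq0 /enorm v0 sqrtr0.
  by rewrite /v => v00; rewrite v00 scaler0 subr0; apply/subr0_eq.
rewrite (_ : c * dotp u v = 1).
  by rewrite scale1r /v opprB addrC subrK.
by rewrite /c mulrAC -vv divff.
Qed.

Section frame.
Context (n : nat) (theta : 'rV[R]_n.+1) (theta1 : enorm theta = 1).

Let B := orthonormal_frame theta.

(** An orthogonal matrix whose first row is [theta] exists; its other rows form a
    frame. *)
Lemma orthonormal_frameP : B *m B^T = 1%:M /\ B *m theta^T = 0.
Proof.
rewrite /B /orthonormal_frame.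
apply: (xgetPex 0 (P := [set B | B *m B^T = 1%:M /\ B *m theta^T = 0])).
have [H HH <-] := unit_vectors_orthogonal (enorm_delta ord0) theta1.
have rowE i : row i H = delta_mx ord0 i *m H by rewrite rowE.
have ortho i j : (row i H *m (row j H)^T) = ((i == j)%:R)%:M.
  rewrite !rowE trmx_mul mulmxA -(mulmxA (delta_mx _ _)) HH mulmx1.
  by rewrite dotp_mx dotp_delta mxE eqxx eq_sym.
exists (row' ord0 H); split.
- apply/matrixP => i j; rewrite !mxE.
  have := ortho (lift ord0 i) (lift ord0 j).
  rewrite (inj_eq lift_inj) => /matrixP/(_ ord0 ord0); rewrite !mxE.
  rewrite eqxx mulr1n => <-; apply: eq_bigr => k _; by rewrite !mxE.
- rewrite -rowE; apply/matrixP => i j; rewrite !mxE.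
  have := ortho (lift ord0 i) ord0.
  move=> /matrixP/(_ ord0 ord0); rewrite !mxE eq_sym (negbTE (neq_lift _ _)).
  rewrite mul0rn (ord1 j) => h; rewrite -[RHS]h.
  by apply: eq_bigr => k _; rewrite !mxE.
Qed.

Lemma dotp_frame0 (y : 'rV[R]_n) : dotp (y *m B) theta = 0.
Proof.
have [_ Bt] := orthonormal_frameP.
by rewrite dotpE -mulmxA Bt mulmx0 mxE.
Qed.

Lemma dotp_frame_offset tau (y : 'rV[R]_n) :
  dotp (tau *: theta + y *m B) theta = tau.
Proof. by rewrite dotpDl dotp_frame0 addr0 dotpZl enorm1_dotp// mulr1. Qed.

Lemma dotp_frame tau (y : 'rV[R]_n) :
  dotp (tau *: theta + y *m B) (tau *: theta + y *m B) = tau ^+ 2 + dotp y y.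
Proof.
have [BB _] := orthonormal_frameP.
rewrite dotpDr dotpZr dotp_frame_offset -expr2; congr (_ + _).
rewrite dotpDl dotpZl dotpC dotp_frame0 mulr0 add0r dotp_mull -mulmxA BB.
by rewrite mulmx1.
Qed.

End frame.
End euclidean.

(** * Lebesgue measure on the space of row vectors *)

Section integral_image.
Local Open Scope ereal_scope.
Context d d' (T : measurableType d) (T' : measurableType d') (R : realType).
Context (m : {measure set T -> \bar R}) (m' : {measure set T' -> \bar R}).
Context (phi : T -> T') (mphi : measurable_fun [set: T] phi).

Lemma ge0_integral_image (c : R) (f : T' -> \bar R) : (0 <= c)%R ->
  (forall A, measurable A -> m' A = c%:E * m (phi @^-1` A)) ->
  measurable_fun setT f -> (forall x, 0 <= f x) ->
  \int[m']_x f x = c%:E * \int[m]_x f (phi x).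
Proof.
move=> c0 m'E mf f0.
have := @ge0_integral_pushforward _ _ _ _ _ phi mphi m setT f measurableT mf.
set m1 := (X in \int[X]_(_ in _) _); move=> m1E.
rewrite -[X in _ * X]m1E//.
rewrite -(@ge0_integral_mscale _ _ _ m1 _ measurableT (NngNum c0))//.
by apply: eq_measure_integral => A mA _; rewrite m'E.
Qed.

Lemma integral_image (f : T' -> \bar R) :
  (forall A, measurable A -> m' A = m (phi @^-1` A)) ->
  m.-integrable setT (f \o phi) -> measurable_fun setT f ->
  \int[m']_x f x = \int[m]_x f (phi x).
Proof.
move=> m'E intf mf.
have := @integral_pushforward _ _ _ _ _ phi mphi m setT f mf intf measurableT.
set m1 := (X in \int[X]_(_ in _) _); move=> m1E.
rewrite -[RHS]m1E//.
by apply: eq_measure_integral => A mA _; rewrite m'E.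
Qed.

End integral_image.

Section affine.
Local Open Scope ereal_scope.
Context (R : realType).
Notation leb := (@lebesgue_measure R).

Lemma measurable_affine (a b : R) :
  measurable_fun setT (fun x : measurableTypeR R => a * x + b : measurableTypeR R)%R.
Proof.
by apply: measurable_funD => //; exact: measurable_funM.
Qed.

(** The right-hand side is a measure in [A] with the same values as [leb] on
    half-open intervals. *)
Lemma lebesgue_measure_affine (a b : R) (A : set (measurableTypeR R)) :
  a != 0%R -> measurable A ->
  leb A = `|a|%:E * leb ((fun x => a * x + b)%R @^-1` A).
Proof.
move=> a0 mA.
pose m1 : {measure set (measurableTypeR R) -> \bar R} := mscale (NngNum (normr_ge0 a))
  (measure_function_pushforward__canonical__measure_function_Measure
    leb (measurable_affine a b)).
rewrite -[RHS]/(m1 A).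
apply: lebesgue_measure_unique => // X /ocitvP[->|[[u v]/= uv ->]].
  by rewrite !measure0.
rewrite -[RHS]/(`|a|%:E * leb ((fun x => a * x + b)%R @^-1` `]u, v]%classic)).
have -> : leb `]u, v] = (v - u)%:E.
  by rewrite lebesgue_measure_itv/= lte_fin uv EFinB.
have [agt0|] := ltP 0%R a.
  have -> : (fun x => a * x + b)%R @^-1` `]u, v] = `]((u - b) / a)%R, ((v - b) / a)%R]%classic.
    apply/seteqP; split => x /=; rewrite !in_itv/=.
      by rewrite ltr_pdivrMr// ler_pdivlMr// !(mulrC x) ltrBlDr lerBrDr.
    by rewrite ltr_pdivrMr// ler_pdivlMr// !(mulrC x) ltrBlDr lerBrDr.
  rewrite lebesgue_measure_itv/= lte_fin ltr_pM2r ?invr_gt0// ltrD2r uv.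
  rewrite -EFinB -EFinM gtr0_norm//; congr EFin; field.
  by rewrite gt_eqF.
rewrite le_eqVlt (negbTE a0)/= => alt0.
have -> : (fun x => a * x + b)%R @^-1` `]u, v] = `[((v - b) / a)%R, ((u - b) / a)%R[%classic.
  apply/seteqP; split => x /=; rewrite !in_itv/=.
    by rewrite ler_ndivrMr// ltr_ndivlMr// !(mulrC x) ltrBlDr lerBrDr andbC.
  by rewrite ler_ndivrMr// ltr_ndivlMr// !(mulrC x) ltrBlDr lerBrDr andbC.
rewrite lebesgue_measure_itv/= lte_fin ltr_nM2r ?invr_lt0// ltrD2r uv.
rewrite -EFinB -EFinM ltr0_norm//; congr EFin; field.
by rewrite lt_eqF.
Qed.

Lemma ge0_integral_affine (f : R -> \bar R) (a b : R) : a != 0%R ->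
  measurable_fun setT (f : measurableTypeR R -> _) -> (forall x, 0 <= f x) ->
  \int[leb]_x f x = `|a|%:E * \int[leb]_x f (a * x + b)%R.
Proof.
move=> a0 mf f0; apply: ge0_integral_image => //; first exact: measurable_affine.
by move=> A mA; exact: lebesgue_measure_affine.
Qed.

End affine.

Section rV_measurable.
Context (R : realType) d (T : measurableType d).

Lemma measurable_addrV n (f g : T -> 'rV[R]_n) :
  measurable_fun setT f -> measurable_fun setT g ->
  measurable_fun setT (fun x => f x + g x).
Proof.
move=> mf mg; apply: measurable_fun_rVP => i.
under eq_fun do rewrite mxE.
by apply: measurable_funD; apply: (measurableT_comp (measurable_coord i)).
Qed.

Lemma measurable_scalerV n (a : T -> measurableTypeR R) (f : T -> 'rV[R]_n) :
  measurable_fun setT a -> measurable_fun setT f ->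
  measurable_fun setT (fun x => a x *: f x).
Proof.
move=> ma mf; apply: measurable_fun_rVP => i.
under eq_fun do rewrite mxE.
by apply: measurable_funM => //; apply: (measurableT_comp (measurable_coord i)).
Qed.

Lemma measurable_oppV n (f : T -> 'rV[R]_n) :
  measurable_fun setT f -> measurable_fun setT (fun x => - f x).
Proof.
move=> mf; rewrite (_ : (fun x => _) = fun x => -1 *: f x).
  exact: measurable_scalerV.
by apply/funext => x; rewrite scaleN1r.
Qed.

Lemma measurable_mulmxrV m n (M : 'M[R]_(m, n)) (f : T -> 'rV[R]_m) :
  measurable_fun setT f -> measurable_fun setT (fun x => f x *m M).
Proof.
move=> mf; apply: measurable_fun_rVP => i.
under eq_fun do rewrite mxE.
apply: measurable_sum => j; apply: measurable_funM => //.
by apply: (measurableT_comp (measurable_coord j)).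
Qed.

End rV_measurable.

Section rV_integral.
Local Open Scope ereal_scope.
Context (R : realType).
Notation leb := (@lebesgue_measure R).
Notation mu := (lebesgue_rV R).

Lemma measurable_rV_pair n (g : 'rV[R]_n.+1 -> \bar R) : measurable_fun setT g ->
  measurable_fun setT (g \o @rV_cons R n).
Proof. by move=> mg; apply: (measurableT_comp mg); exact: measurable_rV_cons. Qed.

Lemma ge0_integral_rV_cons n (f : 'rV[R]_n.+1 -> \bar R) :
  measurable_fun setT f -> (forall x, 0 <= f x) ->
  \int[mu n.+1]_x f x = \int[leb]_a \int[mu n]_y f (rV_cons (a, y)).
Proof.
move=> mf f0.
rewrite (@ge0_integral_image _ _ _ _ _ (leb \x mu n) _ _ (@measurable_rV_cons R n) 1%R)//.
  rewrite mul1e fubini_tonelli1//; exact: measurable_rV_pair.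
by move=> A mA; rewrite mul1e.
Qed.

Lemma measurable_integral_rV_cons n (f : 'rV[R]_n.+1 -> \bar R) :
  measurable_fun setT f -> (forall x, 0 <= f x) ->
  measurable_fun [set: measurableTypeR R]
    (fun a => \int[mu n]_y f (rV_cons (a, y))).
Proof.
move=> mf f0.
by apply: (measurable_fun_fubini_tonelli_F (f \o @rV_cons R n));
  [exact: measurable_rV_pair|move=> z; exact: f0].
Qed.

Lemma measurable_rV_slice n (f : 'rV[R]_n.+1 -> \bar R) a :
  measurable_fun setT f ->
  measurable_fun [set: 'rV[R]_n] (fun y => f (rV_cons (a, y))).
Proof. by move=> /measurable_rV_pair /measurable_fun_pair2; exact. Qed.

Lemma integral_rV0 (f : 'rV[R]_0 -> \bar R) : measurable_fun setT f ->
  \int[mu 0]_x f x = f 0%R.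
Proof. by move=> mf; rewrite integral_dirac// diracE mem_set// mul1e. Qed.

Opaque lebesgue_rV.

Lemma ge0_integral_rV_translate n (c : 'rV[R]_n) (f : 'rV[R]_n -> \bar R) :
  measurable_fun setT f -> (forall x, 0 <= f x) ->
  \int[mu n]_x f (x + c)%R = \int[mu n]_x f x.
Proof.
elim: n c f => [|n IHn] c f mf f0.
  by apply: eq_integral => x _; congr f; apply/rowP => -[].
have mfc : measurable_fun [set: 'rV[R]_n.+1] (fun x => f (x + c)%R).
  by apply: (measurableT_comp mf); exact: measurable_addrV.
rewrite (ge0_integral_rV_cons mf f0) (ge0_integral_rV_cons mfc); last by [].
pose F a := \int[mu n]_y f (rV_cons (a, y)).
rewrite -[RHS]/(\int[leb]_a F a).
rewrite (@ge0_integral_affine _ F 1 (c ord0 ord0)); last 3 first.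
- exact: oner_neq0.
- exact: measurable_integral_rV_cons.
- by move=> a; exact: integral_ge0.
rewrite normr1 mul1e; apply: eq_integral => a _; rewrite /F.
rewrite -[RHS](IHn (@rsubmx R 1 1 n c)); last 2 first.
- exact: measurable_rV_slice.
- by move=> y.
apply: eq_integral => y _; congr f.
rewrite /rV_cons/= mul1r -[c in LHS](@hsubmxK _ 1 1 n).
rewrite (@add_row_mx _ 1 1 n); congr (@row_mx _ 1 1 n).
apply/matrixP => i j; rewrite !ord1 !mxE eqxx !mulr1n; congr (_ + c _ _)%R.
exact/val_inj.
Qed.

Lemma ge0_integral_rV_scale n (c : R) (f : 'rV[R]_n -> \bar R) : c != 0%R ->
  measurable_fun setT f -> (forall x, 0 <= f x) ->
  \int[mu n]_x f x = (`|c| ^+ n)%:E * \int[mu n]_x f (c *: x)%R.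
Proof.
move=> c0; elim: n f => [|n IHn] f mf f0.
  rewrite mul1e; apply: eq_integral => x _; congr f; apply/rowP => -[].
  by [].
have mfc : measurable_fun [set: 'rV[R]_n.+1] (fun x => f (c *: x)%R).
  by apply: (measurableT_comp mf); exact: measurable_scalerV.
rewrite (ge0_integral_rV_cons mf f0) (ge0_integral_rV_cons mfc); last by [].
pose F a := \int[mu n]_y f (rV_cons (a, y)).
rewrite -[LHS]/(\int[leb]_a F a).
rewrite (@ge0_integral_affine _ F c 0); last 3 first.
- exact: c0.
- exact: measurable_integral_rV_cons.
- by move=> a; exact: integral_ge0.
rewrite exprS EFinM -muleA; congr (_ * _).
rewrite -ge0_integralZl//; last 2 first.
- exact: (measurable_integral_rV_cons mfc).
- by move=> a _; exact: integral_ge0.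
apply: eq_integral => a _; rewrite /F.
rewrite IHn//; last exact: measurable_rV_slice.
congr (_ * _); apply: eq_integral => y _; congr f.
by rewrite addr0 /rV_cons (@scale_row_mx _ 1 1 n) scale_scalar_mx.
Qed.

Definition gauss_rV n (x : 'rV[R]_n) : R := expR (- dotp x x).

Lemma measurable_gauss_rV n : measurable_fun setT (fun x : 'rV[R]_n => (gauss_rV x)%:E).
Proof.
apply/measurable_EFinP; apply: (measurableT_comp (@measurable_expR R)).
by apply: measurable_funN; exact: measurable_dotp.
Qed.

Lemma dotp_cons n (a b : R) (x y : 'rV[R]_n) :
  dotp (rV_cons (a, x)) (rV_cons (b, y)) = (a * b + dotp x y)%R.
Proof.
rewrite dotpE /rV_cons /= (@tr_row_mx _ 1 1 n) (@mul_row_col _ 1 1 n 1) mxE -dotpE.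
by rewrite -dotpE /dotp big_ord1 !mxE eqxx !mulr1n.
Qed.

Lemma integral_gauss_rV n : \int[mu n]_x (gauss_rV x)%:E = (Num.sqrt pi ^+ n)%:E.
Proof.
elim: n => [|n IHn].
  rewrite integral_rV0; last exact: measurable_gauss_rV.
  by rewrite /gauss_rV dotp0l oppr0 expR0.
rewrite ge0_integral_rV_cons; last 2 first.
- exact: measurable_gauss_rV.
- by move=> x; rewrite lee_fin expR_ge0.
have E a : \int[mu n]_y (gauss_rV (rV_cons (a, y)))%:E =
    (Num.sqrt pi ^+ n)%:E * (gauss_fun a)%:E.
  under eq_integral => y _ do
    rewrite /gauss_rV dotp_cons opprD expRD EFinM -/(gauss_rV y) -expr2.
  rewrite ge0_integralZl ?IHn 1?muleC//; first exact: measurable_gauss_rV.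
  by move=> y _; rewrite lee_fin expR_ge0.
under eq_integral do rewrite E.
rewrite ge0_integralZl//; first by rewrite integralT_gauss exprSr EFinM.
  by apply/measurable_EFinP; exact: measurable_gauss_fun.
by move=> x _; rewrite lee_fin expR_ge0.
Qed.

Let sqrt_pi_neq0 n : (Num.sqrt pi ^+ n != 0 :> R)%R.
Proof. by rewrite expf_neq0// gt_eqF// sqrtr_gt0 pi_gt0. Qed.

(** Both sides of [I(f o M) * I(g) = I(f) * I(g)], with [g] the rotation
    invariant Gaussian, are values of the same double integral
    [\int\int f (x M) g (y) dy dx]; only translations, Tonelli's theorem and
    the symmetry [y |-> - y] are used, so no determinant has to be computed. *)
Lemma ge0_integral_rV_orthogonal n (M : 'M[R]_n) (f : 'rV[R]_n -> \bar R) :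
  M *m M^T = 1%:M -> measurable_fun setT f -> (forall x, 0 <= f x) ->
  \int[mu n]_x f (x *m M) = \int[mu n]_x f x.
Proof.
move=> MM mf f0.
have MTM : M^T *m M = 1%:M by rewrite mulmx1C.
pose g (x : 'rV[R]_n) : \bar R := (gauss_rV x)%:E.
have mg : measurable_fun setT g by exact: measurable_gauss_rV.
have g0 x : 0 <= g x by rewrite lee_fin expR_ge0.
have gM x : g (x *m M) = g x.
  by rewrite /g /gauss_rV dotp_mull -mulmxA MM mulmx1.
have mM : measurable_fun [set: 'rV[R]_n] (fun x => x *m M).
  exact: measurable_mulmxrV.
have mfM : measurable_fun [set: 'rV[R]_n] (fun x => f (x *m M)).
  exact: (measurableT_comp mf).
have mfN : measurable_fun [set: 'rV[R]_n] (fun x => f (- x)%R).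
  by apply: (measurableT_comp mf); exact: measurable_oppV.
have Ig0 : 0 <= \int[mu n]_x g x by exact: integral_ge0.
have IgE : \int[mu n]_x g x = (Num.sqrt pi ^+ n)%:E by exact: integral_gauss_rV.
have fN : \int[mu n]_x f (- x)%R = \int[mu n]_x f x.
  rewrite [RHS](@ge0_integral_rV_scale _ (-1))// ?oppr_eq0 ?oner_eq0//.
  rewrite normrN1 expr1n mul1e.
  by apply: eq_integral => x _; rewrite scaleN1r.
have mfst : measurable_fun [set: 'rV[R]_n * 'rV[R]_n] fst by exact: measurable_fst.
have msnd : measurable_fun [set: 'rV[R]_n * 'rV[R]_n] snd by exact: measurable_snd.
have : \int[mu n]_x \int[mu n]_y (f (x *m M) * g y) =
       \int[mu n]_x \int[mu n]_y (f (- y)%R * g x).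
  transitivity (\int[mu n]_x \int[mu n]_y (f (x *m M) * g (y + x *m M)%R)).
    apply: eq_integral => x _.
    pose h y := f (x *m M) * g y.
    rewrite -(@ge0_integral_rV_translate _ (x *m M) h)//.
    - by apply: emeasurable_funM => //; exact: measurable_cst.
    - by move=> y; rewrite mule_ge0.
  transitivity (\int[mu n]_y \int[mu n]_x (f (x *m M) * g (y + x *m M)%R)).
    pose h (z : 'rV[R]_n * 'rV[R]_n) := f (z.1 *m M) * g (z.2 + z.1 *m M)%R.
    apply: (@fubini_tonelli _ _ _ _ _ (mu n) (mu n) h).
      apply: emeasurable_funM.
        by apply: (measurableT_comp mf); exact: measurable_mulmxrV.
      apply: (measurableT_comp mg); apply: measurable_addrV => //.
      exact: measurable_mulmxrV.
    by move=> z; rewrite mule_ge0.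
  transitivity (\int[mu n]_y \int[mu n]_x (f (x *m M - y)%R * g x)).
    apply: eq_integral => y _.
    pose h x := f (x *m M) * g (y + x *m M)%R.
    rewrite -(@ge0_integral_rV_translate _ (- (y *m M^T)) h).
    - apply: eq_integral => x _; rewrite /h.
      by rewrite mulmxBl -mulmxA MTM mulmx1 addrCA subrr addr0 gM.
    - apply: emeasurable_funM => //.
      by apply: (measurableT_comp mg); exact: measurable_addrV.
    - by move=> x; rewrite mule_ge0.
  transitivity (\int[mu n]_x \int[mu n]_y (f (x *m M - y)%R * g x)).
    pose h (z : 'rV[R]_n * 'rV[R]_n) := f (z.2 *m M - z.1)%R * g z.2.
    apply: (@fubini_tonelli _ _ _ _ _ (mu n) (mu n) h).
      apply: emeasurable_funM; last exact: (measurableT_comp mg).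
      apply: (measurableT_comp mf); apply: measurable_addrV.
        exact: measurable_mulmxrV.
      exact: measurable_oppV.
    by move=> z; rewrite mule_ge0.
  apply: eq_integral => x _ /=.
  pose h y := f (x *m M - y)%R * g x.
  rewrite -(@ge0_integral_rV_translate _ (x *m M) h).
  - apply: eq_integral => y _; rewrite /h.
    by rewrite opprD addrCA subrr addr0.
  - apply: emeasurable_funM => //.
    apply: (measurableT_comp mf); apply: measurable_addrV => //.
    exact: measurable_oppV.
  - by move=> y; rewrite mule_ge0.
move=> H.
have e1 : \int[mu n]_x \int[mu n]_y (f (x *m M) * g y) =
    (\int[mu n]_x f (x *m M)) * \int[mu n]_x g x.
  rewrite -ge0_integralZr; [|by []..].
  by apply: eq_integral => x _; rewrite ge0_integralZl.
have e2 : \int[mu n]_x \int[mu n]_y (f (- y)%R * g x) =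
    (\int[mu n]_x f x) * \int[mu n]_x g x.
  rewrite -ge0_integralZl; [|by []..|exact: integral_ge0].
  apply: eq_integral => x _; rewrite -fN.
  by apply: ge0_integralZr.
have := etrans (esym e1) (etrans H e2); rewrite IgE => fMg.
have : (Num.sqrt pi ^+ n)^-1%:E * (Num.sqrt pi ^+ n)%:E = 1 :> \bar R.
  by rewrite -EFinM mulVf// sqrt_pi_neq0.
move=> cK; rewrite -[LHS]mule1 -[RHS]mule1 -cK !muleA.
by rewrite muleAC fMg muleAC.
Qed.

Section frame_integral.
Context (n : nat) (theta : 'rV[R]_n.+1) (theta1 : enorm theta = 1%R).
Notation B := (orthonormal_frame theta).

Definition frame_coord (z : measurableTypeR R * 'rV[R]_n) : 'rV[R]_n.+1 :=
  (z.1 *: theta + z.2 *m B)%R.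

Lemma measurable_frame_coord : measurable_fun setT frame_coord.
Proof.
apply: measurable_addrV.
  by apply: measurable_scalerV; [exact: measurable_fst|exact: measurable_cst].
by apply: measurable_mulmxrV; exact: measurable_snd.
Qed.

Let M : 'M[R]_n.+1 := @col_mx R 1 n n.+1 theta B.

Let MM : M *m M^T = 1%:M.
Proof.
have [BB Bt] := orthonormal_frameP theta1.
rewrite /M (@tr_col_mx _ 1 n) (@mul_col_row _ 1 n _ 1 n) BB Bt.
have -> : theta *m B^T = 0%R by rewrite -[LHS]trmxK trmx_mul trmxK Bt trmx0.
by rewrite dotp_mx enorm1_dotp// -scalar_mx_block.
Qed.

Lemma frame_coordE z : frame_coord z = rV_cons z *m M.
Proof. by rewrite /rV_cons /M (@mul_row_col _ 1 1 n n.+1) mul_scalar_mx. Qed.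

Lemma ge0_integral_frame (f : 'rV[R]_n.+1 -> \bar R) :
  measurable_fun setT f -> (forall x, 0 <= f x) ->
  \int[mu n.+1]_x f x = \int[leb]_tau \int[mu n]_y f (frame_coord (tau, y)).
Proof.
move=> mf f0; rewrite -(ge0_integral_rV_orthogonal MM)//.
have mfM : measurable_fun [set: 'rV[R]_n.+1] (fun x => f (x *m M)).
  by apply: (measurableT_comp mf); exact: measurable_mulmxrV.
rewrite (ge0_integral_rV_cons mfM); last by [].
by apply: eq_integral => a _; apply: eq_integral => y _; rewrite frame_coordE.
Qed.

Lemma lebesgue_rV_frame (A : set 'rV[R]_n.+1) : measurable A ->
  mu n.+1 A = (leb \x mu n) (frame_coord @^-1` A).
Proof.
move=> mA.
have mpA : measurable (frame_coord @^-1` A).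
  by rewrite -[X in measurable X]setTI; exact: measurable_frame_coord.
rewrite -[A in LHS]setIT -integral_indic//.
rewrite -[X in (_ \x _) X]setIT -integral_indic//.
rewrite ge0_integral_frame//; last first.
  by apply/measurable_EFinP; exact: measurable_indic.
rewrite fubini_tonelli1//.
by apply/measurable_EFinP; exact: measurable_indic.
Qed.

Lemma integral_frame (f : 'rV[R]_n.+1 -> R) :
  measurable_fun setT f ->
  (leb \x mu n).-integrable setT (EFin \o f \o frame_coord) ->
  \int[mu n.+1]_x (f x)%:E =
  \int[leb]_tau \int[mu n]_y (f (frame_coord (tau, y)))%:E.
Proof.
move=> mf intf.
rewrite (integral_image measurable_frame_coord lebesgue_rV_frame)//; last first.
  exact/measurable_EFinP.
by rewrite -integral12_prod_meas1.
Qed.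

Lemma integrable_frame (f : 'rV[R]_n.+1 -> R) :
  measurable_fun setT f ->
  (mu n.+1).-integrable setT (EFin \o f) ->
  (leb \x mu n).-integrable setT (EFin \o f \o frame_coord).
Proof.
move=> mf /integrableP[mf' foo]; apply/integrableP; split.
  exact: (measurableT_comp mf' measurable_frame_coord).
have mg : measurable_fun setT (fun x => `|(f x)%:E|).
  by apply: measurableT_comp.
rewrite fubini_tonelli1//=; first by move: foo; rewrite ge0_integral_frame.
exact: (measurableT_comp mg measurable_frame_coord).
Qed.

End frame_integral.

End rV_integral.

(** * Measurability of continuous functions *)

Section continuous_measurable.
Context (R : realType).

(** A pointwise limit of functions that factor through a countable type is
    measurable; here [e k \o c k] is a rounding map tending to the identity. *)
Lemma measurable_fun_rounding d (T : measurableType d) (I : countType)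
    (c : nat -> T -> I) (e : nat -> I -> T) (U : set T) (f : T -> R) :
  measurable U -> (forall k i, measurable (c k @^-1` [set i])) ->
  (forall x, U x -> f (e k (c k x)) @[k --> \oo] --> f x) ->
  measurable_fun U f.
Proof.
move=> mU mc fc; apply: (measurable_fun_cvg (h := fun k x => f (e k (c k x)))) => //.
move=> k; apply: measurable_funTS => _ A mA; rewrite setTI.
pose F m := if unpickle m is Some i then
  if pselect (A (f (e k i))) then c k @^-1` [set i] else set0 else set0.
have -> : (fun x => f (e k (c k x))) @^-1` A = \bigcup_m F m.
  apply/seteqP; split => x /=.
    move=> Ax; exists (pickle (c k x)) => //; rewrite /F pickleK.
    by case: pselect.
  move=> [m _]; rewrite /F; case: unpickle => // i.
  by case: pselect => // Ai /= cki; rewrite cki.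
apply: bigcupT_measurable => m; rewrite /F.
case: unpickle => [i|]; last exact: measurable0.
by case: pselect => [?|?]; [exact: mc|exact: measurable0].
Qed.

Let rnd (k : nat) (t : R) : int := Num.floor (k.+1%:R * t).
Let unrnd (k : nat) (i : int) : R := i%:~R / k.+1%:R.

Let measurable_rnd k i : measurable ((rnd k : measurableTypeR R -> int) @^-1` [set i]).
Proof.
rewrite (_ : _ @^-1` _ = (fun t => k.+1%:R * t) @^-1` `[i%:~R, (i + 1)%:~R[%classic).
  rewrite -[X in measurable X]setTI.
  have mk : measurable_fun [set: measurableTypeR R]
    (fun t : measurableTypeR R => k.+1%:R * t : measurableTypeR R).
    exact: measurable_funM.
  by apply: mk => //; exact: measurable_itv.
apply/seteqP; split => t /=; rewrite in_itv/= /rnd.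
  by move=> <-; exact: floor_itv.
exact: floor_def.
Qed.

Let rnd_near k t : `|unrnd k (rnd k t) - t| <= k.+1%:R^-1.
Proof.
have k0 : 0 < k.+1%:R :> R by rewrite ltr0n.
have -> : unrnd k (rnd k t) - t = ((rnd k t)%:~R - k.+1%:R * t) / k.+1%:R.
  by rewrite /unrnd mulrBl (mulrC k.+1%:R) mulfK// lt0r_neq0.
rewrite normrM (gtr0_norm (x := _^-1)) ?invr_gt0// ler_piMl ?invr_ge0 ?ltW//.
have /andP[h1 h2] := floor_itv (k.+1%:R * t).
by rewrite distrC ger0_norm ?subr_ge0// ltrBlDr addrC -[1]/(1%:~R) -intrD.
Qed.

Let inv_cvg0 : (k.+1%:R^-1 : R) @[k --> \oo] --> (0 : R).
Proof. exact: cvg_harmonic. Qed.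

Lemma cvg_rV n (u : nat -> 'rV[R]_n) (x : 'rV[R]_n) (e : nat -> R) :
  e k @[k --> \oo] --> (0 : R) ->
  (forall k i, `|u k ord0 i - x ord0 i| <= e k) -> u k @[k --> \oo] --> x.
Proof.
move=> e0 ux; apply/cvg_ballP => eps eps0.
move/cvgrPdist_lt : e0 => /(_ eps eps0) /=; apply: filterS => k.
rewrite sub0r normrN => ek; split => // i j.
rewrite /ball/= !ord1 distrC; apply: le_lt_trans (ux k j) _.
exact: le_lt_trans (ler_norm _) ek.
Qed.

Lemma measurable_continuous_pair n (U : set (measurableTypeR R * 'rV[R]_n))
    (f : R * 'rV[R]_n -> R) :
  measurable U -> (forall z, U z -> {for z, continuous f}) ->
  measurable_fun U (f : measurableTypeR R * 'rV[R]_n -> R).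
Proof.
move=> mU cf.
pose c (k : nat) (z : measurableTypeR R * 'rV[R]_n) : int * {ffun 'I_n -> int} :=
  (rnd k z.1, [ffun i => rnd k (z.2 ord0 i)]).
pose e (k : nat) (i : int * {ffun 'I_n -> int}) : measurableTypeR R * 'rV[R]_n :=
  (unrnd k i.1, \row_j unrnd k (i.2 j)).
apply: (measurable_fun_rounding (c := c) (e := e)) => //.
- move=> k [i v].
  rewrite (_ : _ @^-1` _ = (fst @^-1` (rnd k @^-1` [set i])) `&`
     \bigcap_(j in [set: 'I_n]) (snd @^-1` ((fun x : 'rV[R]_n => x ord0 j) @^-1`
       (rnd k @^-1` [set v j])))).
    apply: measurableI.
      rewrite -[X in measurable X]setTI.
      apply: measurable_fst => //; exact: measurable_rnd.
    apply: fin_bigcap_measurable => // j _.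
    rewrite -[X in measurable X]setTI; apply: measurable_snd => //.
    rewrite -[X in measurable X]setTI; apply: measurable_coord => //.
  apply/seteqP; split => z /=.
    by move=> [<- <-]; split => // j _ /=; rewrite ffunE.
  move=> [zi zv]; rewrite /c zi; congr (_, _); apply/ffunP => j; rewrite ffunE.
  exact: zv.
- move=> z Uz.
  apply: (cvg_comp (fun k => e k (c k z)) f); last exact: (cf z Uz).
  rewrite {2}(_ : z = (z.1, z.2)); last by case: z {Uz}.
  have c1 : unrnd k (rnd k z.1) @[k --> \oo] --> z.1.
    apply/cvgrPdist_le => /= eps eps0.
    move/cvgrPdist_le : inv_cvg0 => /(_ eps eps0); apply: filterS => k.
    rewrite sub0r normrN ger0_norm ?invr_ge0// => kE.
    by rewrite distrC (le_trans (rnd_near _ _)).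
  have c2 : (\row_j unrnd k ([ffun i => rnd k (z.2 ord0 i)] j))
      @[k --> \oo] --> z.2.
    apply: (cvg_rV inv_cvg0) => k j; rewrite mxE ffunE.
    exact: rnd_near.
  exact: (cvg_pair c1 c2).
Qed.

Lemma measurable_continuous_rV n (f : 'rV[R]_n -> R) :
  continuous f -> measurable_fun [set: 'rV[R]_n] f.
Proof.
move=> cf.
have m2 : measurable_fun [set: measurableTypeR R * 'rV[R]_n] (fun z => f z.2).
  apply: measurable_continuous_pair => // z _.
  by apply: (continuous_comp (f := snd)); [exact: cvg_snd|exact: cf].
exact: (@measurable_fun_pair2 _ _ _ _ _ _ _ (0 : measurableTypeR R) m2).
Qed.

Lemma measurable_invr : measurable_fun [set: measurableTypeR R] (fun t : R => t^-1).
Proof.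
rewrite (_ : (fun t : R => t^-1) = fun t => t * (`|t| `^ (-1)) ^+ 2).
  apply: measurable_funM => //; apply: measurable_funX.
  by apply: (measurableT_comp (measurable_powR _)); exact: normr_measurable.
apply/funext => t; rewrite powR_inv1// exprVn real_normK ?num_real//.
have [->|t0] := eqVneq t 0; first by rewrite invr0 mul0r.
by rewrite expr2 invfM mulrA divff// mul1r.
Qed.

End continuous_measurable.

(** * Integrable majorants *)

Section decay.
Context (R : realType).
Notation leb := (@lebesgue_measure R).
Notation mu := (lebesgue_rV R).

(** A majorant which is a product of one-variable functions, hence integrable by
    Tonelli's theorem. *)
Definition decay n (x : 'rV[R]_n) : R := \prod_(i < n) (1 + x ord0 i ^+ 2)^-1.

Lemma onePsqr_gt0 (a : R) : 0 < 1 + a ^+ 2.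
Proof. by rewrite ltr_wpDr ?sqr_ge0. Qed.

Lemma decay_gt0 n (x : 'rV[R]_n) : 0 < decay x.
Proof. by apply: prodr_gt0 => i _; rewrite invr_gt0 onePsqr_gt0. Qed.

Lemma decay_ge0 n (x : 'rV[R]_n) : 0 <= decay x.
Proof. exact/ltW/decay_gt0. Qed.

Lemma decay_cons n a (y : 'rV[R]_n) :
  decay (rV_cons (a, y)) = (1 + a ^+ 2)^-1 * decay y.
Proof.
rewrite /decay big_ord_recl; congr (_ * _).
  rewrite /rV_cons (_ : ord0 = @lshift 1 n ord0); last exact/val_inj.
  by rewrite (row_mxEl a%:M y) mxE eqxx mulr1n.
apply: eq_bigr => i _.
rewrite /rV_cons (_ : lift ord0 i = @rshift 1 n i); last exact/val_inj.
by rewrite (row_mxEr a%:M y).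
Qed.

Lemma decay_cons_le n a (y : 'rV[R]_n) : decay (rV_cons (a, y)) <= decay y.
Proof.
rewrite decay_cons ler_piMl ?decay_ge0// invf_le1 ?onePsqr_gt0//.
by rewrite lerDl sqr_ge0.
Qed.

Lemma decay_ge n (x : 'rV[R]_n) : (1 + dotp x x) ^- n <= decay x.
Proof.
rewrite /decay prodfV lef_pV2 ?posrE ?exprn_gt0 ?prodr_gt0 ?ltr_wpDr ?dotp_ge0//; last first.
  by move=> i _; exact: onePsqr_gt0.
rewrite [leRHS](_ : _ = \prod_(i < n) (1 + dotp x x)); last first.
  by rewrite prodr_const card_ord.
apply: ler_prod => i _.
rewrite ltW ?onePsqr_gt0//= lerD2l -enorm_sqr -[x ord0 i ^+ 2]real_normK ?num_real//.
by rewrite lerXn2r ?nnegrE ?enorm_ge0// coord_le_enorm.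
Qed.

Lemma measurable_decay n : measurable_fun [set: 'rV[R]_n] (@decay n).
Proof.
rewrite /decay; apply: measurable_prod => i _.
rewrite (_ : (fun x => _) = fun x : 'rV[R]_n => (1 + x ord0 i ^+ 2) `^ (-1)).
  apply: (measurableT_comp (measurable_powR _)); apply: measurable_funD => //.
  by apply: measurable_funX; exact: measurable_coord.
by apply/funext => x; rewrite powR_inv1// ltW// onePsqr_gt0.
Qed.

Lemma integral_oneDsqr : (\int[leb]_t ((1 + t ^+ 2)^-1)%:E = pi%:E)%E.
Proof.
rewrite (@ge0_symfun_integralT _ (fun t => (1 + t ^+ 2)^-1)).
- rewrite (_ : [set x | _] = `[0, +oo[%classic).
    have := @integral0y_oneDsqr R; rewrite /oneDsqr => ->.
    by rewrite -EFinM; congr EFin; field.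
  by apply/seteqP; split => x /=; rewrite in_itv/= andbT.
- by move=> x; rewrite invr_ge0 ltW// onePsqr_gt0.
- exact: continuous_oneDsqrV.
- by move=> x /=; rewrite sqrrN.
Qed.

Lemma measurable_oneDsqrV :
  measurable_fun [set: measurableTypeR R] (fun t : R => (1 + t ^+ 2)^-1).
Proof. by apply: continuous_measurable_fun; exact: continuous_oneDsqrV. Qed.

Lemma integral_decay n : (\int[mu n]_x (decay x)%:E = (pi ^+ n)%:E)%E.
Proof.
elim: n => [|n IHn].
  rewrite integral_rV0 ?/decay ?big_ord0//.
  by apply/measurable_EFinP; exact: measurable_decay.
rewrite ge0_integral_rV_cons; last 2 first.
- by apply/measurable_EFinP; exact: measurable_decay.
- by move=> x; rewrite lee_fin decay_ge0.
have E a : (\int[mu n]_y (decay (rV_cons (a, y)))%:E =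
    (pi ^+ n)%:E * ((1 + a ^+ 2)^-1)%:E)%E.
  under eq_integral do rewrite decay_cons EFinM.
  rewrite ge0_integralZl ?IHn 1?muleC//.
  - by apply/measurable_EFinP; exact: measurable_decay.
  - by move=> y _; rewrite lee_fin decay_ge0.
  - by rewrite lee_fin invr_ge0 ltW// onePsqr_gt0.
under eq_integral do rewrite E.
rewrite ge0_integralZl//.
- by rewrite integral_oneDsqr exprSr EFinM.
- by apply/measurable_EFinP; exact: measurable_oneDsqrV.
- by move=> a _; rewrite lee_fin invr_ge0 ltW// onePsqr_gt0.
- by rewrite lee_fin exprn_ge0// pi_ge0.
Qed.

Lemma integrable_decay n (C : R) : (mu n).-integrable setT (fun x => (C * decay x)%:E).
Proof.
under eq_fun do rewrite EFinM.
apply: integrableZl => //; apply/integrableP; split.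
  by apply/measurable_EFinP; exact: measurable_decay.
under eq_integral do rewrite gee0_abs ?lee_fin ?decay_ge0//.
by rewrite integral_decay ltry.
Qed.

Lemma integrable_le_decay n (C : R) (f : 'rV[R]_n -> R) :
  measurable_fun setT f -> (forall x, `|f x| <= C * decay x) ->
  (mu n).-integrable setT (EFin \o f).
Proof.
move=> mf fC; apply: (le_integrable _ _ _ (integrable_decay n C)) => //.
  exact/measurable_EFinP.
by move=> x _ /=; rewrite lee_fin (le_trans (fC x))// ler_norm.
Qed.

End decay.

(** * Passing to the limit under the integral sign *)

Section cvg_under_integral.
Context (R : realType) (V : normedModType R).

Lemma cvg_sequential (f : V -> R) (z : V) (l : R) :
  (forall u : nat -> V, u k @[k --> \oo] --> z -> f (u k) @[k --> \oo] --> l) ->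
  f x @[x --> z] --> l.
Proof.
move=> fu; apply/cvgrPdist_lt => e e0; apply: contrapT => nfz.
have /choice[u uP] : forall k : nat, exists x : V,
    `|z - x| < k.+1%:R^-1 /\ ~ `|l - f x| < e.
  move=> k; apply: contrapT => nx; apply: nfz; apply/nbhs_normP.
  exists k.+1%:R^-1; first by rewrite /= invr_gt0.
  move=> x /= zx; apply: contrapT => nlx; apply: nx; exists x; split => //.
have uz : u k @[k --> \oo] --> z.
  apply/cvgrPdist_lt => eps eps0.
  have /cvgrPdist_lt/(_ eps eps0) := @cvg_harmonic R; apply: filterS => k /=.
  rewrite sub0r normrN ger0_norm ?invr_ge0// => keps.
  by have [zu _] := uP k; exact: lt_trans zu keps.
have /cvgrPdist_lt/(_ e e0)[N _ /(_ N (leqnn N))] := fu u uz.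
by have [_] := uP N.
Qed.

Lemma cvg_Rintegral d (T : measurableType d) (mu : {measure set T -> \bar R})
    (F : V -> T -> R) (G : T -> R) (z : V) :
  (forall x, measurable_fun setT (F x)) ->
  (forall y, F x y @[x --> z] --> F z y) ->
  mu.-integrable setT (EFin \o G) ->
  (forall x y, `|F x y| <= G y) ->
  (\int[mu]_y F x y)%R @[x --> z] --> (\int[mu]_y F z y)%R.
Proof.
move=> mF cF iG FG; apply: cvg_sequential => u uz.
have iF : mu.-integrable setT (EFin \o F z).
  apply: (le_integrable _ _ _ iG) => //; first exact/measurable_EFinP.
  by move=> y _; rewrite lee_fin (le_trans (FG z y))// ler_norm.
apply: fine_cvg; rewrite fineK; last exact: integrable_fin_num.
apply: (@dominated_cvg _ _ _ mu _ measurableT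
  (fun k y => (F (u k) y)%:E) _ (EFin \o G)) => //=.
- by move=> k; exact/measurable_EFinP.
- move=> y _; apply: cvg_EFin; first exact: nearW.
  exact: (cvg_comp u (fun x => F x y) uz (cF y)).
- by move=> k y _; rewrite lee_fin.
Qed.

End cvg_under_integral.

(** * Continuity of the Euclidean operations *)

Section cvg_euclidean.
Context (R : realType) (n : nat) (T : Type) (F : set_system T) (FF : Filter F).

Lemma cvg_dotp (f g : T -> 'rV[R]_n) (a b : 'rV[R]_n) :
  f x @[x --> F] --> a -> g x @[x --> F] --> b ->
  dotp (f x) (g x) @[x --> F] --> dotp a b.
Proof.
move=> fa gb; rewrite /dotp; elim: (index_enum _) => [|i r IHr].
  by under eq_fun do rewrite big_nil; rewrite big_nil; exact: cvg_cst.
under eq_fun do rewrite big_cons; rewrite big_cons; apply: cvgD; last exact: IHr.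
have coordi c : {for c, continuous (fun x : 'rV[R]_n => x ord0 i)}.
  exact: coord_continuous.
apply: cvgM; first exact: (cvg_comp f _ fa (coordi a)).
exact: (cvg_comp g _ gb (coordi b)).
Qed.

Lemma cvg_enorm (f : T -> 'rV[R]_n) (a : 'rV[R]_n) :
  f x @[x --> F] --> a -> enorm (f x) @[x --> F] --> enorm a.
Proof.
move=> fa; have fafa := cvg_dotp fa fa.
exact: (cvg_comp (fun x => dotp (f x) (f x)) Num.sqrt fafa (@sqrt_continuous _ _)).
Qed.

End cvg_euclidean.

(** * The Radon transform of tame functions *)

Section tame.
Context (R : realType).
Notation leb := (@lebesgue_measure R).
Notation mu := (lebesgue_rV R).

(** Continuity and this decay are all that the Fourier slice theorem and the
    norm identity use; unlike smoothness, they survive taking absolute values. *)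
Definition tame n (f : 'rV[R]_n -> R) : Prop :=
  continuous f /\ exists C, forall x, `|f x| <= C * (1 + dotp x x) ^- n.

Lemma tame_measurable n (f : 'rV[R]_n -> R) :
  tame f -> measurable_fun setT f.
Proof. by case=> cf _; exact: measurable_continuous_rV. Qed.

Lemma tameD n (f g : 'rV[R]_n -> R) : tame f -> tame g -> tame (fun x => f x + g x).
Proof.
move=> [cf [C fC]] [cg [D gD]]; split; first by move=> x; exact: cvgD (cf x) (cg x).
exists (C + D) => x; rewrite mulrDl (le_trans (ler_normD _ _))//.
exact: lerD.
Qed.

Lemma tameZ n c (f : 'rV[R]_n -> R) : tame f -> tame (fun x => c * f x).
Proof.
move=> [cf [C fC]]; split; first by move=> x; exact: (cvgM (cvg_cst c) (cf x)).
exists (`|c| * C) => x; rewrite normrM -mulrA; exact: ler_wpM2l.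
Qed.

Lemma tame_norm n (f : 'rV[R]_n -> R) : tame f -> tame (fun x => `|f x|).
Proof.
move=> [cf [C fC]]; split; first by move=> x; exact: cvg_norm (cf x).
by exists C => x; rewrite normr_id.
Qed.

Lemma tameB n (f g : 'rV[R]_n -> R) : tame f -> tame g -> tame (fun x => f x - g x).
Proof.
move=> tf tg; rewrite (_ : (fun x => _) = fun x => f x + -1 * g x).
  by apply: tameD => //; exact: tameZ.
by apply/funext => x; rewrite mulN1r.
Qed.

Lemma tame_sum n (I : Type) (r : seq I) (f : I -> 'rV[R]_n -> R) :
  (forall i, tame (f i)) -> tame (fun x => \sum_(i <- r) f i x).
Proof.
move=> tf; elim: r => [|i r IHr].
  under eq_fun do rewrite big_nil.
  split; first exact: cst_continuous.
  by exists 0 => x; rewrite normr0 mul0r.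
by under eq_fun do rewrite big_cons; exact: tameD.
Qed.

Lemma tame_bound n (f : 'rV[R]_n -> R) : tame f ->
  exists2 C, 0 <= C & forall x, `|f x| <= C * (1 + dotp x x) ^- n.
Proof.
move=> [_ [C fC]]; exists C => //.
have := fC 0; rewrite dotp0l addr0 expr1n invr1 mulr1.
by apply: le_trans; exact: normr_ge0.
Qed.

Lemma tame_integrable n (f : 'rV[R]_n -> R) : tame f ->
  (mu n).-integrable setT (EFin \o f).
Proof.
move=> tf; have [C C0 fC] := tame_bound tf.
apply: (@integrable_le_decay _ _ C); first exact: tame_measurable.
by move=> x; rewrite (le_trans (fC x))// ler_wpM2l// decay_ge.
Qed.

End tame.

Section continuous_integral_inj.
Context (R : realType).
Notation leb := (@lebesgue_measure R).

(** If [v t < u t], then two constants separate [v] from [u] on a small interval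
    around [t], and the integrals over that interval differ. *)
Lemma continuous_integral_inj (u v : R -> R) :
  continuous u -> continuous v -> (forall t, 0 <= u t) -> (forall t, 0 <= v t) ->
  (forall E : set (measurableTypeR R), measurable E ->
    \int[leb]_t (\1_E t * u t)%:E = \int[leb]_t (\1_E t * v t)%:E)%E ->
  u =1 v.
Proof.
suff H (u0 v0 : R -> R) : continuous u0 -> continuous v0 ->
  (forall t, 0 <= u0 t) -> (forall t, 0 <= v0 t) ->
  (forall E : set (measurableTypeR R), measurable E ->
    \int[leb]_t (\1_E t * u0 t)%:E = \int[leb]_t (\1_E t * v0 t)%:E)%E ->
  forall t, u0 t <= v0 t.
  move=> cu cv u0 v0 uv t; apply/eqP; rewrite eq_le H//= H// => E mE.
  by rewrite uv.
move=> {u v} cu cv u_ge0 v_ge0 uv t; rewrite leNgt; apply/negP => vu.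
pose c1 := (2 * v0 t + u0 t) / 3; pose c2 := (v0 t + 2 * u0 t) / 3.
have vc1 : v0 t < c1 by rewrite /c1; lra.
have c2u : c2 < u0 t by rewrite /c2; lra.
have c12 : c1 < c2 by rewrite /c1 /c2; lra.
have /nbhs_ballP[d /= d0 dP] : \forall s \near t, v0 s < c1 /\ c2 < u0 s.
  by apply: filterI; [exact: (cvgr_lt (v0 t) (cv t))|exact: (cvgr_gt (u0 t) (cu t))].
pose E : set (measurableTypeR R) := `]t - d, t + d[%classic.
have mE : measurable E by exact: measurable_itv.
have EP s : E s -> v0 s < c1 /\ c2 < u0 s.
  rewrite /E/= in_itv/= => /andP[ts st]; apply: dP.
  by rewrite /ball/= ltr_norml; apply/andP; split; lra.
have c1_gt0 : 0 < c1 by exact: le_lt_trans (v_ge0 t) vc1.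
have lebE : leb E = (d *+ 2)%:E.
  rewrite lebesgue_measure_itv/= lte_fin ifT; last by lra.
  by rewrite -EFinB; congr EFin; rewrite mulr2n; lra.
have intE : (\int[leb]_s (\1_E s)%:E = (d *+ 2)%:E)%E.
  by rewrite integral_indic// setIT; exact: lebE.
have intc c : 0 <= c -> (\int[leb]_s (\1_E s * c)%:E = (d *+ 2 * c)%:E)%E.
  move=> c0; under eq_integral do rewrite EFinM.
  rewrite ge0_integralZr//; last by apply/measurable_EFinP; exact: measurable_indic.
  by rewrite intE -EFinM.
have mI (w : R -> R) : continuous w -> measurable_fun [set: measurableTypeR R]
    (fun s => (\1_E s * w s)%:E).
  move=> cw; apply/measurable_EFinP; apply: measurable_funM.
    exact: measurable_indic.
  exact: continuous_measurable_fun.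
have : ((d *+ 2 * c2)%:E <= (d *+ 2 * c1)%:E)%E.
  rewrite -!intc; [|exact: ltW|by rewrite ltW// (lt_trans c1_gt0)].
  apply: (@le_trans _ _ (\int[leb]_s (\1_E s * u0 s)%:E)%E).
    apply: ge0_le_integral => //.
    - by move=> s _; rewrite lee_fin mulr_ge0// ltW// (lt_trans c1_gt0).
    - by apply: mI; exact: cst_continuous.
    - exact: mI.
    move=> s _; rewrite lee_fin indicE; have [/set_mem/EP[_ /ltW]|] := boolP (s \in E).
      by rewrite !mul1r.
    by rewrite !mul0r.
  rewrite uv//; apply: ge0_le_integral => //.
  - by move=> s _; rewrite lee_fin mulr_ge0.
  - exact: mI.
  - by apply: mI; exact: cst_continuous.
  move=> s _; rewrite lee_fin indicE; have [/set_mem/EP[/ltW + _]|] := boolP (s \in E).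
    by rewrite !mul1r.
  by rewrite !mul0r.
by rewrite lee_fin ler_pM2l ?mulrn_wgt0// leNgt c12.
Qed.

End continuous_integral_inj.

Section radon_real.
Context (R : realType) (m : nat).
Notation n := m.+1.
Notation leb := (@lebesgue_measure R).
Notation mu := (lebesgue_rV R).
Implicit Types (f : 'rV[R]_n -> R) (theta : 'rV[R]_n).

Lemma tame_frame f : tame f -> exists2 C, 0 <= C &
  forall theta tau y, enorm theta = 1 ->
    `|f (frame_coord theta (tau, y))| <= C * decay (rV_cons (tau, y)).
Proof.
move=> tf; have [C C0 fC] := tame_bound tf; exists C => // theta tau y theta1.
rewrite (le_trans (fC _))// ler_wpM2l// (le_trans _ (decay_ge _))//.
by rewrite /frame_coord dotp_frame// dotp_cons expr2.
Qed.

Lemma tame_frame_slice f : tame f -> exists2 C, 0 <= C &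
  forall theta tau y, enorm theta = 1 ->
    `|f (frame_coord theta (tau, y))| <= C * decay y.
Proof.
move=> /tame_frame[C C0 fC]; exists C => // theta tau y theta1.
by rewrite (le_trans (fC _ _ _ theta1))// ler_wpM2l// decay_cons_le.
Qed.

Definition radon_real f (z : R * 'rV[R]_n) : R :=
  (\int[mu m]_y f (frame_coord z.2 (z.1, y)))%R.

Lemma measurable_frame_slice f theta tau : measurable_fun setT f ->
  measurable_fun [set: 'rV[R]_m] (fun y => f (frame_coord theta (tau, y))).
Proof.
move=> mf; apply: (measurableT_comp mf).
exact: (measurable_fun_pair2 _ (measurable_frame_coord theta)).
Qed.

Lemma integrable_frame_slice f theta tau : tame f -> enorm theta = 1 ->
  (mu m).-integrable setT (fun y => (f (frame_coord theta (tau, y)))%:E).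
Proof.
move=> tf theta1; have [C C0 fC] := tame_frame_slice tf.
apply: (@integrable_le_decay _ _ C); last by move=> y; exact: fC.
by apply: measurable_frame_slice; exact: tame_measurable.
Qed.

Lemma radon_realD f g z : tame f -> tame g -> enorm z.2 = 1 ->
  radon_real (fun x => f x + g x) z = radon_real f z + radon_real g z.
Proof.
by move=> tf tg z1; rewrite /radon_real RintegralD//; exact: integrable_frame_slice.
Qed.

Lemma radon_realZ c f z : tame f -> enorm z.2 = 1 ->
  radon_real (fun x => c * f x) z = c * radon_real f z.
Proof.
by move=> tf z1; rewrite /radon_real RintegralZl//; exact: integrable_frame_slice.
Qed.

Lemma radon_real_sum (I : Type) (r : seq I) (f : I -> 'rV[R]_n -> R) z :
  (forall i, tame (f i)) -> enorm z.2 = 1 ->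
  radon_real (fun x => \sum_(i <- r) f i x) z = \sum_(i <- r) radon_real (f i) z.
Proof.
move=> tf z1; elim: r => [|i r IHr].
  rewrite big_nil /radon_real; under eq_Rintegral do rewrite big_nil.
  by rewrite Rintegral_cst// mul0r.
rewrite big_cons -IHr -radon_realD//; last exact: tame_sum.
by apply: eq_Rintegral => y _; rewrite big_cons.
Qed.

(** Fubini's theorem in the orthonormal coordinates adapted to [theta]. *)
Lemma integral_radon_real f theta (phi : R -> R) (K : R) :
  tame f -> enorm theta = 1 ->
  measurable_fun [set: measurableTypeR R] phi -> (forall t, `|phi t| <= K) ->
  (\int[leb]_tau (phi tau * radon_real f (tau, theta))%:E =
   \int[mu n]_x (phi (dotp x theta) * f x)%:E)%E.
Proof.
move=> tf theta1 mphi phiK; have mf := tame_measurable tf.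
have mg : measurable_fun [set: 'rV[R]_n] (fun x => phi (dotp x theta) * f x).
  apply: measurable_funM => //; apply: (measurableT_comp mphi).
  by apply: measurable_dotp => //; exact: measurable_cst.
have [C C0 fC] := tame_bound tf.
have ig : (mu n).-integrable setT (EFin \o (fun x => phi (dotp x theta) * f x)).
  apply: (@integrable_le_decay _ _ (K * C)) => // x.
  rewrite normrM -mulrA ler_pM// (le_trans (fC x))//.
  by rewrite ler_wpM2l// decay_ge.
rewrite (integral_frame theta1 mg (integrable_frame theta1 mg ig)).
apply: eq_integral => tau _.
under eq_integral do rewrite /frame_coord dotp_frame_offset//.
have ifs := integrable_frame_slice tau tf theta1.
rewrite /radon_real EFinM fineK; last exact: integrable_fin_num.
rewrite -integralZl; [|by []|exact: ifs].
by [].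
Qed.

Lemma continuous_frame_coord theta y :
  continuous (fun tau : R => frame_coord theta (tau, y)).
Proof.
move=> tau; rewrite /continuous_at /frame_coord /=.
by apply: cvgD; [apply: cvgZr_tmp; exact: cvg_id|exact: cvg_cst].
Qed.

Lemma continuous_radon_real f theta : tame f -> enorm theta = 1 ->
  continuous (fun tau => radon_real f (tau, theta)).
Proof.
move=> tf theta1 tau; have [C C0 fC] := tame_frame_slice tf.
apply: (@cvg_Rintegral _ _ _ _ (mu m)
  (fun tau y => f (frame_coord theta (tau, y))) (fun y => C * decay y)).
- by move=> t; apply: measurable_frame_slice; exact: tame_measurable.
- move=> y; apply: (cvg_comp (fun t : R => frame_coord theta (t, y)) f).
    exact: continuous_frame_coord.
  by have [cf _] := tf; exact: cf.
- exact: integrable_decay.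
- by move=> t y; exact: fC.
Qed.

End radon_real.

(** * The hyperplane as a graph over a coordinate hyperplane *)

Section chart.
Context (R : realType) (m : nat).
Notation n := m.+1.
Notation leb := (@lebesgue_measure R).
Notation mu := (lebesgue_rV R).
Implicit Types (f : 'rV[R]_n -> R) (theta x : 'rV[R]_n) (i : 'I_n).

Notation edelta i := (delta_mx ord0 i : 'rV[R]_n).
Notation Bi i := (orthonormal_frame (edelta i)).

(** For [z = (s, x)] the hyperplane [{w | dotp w x = s * enorm x}] is the graph of
    this function over the [i]-th coordinate hyperplane; unlike a frame adapted
    to [x], this parametrization depends smoothly on [x]. *)
Definition chart_height i (z : R * 'rV[R]_n) (y : 'rV[R]_m) : R :=
  (z.1 * enorm z.2 - dotp (y *m Bi i) z.2) / z.2 ord0 i.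

Definition chart i (z : R * 'rV[R]_n) (y : 'rV[R]_m) : 'rV[R]_n :=
  frame_coord (edelta i) (chart_height i z y, y).

Definition chart_integral i f (z : R * 'rV[R]_n) : R :=
  (\int[mu m]_y f (chart i z y))%R.

Lemma measurable_chart i :
  measurable_fun [set: (measurableTypeR R * 'rV[R]_n) * 'rV[R]_m]
    (fun u => chart i u.1 u.2).
Proof.
apply: (measurableT_comp (measurable_frame_coord (edelta i))).
apply: measurable_fun_pair; last exact: measurable_snd.
rewrite /chart_height; apply: measurable_funM.
  apply: measurable_funB.
    apply: measurable_funM.
      exact: (measurableT_comp measurable_fst measurable_fst).
    apply: (measurableT_comp (@measurable_enorm R n)).
    exact: (measurableT_comp measurable_snd measurable_fst).
  apply: measurable_dotp.
    by apply: measurable_mulmxrV; exact: measurable_snd.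
  exact: (measurableT_comp measurable_snd measurable_fst).
apply: (measurableT_comp (f := fun t : R => t^-1)).
  exact: measurable_invr.
apply: (measurableT_comp (measurable_coord i)).
exact: (measurableT_comp measurable_snd measurable_fst).
Qed.

Lemma measurable_chart_slice f i z : measurable_fun setT f ->
  measurable_fun [set: 'rV[R]_m] (fun y => f (chart i z y)).
Proof.
move=> mf; apply: (measurableT_comp mf).
exact: (@measurable_fun_pair2 _ _ _ _ _ _ _ z (measurable_chart i)).
Qed.

Lemma tame_chart f : tame f -> exists2 C, 0 <= C &
  forall i z y, `|f (chart i z y)| <= C * decay y.
Proof.
move=> /tame_frame_slice[C C0 fC]; exists C => // i z y.
by apply: fC; exact: enorm_delta.
Qed.

Lemma integrable_chart f i z : tame f ->
  (mu m).-integrable setT (fun y => (f (chart i z y))%:E).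
Proof.
move=> tf; have [C C0 fC] := tame_chart tf.
apply: (@integrable_le_decay _ _ C); last by move=> y; exact: fC.
by apply: measurable_chart_slice; exact: tame_measurable.
Qed.

Lemma cvg_chart i (z : R * 'rV[R]_n) y : z.2 ord0 i != 0 ->
  chart i z' y @[z' --> z] --> chart i z y.
Proof.
move=> zi; rewrite /chart /frame_coord /=.
apply: cvgD; last exact: cvg_cst.
apply: cvgZr_tmp; rewrite /chart_height; apply: cvgM.
  apply: cvgB.
    by apply: cvgM; [exact: cvg_fst|apply: cvg_enorm; exact: cvg_snd].
  by apply: cvg_dotp; [exact: cvg_cst|exact: cvg_snd].
apply: cvgV => //; apply: (cvg_comp snd (fun x : 'rV[R]_n => x ord0 i)).
  exact: cvg_snd.
exact: coord_continuous.
Qed.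

Lemma cvg_chart_integral i f (z : R * 'rV[R]_n) : tame f -> z.2 ord0 i != 0 ->
  chart_integral i f z' @[z' --> z] --> chart_integral i f z.
Proof.
move=> tf zi; have [C C0 fC] := tame_chart tf.
apply: (@cvg_Rintegral _ _ _ _ (mu m)
  (fun z y => f (chart i z y)) (fun y => C * decay y)).
- by move=> t; apply: measurable_chart_slice; exact: tame_measurable.
- move=> y; apply: (cvg_comp (fun t => chart i t y) f).
    exact: cvg_chart.
  by have [cf _] := tf; exact: cf.
- exact: integrable_decay.
- by move=> t y; exact: fC.
Qed.

Lemma chart_integralD i f g z : tame f -> tame g ->
  chart_integral i (fun x => f x + g x) z = chart_integral i f z + chart_integral i g z.
Proof.
by move=> tf tg; rewrite /chart_integral RintegralD//; exact: integrable_chart.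
Qed.

Lemma chart_integralZ i c f z : tame f ->
  chart_integral i (fun x => c * f x) z = c * chart_integral i f z.
Proof.
by move=> tf; rewrite /chart_integral RintegralZl//; exact: integrable_chart.
Qed.

Lemma chart_integral_sum (I : Type) (r : seq I) i (f : I -> 'rV[R]_n -> R) z :
  (forall j, tame (f j)) ->
  chart_integral i (fun x => \sum_(j <- r) f j x) z =
  \sum_(j <- r) chart_integral i (f j) z.
Proof.
move=> tf; elim: r => [|j r IHr].
  rewrite big_nil /chart_integral; under eq_Rintegral do rewrite big_nil.
  by rewrite Rintegral_cst// mul0r.
rewrite big_cons -IHr -chart_integralD//; last exact: tame_sum.
by apply: eq_Rintegral => y _; rewrite big_cons.
Qed.

Section graph.
Context (theta : 'rV[R]_n) (theta1 : enorm theta = 1).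
Context (i : 'I_n) (thetai : theta ord0 i != 0).
Let b y := dotp (y *m Bi i) theta.

Let frame_dotp a y :
  dotp (frame_coord (edelta i) (a, y)) theta = theta ord0 i * a + b y.
Proof.
by rewrite /frame_coord/= dotpDl dotpZl dotpC dotp_delta mulrC.
Qed.

(** Integrated against the indicator of a set of offsets, both sides become the
    same integral over the whole space, written once in the coordinates adapted
    to [theta] and once in those adapted to the [i]-th axis; the factor is the
    rate at which the offset changes with the height. As both sides are continuous
    in the offset, they agree everywhere. *)
Let ge0_radon_real_chart f sigma : tame f -> (forall x, 0 <= f x) ->
  `|theta ord0 i| * radon_real f (sigma, theta) = chart_integral i f (sigma, theta).
Proof.
move=> tf f0; have mf := tame_measurable tf; move: sigma.
apply: continuous_integral_inj.
- move=> t; apply: cvgM; first exact: cvg_cst.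
  exact: continuous_radon_real.
- move=> t; apply: (cvg_comp (fun t : R => (t, theta)) (chart_integral i f)).
    by apply: (@cvg_pair _ _ _ _ (nbhs t) (nbhs theta)); [exact: cvg_id|exact: cvg_cst].
  exact: cvg_chart_integral.
- by move=> t; rewrite mulr_ge0// Rintegral_ge0.
- by move=> t; rewrite Rintegral_ge0.
move=> E mE.
have mE1 : measurable_fun [set: measurableTypeR R] (\1_E : R -> R).
  exact: measurable_indic.
pose F a y := (\1_E (theta ord0 i * a + b y) * f (frame_coord (edelta i) (a, y)))%:E.
have mF : measurable_fun [set: measurableTypeR R * 'rV[R]_m] (fun z => F z.1 z.2).
  apply/measurable_EFinP; apply: measurable_funM.
    apply: (measurableT_comp mE1); apply: measurable_funD.
      apply: measurable_funM; [exact: measurable_cst|exact: measurable_fst].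
    apply: measurable_dotp; last exact: measurable_cst.
    by apply: measurable_mulmxrV; exact: measurable_snd.
  apply: (measurableT_comp mf).
  rewrite (_ : (fun z : measurableTypeR R * 'rV[R]_m => _) =
      fun z => frame_coord (edelta i) z); first exact: measurable_frame_coord.
  by apply/funext => -[].
have F0 a y : (0 <= F a y)%E by rewrite lee_fin mulr_ge0.
have radonE : (\int[leb]_t (\1_E t * (`|theta ord0 i| * radon_real f (t, theta)))%:E =
    `|theta ord0 i|%:E * \int[leb]_a \int[mu m]_y F a y)%E.
  under eq_integral do rewrite mulrCA EFinM.
  rewrite ge0_integralZl//; last 2 first.
  - apply/measurable_EFinP; apply: measurable_funM => //.
    by apply: continuous_measurable_fun; exact: continuous_radon_real.
  - by move=> t _; rewrite lee_fin mulr_ge0// Rintegral_ge0.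
  congr (_ * _)%E.
  rewrite (@integral_radon_real _ _ f theta (\1_E) 1)//; last first.
    by move=> t; rewrite indicE; case: (_ \in _); rewrite ?normr1 ?normr0.
  rewrite (@ge0_integral_frame _ _ _ (enorm_delta R i)).
  - apply: eq_integral => a _; apply: eq_integral => y _.
    by rewrite frame_dotp.
  - apply/measurable_EFinP; apply: measurable_funM => //.
    apply: (measurableT_comp mE1).
    by apply: measurable_dotp => //; exact: measurable_cst.
  - by move=> x; rewrite lee_fin mulr_ge0.
rewrite radonE.
have -> : (\int[leb]_a \int[mu m]_y F a y = \int[mu m]_y \int[leb]_a F a y)%E.
  by apply: (@fubini_tonelli _ _ _ _ _ leb (mu m) (fun z => F z.1 z.2)).
pose G t y := (\1_E t * f (chart i (t, theta) y))%:E.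
have mG : measurable_fun [set: measurableTypeR R * 'rV[R]_m] (fun z => G z.1 z.2).
  apply/measurable_EFinP; apply: measurable_funM.
    by apply: (measurableT_comp mE1); exact: measurable_fst.
  have mp : measurable_fun [set: measurableTypeR R * 'rV[R]_m]
      (fun z => ((z.1, theta), z.2)).
    apply: measurable_fun_pair; last exact: measurable_snd.
    by apply: measurable_fun_pair; [exact: measurable_fst|exact: measurable_cst].
  exact: (measurableT_comp mf (measurableT_comp (measurable_chart i) mp)).
have G0 t y : (0 <= G t y)%E by rewrite lee_fin mulr_ge0.
have chartE : (\int[leb]_t (\1_E t * chart_integral i f (t, theta))%:E =
    \int[mu m]_y \int[leb]_t G t y)%E.
  transitivity (\int[leb]_t \int[mu m]_y G t y)%E; last first.
    by apply: (@fubini_tonelli _ _ _ _ _ leb (mu m) (fun z => G z.1 z.2)).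
  apply: eq_integral => t _.
  have ifc := integrable_chart i (t, theta) tf.
  rewrite /chart_integral EFinM fineK; last exact: integrable_fin_num.
  by rewrite -integralZl; [|by []|exact: ifc].
rewrite chartE -ge0_integralZl; last 4 first.
- exact: measurableT.
- apply: (@measurable_fun_fubini_tonelli_G _ _ _ _ _ leb (fun z => F z.1 z.2)) => //.
- by move=> y _; exact: integral_ge0.
- by rewrite lee_fin.
apply: eq_integral => y _.
rewrite [RHS](@ge0_integral_affine _ (fun t => G t y) (theta ord0 i) (b y)) //.
- congr (_ * _)%E; apply: eq_integral => a _.
  rewrite /F /G /chart /chart_height /= theta1 mulr1 addrK.
  by rewrite (mulrC (theta ord0 i)) mulfK.
- exact: (@measurable_fun_pair1 _ _ _ _ _ _ _ y mG).
Qed.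

Lemma radon_real_chart f sigma : tame f ->
  `|theta ord0 i| * radon_real f (sigma, theta) = chart_integral i f (sigma, theta).
Proof.
move=> tf; have tn := tame_norm tf.
have tp := tameD tn tf; have tm := tameB tn tf.
pose p x := `|f x| + f x; pose q x := `|f x| - f x.
have fE : f = fun x => 2^-1 * p x + - 2^-1 * q x.
  by apply/funext => x; rewrite /p /q; field.
rewrite fE radon_realD// ?radon_realZ//; try exact: tameZ.
rewrite chart_integralD//; try exact: tameZ.
rewrite !chart_integralZ// -!ge0_radon_real_chart//.
- by ring.
- by move=> x; rewrite subr_ge0 ler_norm.
- by move=> x; rewrite -lerBlDr sub0r -normrN ler_norm.
Qed.

End graph.

End chart.

(** * Directional derivatives *)

Section directional.
Context (R : realType) (V : normedModType R).
Implicit Types (f g : V -> R) (z v : V).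

Lemma is_derive_alongP f z v (h d : R) :
  is_derive h 1 (fun k => f (k *: v + z)) d <-> is_derive (h *: v + z) v f d.
Proof.
pose q k := k^-1 *: ((f \o shift (h *: v + z)) (k *: v) - f (h *: v + z)).
have qE : (fun k => k^-1 *: (((fun k => f (k *: v + z)) \o shift h) (k *: 1) -
    f (h *: v + z))) = q.
  apply/funext => k; rewrite /q /=; congr (_ *: (f _ - _)).
  by rewrite [k%:A]mulr1 scalerDl addrA.
split=> -[df fd]; apply: DeriveDef.
- by move: df; rewrite /derivable qE.
- by move: fd; rewrite /derive qE.
- by rewrite /derivable qE.
- by rewrite /derive qE.
Qed.

Lemma is_derive_along0P f z v (d : R) :
  is_derive (0 : R) 1 (fun k => f (k *: v + z)) d <-> is_derive z v f d.
Proof. by rewrite is_derive_alongP scale0r add0r. Qed.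

Lemma is_derive_affine f z v (d : R) :
  (forall h, f (h *: v + z) = f z + h * d) -> is_derive z v f d.
Proof.
move=> fE; apply/is_derive_along0P; under eq_fun do rewrite fE.
have -> : (fun k => f z + k * d) = cst (f z) + d *: (id : R -> R).
  by apply/funext => k; rewrite /= !fctE mulrC.
apply: (is_derive_eq (is_deriveD (is_derive_cst (f z) (0 : R) 1)
  (is_deriveZ d (is_derive_id (0 : R) 1)))).
by rewrite add0r [d%:A]mulr1.
Qed.

Lemma is_derive_comp1 f (phi : R -> R) z v (df dphi : R) :
  is_derive (f z) 1 phi dphi -> is_derive z v f df ->
  is_derive z v (phi \o f) (dphi * df).
Proof.
move=> dp /is_derive_along0P dfz; apply/is_derive_along0P.
apply: (@is_derive1_comp _ phi (fun k => f (k *: v + z))) => //.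
by rewrite scale0r add0r.
Qed.

Lemma is_derive_mul f g z v (df dg : R) :
  is_derive z v f df -> is_derive z v g dg ->
  is_derive z v (fun x => f x * g x) (df * g z + f z * dg).
Proof.
move=> fz gz; apply: (is_derive_eq (is_deriveM fz gz)).
by rewrite /GRing.scale /= addrC (mulrC (g z)).
Qed.

Lemma is_derive_add f g z v (df dg : R) :
  is_derive z v f df -> is_derive z v g dg ->
  is_derive z v (fun x => f x + g x) (df + dg).
Proof. by move=> fz gz; exact: (is_deriveD fz gz). Qed.

Lemma is_derive_scale c f z v (df : R) :
  is_derive z v f df -> is_derive z v (fun x => c * f x) (c * df).
Proof. by move=> fz; exact: (is_deriveZ c fz). Qed.

Lemma is_derive_sub f g z v (df dg : R) :
  is_derive z v f df -> is_derive z v g dg ->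
  is_derive z v (fun x => f x - g x) (df - dg).
Proof. by move=> fz gz; exact: (is_deriveB fz gz). Qed.

Lemma is_derive_inv f z v (df : R) : f z != 0 -> is_derive z v f df ->
  is_derive z v (fun x => (f x)^-1) (- (f z) ^- 2 * df).
Proof.
move=> fz0 fz; apply: DeriveDef; first by apply: derivableV => //; case: fz.
by rewrite deriveV//; case: fz => _ ->.
Qed.

Lemma is_derive_sqrt f z v (df : R) : 0 < f z -> is_derive z v f df ->
  is_derive z v (fun x => Num.sqrt (f x)) ((2 * Num.sqrt (f z))^-1 * df).
Proof. by move=> fz0; apply: is_derive_comp1; exact: is_derive1_sqrt. Qed.

Lemma is_derive_bigsum (I : Type) (r : seq I) (f : I -> V -> R) z v (df : I -> R) :
  (forall i, is_derive z v (f i) (df i)) ->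
  is_derive z v (fun x => \sum_(i <- r) f i x) (\sum_(i <- r) df i).
Proof.
move=> fz; elim: r => [|i r IHr].
  rewrite big_nil (_ : (fun x => _) = cst 0); first exact: is_derive_cst.
  by apply/funext => x; rewrite big_nil.
rewrite big_cons (_ : (fun x => _) = fun x => f i x + \sum_(j <- r) f j x).
  exact: is_derive_add.
by apply/funext => x; rewrite big_cons.
Qed.

Lemma near_line (P : set V) z v : (\forall x \near z, P x) ->
  exists2 e : R, 0 < e & forall h, `|h| < e -> P (h *: v + z).
Proof.
move=> Pz.
have : h *: v + z @[h --> (0 : R)] --> (0 : R) *: v + z.
  by apply: cvgD; [apply: cvgZr_tmp; exact: cvg_id|exact: cvg_cst].
rewrite scale0r add0r => /(_ _ Pz) /nbhs_ballP[e /= e0 eP]; exists e => // h he.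
by apply: eP; rewrite /ball/= sub0r normrN.
Qed.

Lemma is_derive_Rintegral d (T : measurableType d) (mu : {measure set T -> \bar R})
    (F F' : V -> T -> R) (G : T -> R) z v :
  (forall x, mu.-integrable setT (EFin \o F x)) ->
  (\forall x \near z, forall y, is_derive x v (F ^~ y) (F' x y)) ->
  mu.-integrable setT (EFin \o G) ->
  (\forall x \near z, forall y, `|F' x y| <= G y) ->
  is_derive z v (fun x => \int[mu]_y F x y)%R (\int[mu]_y F' z y)%R.
Proof.
move=> iF dF iG FG.
have [e e0 eP] := near_line v (filterI dF FG).
apply/is_derive_along0P.
pose f (h : R) y := F (h *: v + z) y.
have df (h : R) y : `|h| < e -> is_derive h 1 (f ^~ y) (F' (h *: v + z) y).
  move=> he; apply/(is_derive_alongP (F ^~ y)).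
  by have [+ _] := eP h he; exact.
have dfE (h : R) y : `|h| < e -> partial1of2 f h y = F' (h *: v + z) y.
  by move=> he; rewrite partial1of2E; case: (df h y he).
have I0 : `]- e, e[%classic (0 : R) by rewrite /= in_itv/= e0 oppr_lt0 e0.
have IP h : `]- e, e[%classic h -> `|h| < e.
  by rewrite /= in_itv/= ltr_norml.
have G0 y : 0 <= G y.
  by have [_ /(_ y)] := eP 0 (eq_ind_r (fun t => t < e) e0 (normr0 R));
    exact: le_trans.
have h1 h : `]- e, e[%classic h -> mu.-integrable setT (EFin \o f h).
  by move=> _; exact: iF.
have h2 h y : `]- e, e[%classic h -> setT y -> derivable (f ^~ y) h 1.
  by move=> /IP he _; case: (df h y he).
have h3 h y : `]- e, e[%classic h -> setT y -> `|partial1of2 f h y| <= G y.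
  by move=> /IP he _; rewrite dfE//; have [_] := eP h he; exact.
apply: DeriveDef.
  exact: (derivable_under_integral measurableT I0 h1 h2 G0 iG h3).
rewrite -derive1E.
rewrite (differentiation_under_integral measurableT I0 h1 h2 G0 iG h3).
apply: eq_Rintegral => y _; rewrite -[LHS]/(partial1of2 f 0 y) dfE ?normr0//.
by rewrite scale0r add0r.
Qed.

End directional.

(** * Derivatives of the Radon transform *)

Section cylinder.
Context (R : realType) (m : nat).
Notation n := m.+1.
Notation mu := (lebesgue_rV R).
Notation V := (R * 'rV[R]_n)%type.
Implicit Types (z v : V) (i j : 'I_n) (y : 'rV[R]_m).
Notation edelta i := (delta_mx ord0 i : 'rV[R]_n).

Lemma is_derive_fst z v : is_derive z v (fun x : V => x.1) v.1.
Proof. by apply: is_derive_affine => h; rewrite /= addrC. Qed.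

Lemma is_derive_dotp_snd (b : 'rV[R]_n) z v :
  is_derive z v (fun x : V => dotp b x.2) (dotp b v.2).
Proof. by apply: is_derive_affine => h; rewrite /= dotpDr dotpZr addrC. Qed.

Lemma is_derive_coord i z v : is_derive z v (fun x : V => x.2 ord0 i) (v.2 ord0 i).
Proof. by apply: is_derive_affine => h; rewrite /= !mxE addrC. Qed.

Lemma is_derive_enorm z v : z.2 != 0 ->
  is_derive z v (fun x : V => enorm x.2) (dotp z.2 v.2 / enorm z.2).
Proof.
move=> z0.
have dd : is_derive z v (fun x : V => dotp x.2 x.2) (2 * dotp z.2 v.2).
  have := @is_derive_bigsum R _ _ (index_enum 'I_n) _ z v _
    (fun i => is_derive_mul (is_derive_coord i z v) (is_derive_coord i z v)).
  move=> H; apply: (is_derive_eq H); rewrite /dotp mulr_sumr.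
  by apply: eq_bigr => i _; ring.
have dgt0 : 0 < dotp z.2 z.2 by rewrite -enorm_sqr exprn_gt0// enorm_gt0.
have H := @is_derive_sqrt _ _ (fun x : V => dotp x.2 x.2) z v _ dgt0 dd.
apply: (is_derive_eq H); rewrite -/(enorm z.2).
by field; rewrite enorm_eq0.
Qed.

Lemma is_derive_normr_coord i z v : z.2 ord0 i != 0 ->
  is_derive z v (fun x : V => `|x.2 ord0 i|)
    (`|z.2 ord0 i| * v.2 ord0 i / z.2 ord0 i).
Proof.
move=> zi.
have -> : (fun x : V => `|x.2 ord0 i|) = fun x => Num.sqrt (x.2 ord0 i * x.2 ord0 i).
  by apply/funext => x; rewrite -expr2 sqrtr_sqr.
have d2 := is_derive_mul (is_derive_coord i z v) (is_derive_coord i z v).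
have gt0 : 0 < z.2 ord0 i * z.2 ord0 i by rewrite -expr2 exprn_even_gt0.
have H := @is_derive_sqrt _ _ (fun x : V => x.2 ord0 i * x.2 ord0 i) z v _ gt0 d2.
apply: (is_derive_eq H); rewrite -expr2 sqrtr_sqr.
have tT : z.2 ord0 i * z.2 ord0 i = `|z.2 ord0 i| * `|z.2 ord0 i|.
  by rewrite -!expr2 real_normK ?num_real.
have nzi : `|z.2 ord0 i| != 0 by rewrite normr_eq0.
apply: (mulIf zi); rewrite divfK//.
set t := z.2 ord0 i in zi tT nzi *; set T := `|t| in tT nzi *.
have -> : (2 * T)^-1 * (v.2 ord0 i * t + t * v.2 ord0 i) * t = v.2 ord0 i * (t * t) / T.
  by field.
by rewrite tT; field.
Qed.

Lemma coord_neq0 i z : z.2 ord0 i != 0 -> z.2 != 0.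
Proof. by apply: contra_neq => ->; rewrite mxE. Qed.

(** The velocity of the chart: its height moves at this speed when the
    hyperplane [z] moves with velocity [v]; [w] is the point of the chart. *)
Definition chart_speed i z v (w : 'rV[R]_n) : R :=
  (v.1 * enorm z.2 + z.1 * (dotp z.2 v.2 / enorm z.2) - dotp w v.2) / z.2 ord0 i.

Lemma is_derive_chart_height i z v y : z.2 ord0 i != 0 ->
  is_derive z v (fun x => chart_height i x y) (chart_speed i z v (chart i z y)).
Proof.
move=> zi; have z0 := coord_neq0 zi.
have d1 := is_derive_mul (is_derive_fst z v) (is_derive_enorm v z0).
have d2 := is_derive_dotp_snd (y *m orthonormal_frame (edelta i)) z v.
have d3 := is_derive_inv zi (is_derive_coord i z v).
apply: (is_derive_eq (is_derive_mul (is_derive_sub d1 d2) d3)).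
rewrite /chart_speed /chart /frame_coord /= dotpDl dotpZl.
rewrite [dotp (edelta i) _]dotpC dotp_delta /chart_height; field.
by rewrite zi enorm_eq0.
Qed.

Definition partial i (g g' : 'rV[R]_n -> R) := forall x, is_derive x (edelta i) g (g' x).

Lemma is_derive_chart i (g g' : 'rV[R]_n -> R) z v y : z.2 ord0 i != 0 ->
  partial i g g' ->
  is_derive z v (fun x => g (chart i x y))
    (g' (chart i z y) * chart_speed i z v (chart i z y)).
Proof.
move=> zi gg'.
pose b := y *m orthonormal_frame (edelta i).
apply: (@is_derive_comp1 _ _ (fun x => chart_height i x y)
  (fun t => g (t *: edelta i + b))).
  by apply/is_derive_alongP; exact: gg'.
exact: is_derive_chart_height.
Qed.

(** The Radon transform as a function of a nonzero normal vector, extended so as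
    to be homogeneous of degree 0 in that vector. *)
Definition hradon (g : 'rV[R]_n -> R) (z : V) : R :=
  radon_real g (z.1, (enorm z.2)^-1 *: z.2).

Lemma chart_normalize i z y : z.2 ord0 i != 0 ->
  chart i (z.1, (enorm z.2)^-1 *: z.2) y = chart i z y.
Proof.
move=> zi; have z0 := coord_neq0 zi.
rewrite /chart; congr (frame_coord _ (_, _)); rewrite /chart_height /=.
rewrite enorm_normalize// dotpZr mxE; field.
by rewrite zi enorm_eq0.
Qed.

Lemma hradon_chart i g z : tame g -> z.2 ord0 i != 0 ->
  hradon g z = enorm z.2 / `|z.2 ord0 i| * chart_integral i g z.
Proof.
move=> tg zi; have z0 := coord_neq0 zi.
have ti : ((enorm z.2)^-1 *: z.2) ord0 i != 0.
  by rewrite mxE mulf_neq0// invr_eq0 enorm_eq0.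
have H := radon_real_chart (enorm_normalize z0) ti z.1 tg.
have <- : chart_integral i g (z.1, (enorm z.2)^-1 *: z.2) = chart_integral i g z.
  by apply: eq_Rintegral => y _; rewrite chart_normalize.
have tiE : `|((enorm z.2)^-1 *: z.2) ord0 i| = (enorm z.2)^-1 * `|z.2 ord0 i|.
  by rewrite mxE normrM ger0_norm ?invr_ge0 ?enorm_ge0.
rewrite -H tiE -/(hradon g z).
by field; rewrite ?normr_eq0 ?zi ?enorm_eq0 ?z0.
Qed.

Lemma exists_coord_neq0 z : z.2 != 0 -> exists i, z.2 ord0 i != 0.
Proof.
move=> z0; apply: contrapT => nz; move/eqP: z0; apply; apply/rowP => i.
by rewrite mxE; apply/eqP/negPn/negP => zi; apply: nz; exists i.
Qed.

Lemma near_coord_neq0 i z : z.2 ord0 i != 0 ->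
  \forall x \near z, (x : V).2 ord0 i != 0.
Proof.
move=> zi; apply: (@cvgr_neq0 _ _ _ (nbhs z) _ (fun x : V => x.2 ord0 i) (z.2 ord0 i)) => //.
apply: (cvg_comp snd (fun x : 'rV[R]_n => x ord0 i)); first exact: cvg_snd.
exact: coord_continuous.
Qed.

Lemma near_neq0 z : z.2 != 0 -> \forall x \near z, (x : V).2 != 0.
Proof.
move=> /exists_coord_neq0[i zi].
by apply: filterS (near_coord_neq0 zi) => x; exact: coord_neq0.
Qed.

Lemma cvg_coord i z : (x : V).2 ord0 i @[x --> z] --> z.2 ord0 i.
Proof.
apply: (cvg_comp snd (fun x : 'rV[R]_n => x ord0 i)); first exact: cvg_snd.
exact: coord_continuous.
Qed.

Lemma cvg_hradon g z : tame g -> z.2 != 0 -> hradon g x @[x --> z] --> hradon g z.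
Proof.
move=> tg z0; have [i zi] := exists_coord_neq0 z0.
rewrite (hradon_chart tg zi).
apply: (@cvg_trans _ ((fun x => enorm x.2 / `|x.2 ord0 i| * chart_integral i g x) @ z)).
  apply: near_eq_cvg; apply: filterS (near_coord_neq0 zi) => x xi.
  by rewrite (hradon_chart tg xi).
have c0 : `|z.2 ord0 i| != 0 by rewrite normr_eq0.
have c1 : enorm (x : V).2 @[x --> z] --> enorm z.2 by apply: cvg_enorm; exact: cvg_snd.
have c2 : `|(x : V).2 ord0 i|^-1 @[x --> z] --> `|z.2 ord0 i|^-1.
  by apply: cvgV => //; apply: cvg_norm; exact: cvg_coord.
exact: (cvgM (cvgM c1 c2) (cvg_chart_integral tg zi)).
Qed.

(** In this section [S] is any class of tame functions that is stable under
    partial derivatives and under multiplication by coordinates; derivatives of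
    the Radon transforms of its elements are then expressed by Radon transforms of
    its elements. *)
Section derivation.
Context (S : set ('rV[R]_n -> R)).
Hypothesis S_tame : forall g, S g -> tame g.
Hypothesis S_partial : forall g, S g -> forall i, exists2 g', S g' & partial i g g'.
Hypothesis S_coord : forall g j, S g -> S (fun x => x ord0 j * g x).

Let A z v := v.1 * enorm z.2 + z.1 * (dotp z.2 v.2 / enorm z.2).

Let cvg_A z v : z.2 != 0 -> A x v @[x --> z] --> A z v.
Proof.
move=> z0; have ce : enorm x.2 @[x --> z] --> enorm z.2.
  by apply: cvg_enorm; exact: cvg_snd.
apply: cvgD; first by apply: cvgM => //; exact: cvg_cst.
apply: cvgM; first exact: cvg_fst.
apply: cvgM; last by apply: cvgV => //; rewrite enorm_eq0.
by apply: cvg_dotp; [exact: cvg_snd|exact: cvg_cst].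
Qed.

Let is_derive_chart_integral i g g' z v : S g -> S g' -> partial i g g' ->
  z.2 ord0 i != 0 ->
  is_derive z v (chart_integral i g) (A z v / z.2 ord0 i * chart_integral i g' z -
    (z.2 ord0 i)^-1 * \sum_j v.2 ord0 j * chart_integral i (fun x => x ord0 j * g' x) z).
Proof.
move=> Sg Sg' gg' zi; have z0 := coord_neq0 zi.
have tg := S_tame Sg; have tg' := S_tame Sg'.
pose q (x : 'rV[R]_n) := \sum_j v.2 ord0 j * (x ord0 j * g' x).
have tq : tame q by apply: tame_sum => j; apply/tameZ/S_tame/S_coord.
have [C1 C10 C1P] := tame_chart tg'.
have [C2 C20 C2P] := tame_chart tq.
pose F' x y := A x v / x.2 ord0 i * g' (chart i x y) +
  - (x.2 ord0 i)^-1 * q (chart i x y).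
pose K1 := `|A z v / z.2 ord0 i| + 1; pose K2 := `|(z.2 ord0 i)^-1| + 1.
have ci : ((x : V).2 ord0 i)^-1 @[x --> z] --> (z.2 ord0 i)^-1.
  by apply: cvgV => //; exact: cvg_coord.
have nearK1 : \forall x \near z, `|A x v / (x : V).2 ord0 i| < K1.
  have k1 : `|A x v / (x : V).2 ord0 i| @[x --> z] --> `|A z v / z.2 ord0 i|.
    by apply: cvg_norm; apply: cvgM => //; exact: cvg_A.
  by apply: (cvgr_lt _ k1); rewrite ltrDl.
have nearK2 : \forall x \near z, `|((x : V).2 ord0 i)^-1| < K2.
  by apply: (cvgr_lt _ (cvg_norm ci)); rewrite ltrDl.
have H : is_derive z v (chart_integral i g) (\int[mu m]_y F' z y)%R.
  apply: (@is_derive_Rintegral _ _ _ _ (mu m) (fun x y => g (chart i x y)) F'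
    (fun y => (K1 * C1 + K2 * C2) * decay y)).
  - by move=> x; exact: integrable_chart.
  - apply: filterS (near_coord_neq0 zi) => x xi y.
    apply: (is_derive_eq (is_derive_chart v y xi gg')).
    rewrite /F' /chart_speed /q /A.
    have -> : \sum_j v.2 ord0 j * (chart i x y ord0 j * g' (chart i x y)) =
      dotp (chart i x y) v.2 * g' (chart i x y).
      by rewrite /dotp mulr_suml; apply: eq_bigr => j _; rewrite mulrCA mulrA.
    by field; rewrite xi enorm_eq0 (coord_neq0 xi).
  - exact: integrable_decay.
  - apply: filterS2 nearK1 nearK2 => x K1x K2x y.
    have e1 : `|A x v / x.2 ord0 i * g' (chart i x y)| <= K1 * (C1 * decay y).
      by rewrite normrM; apply: ler_pM => //; exact: ltW.
    have e2 : `|- (x.2 ord0 i)^-1 * q (chart i x y)| <= K2 * (C2 * decay y).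
      by rewrite normrM normrN; apply: ler_pM => //; exact: ltW.
    by rewrite mulrDl -!mulrA (le_trans (ler_normD _ _))// lerD.
apply: (is_derive_eq H).
rewrite -/(chart_integral i (fun w => A z v / z.2 ord0 i * g' w + - (z.2 ord0 i)^-1 * q w) z).
rewrite chart_integralD ?chart_integralZ//; try exact: tameZ.
rewrite mulNr; congr (_ - _ * _).
rewrite chart_integral_sum; last by move=> j; apply/tameZ/S_tame/S_coord.
by apply: eq_bigr => j _; rewrite chart_integralZ//; apply/S_tame/S_coord.
Qed.

(** Where the [i]-th coordinate of the normal does not vanish, the chart gives a
    formula for the derivative multiplied by that coordinate. Multiplying it by
    the coordinate once more and summing over [i] gives a formula that is no longer
    singular where a coordinate vanishes. *)
Lemma is_derive_hradon g : S g -> exists2 dg : 'I_n -> 'rV[R]_n -> R,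
  forall i, S (dg i) & forall z v, z.2 != 0 ->
  is_derive z v (hradon g)
    (\sum_i z.2 ord0 i / enorm z.2 ^+ 2 *
      (A z v * hradon (dg i) z -
       \sum_j v.2 ord0 j * hradon (fun x => x ord0 j * dg i x) z)).
Proof.
move=> Sg.
have /choice[dg dgP] : forall i, exists g', S g' /\ partial i g g'.
  by move=> i; have [g' Sg' gg'] := S_partial Sg i; exists g'.
exists dg => [i|z v z0]; first by case: (dgP i).
pose E i := (z.2 ord0 i * (dotp z.2 v.2 / enorm z.2 ^+ 2) - v.2 ord0 i) * hradon g z +
  (A z v * hradon (dg i) z - \sum_j v.2 ord0 j * hradon (fun x => x ord0 j * dg i x) z).
have dE i : z.2 ord0 i != 0 -> is_derive z v (hradon g) (E i / z.2 ord0 i).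
  move=> zi; have [Sdg pdg] := dgP i.
  apply: (@near_eq_is_derive _ _ _
    (fun x => enorm x.2 / `|x.2 ord0 i| * chart_integral i g x)).
    apply: filterS (near_coord_neq0 zi) => x xi.
    by rewrite (hradon_chart (S_tame Sg) xi).
  have nzi : `|z.2 ord0 i| != 0 by rewrite normr_eq0.
  have d1 := is_derive_mul (is_derive_enorm v z0)
    (@is_derive_inv _ _ (fun x : V => `|x.2 ord0 i|) z v _ nzi (is_derive_normr_coord v zi)).
  have d2 := is_derive_chart_integral v Sg Sdg pdg zi.
  apply: (is_derive_eq (is_derive_mul d1 d2)).
  set s := \sum_j v.2 ord0 j * chart_integral i (fun x => x ord0 j * dg i x) z.
  set c := enorm z.2 / `|z.2 ord0 i|.
  have -> : E i = (z.2 ord0 i * (dotp z.2 v.2 / enorm z.2 ^+ 2) - v.2 ord0 i) *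
      (c * chart_integral i g z) + (A z v * (c * chart_integral i (dg i) z) - c * s).
    congr (_ * _ + (_ * _ - _)).
    - exact: hradon_chart (S_tame Sg) zi.
    - exact: hradon_chart (S_tame Sdg) zi.
    rewrite /s mulr_sumr; apply: eq_bigr => j _.
    by rewrite (hradon_chart (S_tame (S_coord j Sdg)) zi) mulrCA.
  by rewrite /c; field; rewrite ?zi ?nzi ?enorm_eq0 ?z0.
have [i0 zi0] := exists_coord_neq0 z0.
pose D := 'D_v (hradon g) z.
have DE i : z.2 ord0 i != 0 -> E i = z.2 ord0 i * D.
  by move=> zi; have [_] := dE i zi; rewrite -/D => ->; rewrite mulrC divfK.
apply: (is_derive_eq (dE i0 zi0)).
have -> : E i0 / z.2 ord0 i0 = D by rewrite DE// mulrC mulKf.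
transitivity (\sum_i (z.2 ord0 i * z.2 ord0 i) * (D / enorm z.2 ^+ 2 -
    dotp z.2 v.2 / enorm z.2 ^+ 4 * hradon g z) +
  \sum_i (z.2 ord0 i * v.2 ord0 i) * (hradon g z / enorm z.2 ^+ 2)).
  rewrite -!mulr_suml -!/(dotp _ _) -enorm_sqr.
  by field; rewrite enorm_eq0.
rewrite -big_split /=; apply: eq_bigr => i _.
have [->|zi] := eqVneq (z.2 ord0 i) 0; first by rewrite !mul0r addr0.
have := DE i zi; rewrite /E.
set w := A z v * _ - _; set t := z.2 ord0 i => ED.
have -> : w = t * D - (t * (dotp z.2 v.2 / enorm z.2 ^+ 2) - v.2 ord0 i) * hradon g z.
  by rewrite -ED addrC addKr.
by field; rewrite enorm_eq0.
Qed.

(** Multiplication by each of the coefficients in [is_derive_hradon] is a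
    constructor, so that the class is closed under derivatives. *)
Inductive hclass : (V -> R) -> Prop :=
| hclass_radon g : S g -> hclass (hradon g)
| hclass_offset F : hclass F -> hclass (fun z => z.1 * F z)
| hclass_coord i F : hclass F -> hclass (fun z => z.2 ord0 i * F z)
| hclass_inv F : hclass F -> hclass (fun z => (enorm z.2)^-1 * F z)
| hclass_scale c F : hclass F -> hclass (fun z => c * F z)
| hclass_add F G : hclass F -> hclass G -> hclass (fun z => F z + G z).

Lemma hclass_eq F G : hclass F -> F =1 G -> hclass G.
Proof. by move=> HF /funext <-. Qed.

Lemma hclass_sum (I : Type) (r : seq I) (F : I -> V -> R) (F0 : V -> R) :
  hclass F0 -> (forall k, hclass (F k)) -> hclass (fun z => \sum_(k <- r) F k z).
Proof.
move=> HF0 HF; elim: r => [|k r IHr].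
  by apply: (hclass_eq (hclass_scale 0 HF0)) => z; rewrite big_nil mul0r.
by apply: (hclass_eq (hclass_add (HF k) IHr)) => z; rewrite big_cons.
Qed.

Lemma hclass_derive F v : hclass F ->
  exists2 F', hclass F' & forall z, z.2 != 0 -> is_derive z v F (F' z).
Proof.
elim=> {F} [g Sg|F HF [F' HF' dF]|i F HF [F' HF' dF]|F HF [F' HF' dF]|c F HF [F' HF' dF]|
    F G HF [F' HF' dF] HG [G' HG' dG]].
- have [dg Sdg dP] := is_derive_hradon Sg.
  eexists; last by move=> z z0; exact: dP.
  have Hj i j : hclass (fun z => v.2 ord0 j * hradon (fun x => x ord0 j * dg i x) z).
    exact/hclass_scale/hclass_radon/S_coord.
  have HA i : hclass (fun z => A z v * hradon (dg i) z).
    have H1 := hclass_inv (hclass_radon (Sdg i)).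
    have H2 : hclass (fun z => enorm z.2 * hradon (dg i) z).
      (* enorm x = (\sum_j x_j ^ 2) / enorm x, where only 1 / enorm x is a coefficient *)
      apply: (hclass_eq (hclass_sum (index_enum 'I_n) (hclass_radon Sg)
        (fun j => hclass_coord j (hclass_coord j H1)))) => z.
      rewrite (eq_bigr (fun j => z.2 ord0 j * z.2 ord0 j *
        ((enorm z.2)^-1 * hradon (dg i) z))); last by move=> j _; rewrite mulrA.
      rewrite -mulr_suml -/(dotp z.2 z.2) -enorm_sqr.
      have [->|z0] := eqVneq (enorm z.2) 0; first by rewrite expr0n/= !mul0r.
      by rewrite expr2 -mulrA mulVKf.
    have H3 : hclass (fun z => z.1 * (dotp z.2 v.2 * ((enorm z.2)^-1 * hradon (dg i) z))).
      apply: hclass_offset.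
      apply: (hclass_eq (hclass_sum (index_enum 'I_n) (hclass_radon Sg)
        (fun j => hclass_scale (v.2 ord0 j) (hclass_coord j H1)))) => z.
      rewrite /dotp mulr_suml; apply: eq_bigr => j _.
      by rewrite mulrA (mulrC (v.2 _ _)).
    apply: (hclass_eq (hclass_add (hclass_scale v.1 H2) H3)) => z.
    by rewrite /A mulrDl !mulrA.
  apply: (hclass_sum _ (hclass_radon Sg)) => i.
  have Hs := hclass_sum (index_enum 'I_n) (hclass_radon Sg) (Hj i).
  apply: (hclass_eq (hclass_coord i (hclass_inv (hclass_inv
    (hclass_add (HA i) (hclass_scale (-1) Hs)))))) => z.
  by rewrite mulN1r expr2 invfM !mulrA.
- exists (fun z => v.1 * F z + z.1 * F' z).
    exact: hclass_add (hclass_scale _ HF) (hclass_offset HF').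
  by move=> z z0; apply: is_derive_mul; [exact: is_derive_fst|exact: dF].
- exists (fun z => v.2 ord0 i * F z + z.2 ord0 i * F' z).
    exact: hclass_add (hclass_scale _ HF) (hclass_coord i HF').
  by move=> z z0; apply: is_derive_mul; [exact: is_derive_coord|exact: dF].
- exists (fun z => - (enorm z.2) ^- 2 * (dotp z.2 v.2 / enorm z.2) * F z +
      (enorm z.2)^-1 * F' z).
    apply: hclass_add; last exact: hclass_inv.
    apply: (hclass_eq (hclass_sum (index_enum 'I_n) HF (fun j => hclass_scale (- v.2 ord0 j)
      (hclass_coord j (hclass_inv (hclass_inv (hclass_inv HF))))))) => z.
    rewrite /dotp !mulr_suml !mulr_sumr mulr_suml; apply: eq_bigr => j _.
    by rewrite -exprVn; ring.
  move=> z z0; apply: is_derive_mul; last exact: dF.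
  apply: (@is_derive_inv _ _ (fun x : V => enorm x.2)); first by rewrite enorm_eq0.
  exact: is_derive_enorm.
- exists (fun z => c * F' z); first exact: hclass_scale.
  by move=> z z0; apply: is_derive_scale; exact: dF.
- exists (fun z => F' z + G' z); first exact: hclass_add.
  by move=> z z0; apply: is_derive_add; [exact: dF|exact: dG].
Qed.

Lemma hclass_cvg F z : hclass F -> z.2 != 0 -> F x @[x --> z] --> F z.
Proof.
move=> + z0; elim=> {F} [g Sg|F HF cF|i F HF cF|F HF cF|c F HF cF|F G HF cF HG cG].
- by apply: cvg_hradon => //; exact: S_tame.
- by apply: cvgM => //; exact: cvg_fst.
- by apply: cvgM => //; exact: cvg_coord.
- apply: cvgM => //; apply: cvgV; first by rewrite enorm_eq0.
  by apply: cvg_enorm; exact: cvg_snd.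
- by apply: cvgM => //; exact: cvg_cst.
- exact: cvgD.
Qed.

Let hradon_unit g sigma theta : enorm theta = 1 ->
  hradon g (sigma, theta) = radon_real g (sigma, theta).
Proof. by move=> t1; rewrite /hradon /= t1 invr1 scale1r. Qed.

(** On the hyperplane the offset equals [\sum_j theta_j x_j], so that powers of the
    offset are absorbed by the function. *)
Let radon_offset g sigma theta : S g -> enorm theta = 1 ->
  sigma * radon_real g (sigma, theta) =
  \sum_j theta ord0 j * radon_real (fun x => x ord0 j * g x) (sigma, theta).
Proof.
move=> Sg t1.
transitivity (radon_real (fun x => \sum_j theta ord0 j * (x ord0 j * g x)) (sigma, theta)).
  rewrite -radon_realZ//; last exact: S_tame.
  apply: eq_Rintegral => y _; rewrite /=.
  rewrite -{1}(dotp_frame_offset t1 sigma y) /dotp mulr_suml.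
  by apply: eq_bigr => j _; rewrite mulrCA mulrA.
rewrite radon_real_sum//; last by move=> j; apply/tameZ/S_tame/S_coord.
by apply: eq_bigr => j _; rewrite radon_realZ//; apply/S_tame/S_coord.
Qed.

Let radon_bound g k : S g -> exists C, forall sigma theta, enorm theta = 1 ->
  `|sigma| ^+ k * `|radon_real g (sigma, theta)| <= C.
Proof.
elim: k g => [|k IHk] g Sg.
  have [C C0 CP] := tame_frame_slice (S_tame Sg).
  exists (\int[mu m]_y (C * decay y))%R => sigma theta t1.
  rewrite expr0 mul1r; apply: le_trans (le_normr_Rintegral _ _) _ => //.
    by apply: integrable_frame_slice => //; exact: S_tame.
  apply: le_Rintegral => //.
  - apply: integrable_norm; apply: integrable_frame_slice => //; exact: S_tame.
  - exact: integrable_decay.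
  - by move=> y _; exact: CP.
have /choice[C CP] := fun j => IHk _ (S_coord j Sg).
exists (\sum_j C j) => sigma theta t1.
rewrite exprSr -mulrA -normrM radon_offset// -{1}[`|sigma| ^+ k]ger0_norm ?exprn_ge0//.
rewrite -normrM mulr_sumr (le_trans (ler_norm_sum _ _ _))//.
apply: ler_sum => j _; rewrite !normrM mulrCA.
apply: le_trans (CP j sigma theta t1).
rewrite normrX normr_id ler_piMl ?mulr_ge0 ?exprn_ge0//.
by rewrite -t1 coord_le_enorm.
Qed.

Lemma hclass_bound F k : hclass F -> exists C, forall sigma theta, enorm theta = 1 ->
  `|sigma| ^+ k * `|F (sigma, theta)| <= C.
Proof.
move=> HF; elim: HF k => {F} [g Sg|F HF IH|i F HF IH|F HF IH|c F HF IH|F G HF IHF HG IHG] k.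
- have [C CP] := radon_bound k Sg; exists C => sigma theta t1.
  by rewrite hradon_unit//; exact: CP.
- have [C CP] := IH k.+1; exists C => sigma theta t1.
  by rewrite normrM mulrA -exprSr; exact: CP.
- have [C CP] := IH k; exists C => sigma theta t1.
  rewrite normrM mulrCA; apply: le_trans (CP sigma theta t1).
  rewrite ler_piMl ?mulr_ge0 ?exprn_ge0//=.
  by rewrite -t1 coord_le_enorm.
- have [C CP] := IH k; exists C => sigma theta t1.
  by rewrite /= t1 invr1 mul1r; exact: CP.
- have [C CP] := IH k; exists (`|c| * C) => sigma theta t1.
  by rewrite normrM mulrCA ler_wpM2l//; exact: CP.
- have [C CP] := IHF k; have [D DP] := IHG k; exists (C + D) => sigma theta t1.
  rewrite (le_trans (ler_wpM2l _ (ler_normD _ _))) ?exprn_ge0// mulrDr.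
  by apply: lerD; [exact: CP|exact: DP].
Qed.

(** Only the values off [{z | z.2 = 0}] matter there, because that set is closed. *)
Lemma iter_derive_hclass F0 F vs : hclass F -> (forall z, z.2 != 0 -> F0 z = F z) ->
  exists2 F', hclass F' & forall z, z.2 != 0 -> iter_derive F0 vs z = F' z.
Proof.
move=> HF F0F; elim: vs => [|v vs [F' HF' F'E]]; first by exists F.
have [F'' HF'' dF] := hclass_derive v HF'; exists F'' => // z z0 /=.
rewrite (@near_eq_derive _ _ _ _ F'); first by case: (dF z z0).
exact: filterS (near_neq0 z0).
Qed.

Lemma hclass_cyl_schwartz (g : V -> R) F : hclass F ->
  (forall z, z.2 != 0 -> homog0 g z = F z) -> cyl_schwartz_real g.
Proof.
move=> HF gF; split.
  move=> vs _ z /= z0; have [F' HF' E] := iter_derive_hclass vs HF gF.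
  have nE : \forall x \near z, F' x = iter_derive (homog0 g) vs x.
    by apply: filterS (near_neq0 z0) => x x0; rewrite E.
  split.
    rewrite /prop_for /continuous_at E//.
    apply: cvg_trans (hclass_cvg HF' z0); apply: near_eq_cvg.
    exact: nE.
  move=> v _; have [F'' _ dF] := hclass_derive v HF'.
  by apply: (near_eq_derivable nE); case: (dF z z0).
move=> vs _ k; have [F' HF' E] := iter_derive_hclass vs HF gF.
have [C CP] := hclass_bound k HF'; exists C => sigma theta t1.
by rewrite E ?enorm1_neq0//; exact: CP.
Qed.

End derivation.

End cylinder.

(** * The Radon transform of Schwartz functions *)

Section schwartz_class.
Context (R : realType) (n : nat).
Context (f : 'rV[R]_n -> R) (Sf : schwartz_real f).

(** The functions obtained from [f] by taking partial derivatives and then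
    multiplying by coordinates and adding; no derivative of a product has to be
    iterated to see that they decay rapidly. *)
Inductive schwartz_class : ('rV[R]_n -> R) -> Prop :=
| schwartz_class_derive vs : {in vs, forall v, rV_dirs v} ->
    schwartz_class (iter_derive f vs)
| schwartz_class_coord j g : schwartz_class g ->
    schwartz_class (fun x => x ord0 j * g x)
| schwartz_class_add g h : schwartz_class g -> schwartz_class h ->
    schwartz_class (fun x => g x + h x).

Lemma schwartz_class_self : schwartz_class f.
Proof. exact: (@schwartz_class_derive [::]). Qed.

Lemma schwartz_class_continuous g : schwartz_class g -> continuous g.
Proof.
elim=> {g} [vs dvs|j g _ cg|g h _ cg _ ch] x.
- by have [/(_ vs dvs x I)[]] := Sf.
- have cj : (x' : 'rV[R]_n) ord0 j @[x' --> x] --> x ord0 j by exact: coord_continuous.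
  exact: (cvgM cj (cg x)).
- exact: cvgD (cg x) (ch x).
Qed.

Lemma schwartz_class_rapid g k : schwartz_class g ->
  exists C, forall x, enorm x ^+ k * `|g x| <= C.
Proof.
move=> Hg; elim: Hg k => {g} [vs dvs|j g _ IH|g h _ IHg _ IHh] k.
- by have [_ /(_ vs dvs k)] := Sf.
- have [C CP] := IH k.+1; exists C => x.
  rewrite normrM mulrA; apply: le_trans (CP x).
  rewrite exprSr ler_wpM2r// ler_wpM2l ?exprn_ge0 ?enorm_ge0//.
  exact: coord_le_enorm.
- have [C CP] := IHg k; have [D DP] := IHh k; exists (C + D) => x.
  rewrite (le_trans (ler_wpM2l _ (ler_normD _ _))) ?exprn_ge0 ?enorm_ge0// mulrDr.
  by apply: lerD; [exact: CP|exact: DP].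
Qed.

Lemma schwartz_class_tame g : schwartz_class g -> tame g.
Proof.
move=> Hg; split; first exact: schwartz_class_continuous.
have [C0 C0P] := schwartz_class_rapid 0 Hg.
have [C1 C1P] := schwartz_class_rapid (2 * n) Hg.
exists (2 ^+ n * (C0 + C1)) => x.
rewrite ler_pdivlMr; last by rewrite exprn_gt0// ltr_wpDr ?dotp_ge0.
have ge0 k : 0 <= enorm x ^+ k * `|g x| by rewrite mulr_ge0 ?exprn_ge0 ?enorm_ge0.
have b : (1 + dotp x x) ^+ n <= 2 ^+ n * (1 + enorm x ^+ (2 * n)).
  rewrite -enorm_sqr exprM; have q0 : 0 <= enorm x ^+ 2 by exact: sqr_ge0.
  move: (enorm x ^+ 2) q0 => q q0; have [q1|q1] := leP q 1.
    apply: (@le_trans _ _ (2 ^+ n)); first by rewrite lerXn2r ?nnegrE//; lra.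
    by rewrite ler_peMr ?exprn_ge0// lerDl exprn_ge0.
  rewrite mulrDr -exprMn (@le_trans _ _ ((2 * q) ^+ n))//.
    by rewrite lerXn2r ?nnegrE//; lra.
  by rewrite lerDr mulr1 exprn_ge0.
rewrite mulrC (le_trans (ler_wpM2r _ b))// -mulrA ler_wpM2l ?exprn_ge0//.
rewrite mulrDl; apply: lerD; last exact: C1P.
by have := C0P x; rewrite expr0.
Qed.

Lemma schwartz_class_partial g i : schwartz_class g ->
  exists2 g', schwartz_class g' &
    forall x, is_derive x (delta_mx ord0 i : 'rV[R]_n) g (g' x).
Proof.
elim=> {g} [vs dvs|j g Hg [g' Hg' dg]|g h _ [g' Hg' dg] _ [h' Hh' dh]].
- have di : rV_dirs (delta_mx ord0 i : 'rV[R]_n) by exists i.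
  exists (iter_derive f (delta_mx ord0 i :: vs)).
    apply: schwartz_class_derive => v; rewrite inE => /predU1P[->//|]; exact: dvs.
  move=> x; apply: DeriveDef => //.
  by have [/(_ vs dvs x I)[_ +] _] := Sf; exact.
- have dc x : is_derive x (delta_mx ord0 i : 'rV[R]_n) (fun x => x ord0 j) (i == j)%:R.
    apply: is_derive_affine => h; rewrite !mxE eqxx /= addrC.
    by rewrite eq_sym.
  have [ij|ij] := eqVneq i j.
    exists (fun x : 'rV[R]_n => g x + x ord0 j * g' x).
      by apply: schwartz_class_add => //; exact: schwartz_class_coord.
    move=> x; apply: (is_derive_eq (is_derive_mul (dc x) (dg x))).
    by rewrite ij eqxx mul1r.
  exists (fun x : 'rV[R]_n => x ord0 j * g' x); first exact: schwartz_class_coord.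
  move=> x; apply: (is_derive_eq (is_derive_mul (dc x) (dg x))).
  by rewrite (negbTE ij) mul0r add0r.
- exists (fun x => g' x + h' x); first exact: schwartz_class_add.
  by move=> x; exact: is_derive_add (dg x) (dh x).
Qed.

End schwartz_class.

Definition ctame (R : realType) n (f : 'rV[R]_n -> R[i]) : Prop :=
  tame (@complex.Re R \o f) /\ tame (@complex.Im R \o f).

Lemma schwartz_ctame (R : realType) n (f : 'rV[R]_n -> R[i]) :
  schwartz f -> ctame f.
Proof.
by case=> Sr Si; split; [apply: (schwartz_class_tame Sr)|apply: (schwartz_class_tame Si)];
  exact: schwartz_class_self.
Qed.

Section radon_schwartz.
Context (R : realType) (m : nat).
Notation n := m.+1.

Lemma radon_unit (f : 'rV[R]_n -> R[i]) (z : R * 'rV[R]_n) : enorm z.2 = 1 ->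
  radon f z = Complex (radon_real (@complex.Re R \o f) z) (radon_real (@complex.Im R \o f) z).
Proof. by move=> z1; rewrite /radon z1 eqxx. Qed.

Let cyl_schwartz_hradon (f : 'rV[R]_n -> R) (g : R * 'rV[R]_n -> R) :
  schwartz_real f -> (forall z, z.2 != 0 -> homog0 g z = hradon f z) ->
  cyl_schwartz_real g.
Proof.
move=> Sf gf.
apply: (hclass_cyl_schwartz (S := schwartz_class f) _ _ _
  (hclass_radon (schwartz_class_self f)) gf).
- exact: schwartz_class_tame.
- by move=> h Hh i; exact: schwartz_class_partial.
- by move=> h j; exact: schwartz_class_coord.
Qed.

Lemma radon_cyl_schwartz (f : 'rV[R]_n -> R[i]) : schwartz f -> cyl_schwartz (radon f).
Proof.
case=> Sr Si; split; last by move=> z /negbTE z1; rewrite /radon z1.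
- apply: (cyl_schwartz_hradon Sr) => z z0.
  by rewrite /homog0 /= radon_unit//= enorm_normalize.
- apply: (cyl_schwartz_hradon Si) => z z0.
  by rewrite /homog0 /= radon_unit//= enorm_normalize.
Qed.

End radon_schwartz.

(** * Extension of isometries to completions *)

Section extended_limits.
Context (R : realType).
Local Open Scope ereal_scope.
Implicit Types (x y d : nat -> \bar R).

Lemma cvge0P x : (forall k, 0 <= x k) ->
  x k @[k --> \oo] --> 0 <->
  (forall e : R, (0 < e)%R -> \forall k \near \oo, x k < e%:E).
Proof.
move=> x0; split=> [/fine_cvgP[xfin xc] e e0|xe].
  move/cvgrPdist_lt : xc => /(_ e e0) xc.
  apply: filterS2 xfin xc => k xk /=; rewrite sub0r normrN => xke.
  by rewrite -(fineK xk) lte_fin (le_lt_trans _ xke)// ler_norm.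
apply/fine_cvgP; split.
  by apply: filterS (xe 1%R ltr01) => k xk; rewrite ge0_fin_numE// (lt_trans xk)// ltry.
apply/cvgrPdist_lt => e e0; apply: filterS (xe e e0) => k xk.
have xkf : x k \is a fin_num by rewrite ge0_fin_numE// (lt_trans xk)// ltry.
by rewrite sub0r normrN ger0_norm ?fine_ge0// -lte_fin fineK.
Qed.

Lemma cvge_near_equal x y d (l : \bar R) : (forall k, 0 <= x k) -> (forall k, 0 <= y k) ->
  (forall k, 0 <= d k) -> x k @[k --> \oo] --> l -> d k @[k --> \oo] --> 0 ->
  (forall k, x k <= y k + d k) -> (forall k, y k <= x k + d k) ->
  y k @[k --> \oo] --> l.
Proof.
move=> x0 y0 d0 xl dl xy yx.
have dfin : \forall k \near \oo, d k \is a fin_num.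
  by move/fine_cvgP : dl => [].
apply: (squeeze_cvge (f := fun k => (x k - d k)%E) (h := fun k => (x k + d k)%E)).
- by apply: filterS dfin => k dk; rewrite leeBlDr// xy yx.
- by rewrite -[l]sube0; apply: cvgeB => //; rewrite fin_num_adde_defl.
- by rewrite -[l]adde0; apply: cvgeD => //; rewrite fin_num_adde_defl.
Qed.

Lemma cvge_lt_near x (l : \bar R) (e : R) : (forall k, 0 <= x k) ->
  x k @[k --> \oo] --> l -> l < e%:E -> \forall k \near \oo, x k < e%:E.
Proof.
move=> x0 xl le; have l0 : 0 <= l.
  rewrite -(cvg_lim _ xl)//; apply: lime_ge; first by apply/cvg_ex; exists l.
  exact: nearW.
have lfin : l \is a fin_num by rewrite ge0_fin_numE// (lt_trans le)// ltry.
move: xl le; rewrite -(fineK lfin) => /fine_cvgP[xfin xc]; rewrite lte_fin => le.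
have xe : \forall k \near \oo, (fine (x k) < e)%R by exact: (cvgr_lt _ xc _ le).
by apply: filterS2 xfin xe => k xk xke; rewrite -(fineK xk) lte_fin.
Qed.

(** Once one late term is finite, all late terms are finite and the sequence is
    a Cauchy sequence of reals; otherwise it is eventually equal to [+oo]. *)
Lemma ge0_cauchy_cvg x : (forall k, 0 <= x k) ->
  (forall e : R, (0 < e)%R -> exists K, forall i j, (K <= i)%N -> (K <= j)%N ->
    x i <= x j + e%:E) -> cvg (x k @[k --> \oo]).
Proof.
move=> x0 xc; have [K KP] := xc 1%R ltr01.
have [[j Kj xj]|nfin] := pselect (exists2 j, (K <= j)%N & x j \is a fin_num).
  have xfin i : (K <= i)%N -> x i \is a fin_num.
    move=> Ki; rewrite ge0_fin_numE// (le_lt_trans (KP i j Ki Kj))//.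
    by rewrite lte_add_pinfty ?ltry// -ge0_fin_numE.
  have : cvg (fine (x k) @[k --> \oo]).
    apply/cauchy_cvgP/cauchy_exP => e e0.
    have [L LP] := xc (e / 2)%R (divr_gt0 e0 (ltr0n _ 2)).
    exists (fine (x (maxn K L))); exists (maxn K L) => // i /=.
    rewrite geq_max => /andP[Ki Li].
    have xi := xfin i Ki; have xm := xfin _ (leq_maxl K L).
    have h1 := LP i (maxn K L) Li (leq_maxr _ _).
    have h2 := LP (maxn K L) i (leq_maxr _ _) Li.
    move: h1 h2; rewrite -(fineK xi) -(fineK xm) -!EFinD !lee_fin => h1 h2.
    by rewrite /ball/= ltr_norml; apply/andP; split; lra.
  move=> /cvg_ex[/= l xl]; apply/cvg_ex; exists l%:E; apply/fine_cvgP; split => //.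
  by exists K => // i /=; exact: xfin.
apply/cvg_ex; exists +oo; apply: cvg_near_cst; exists K => // i /= Ki.
apply/eqP; case: (eqVneq (x i) +oo) => // xi; case: nfin; exists i => //.
by rewrite ge0_fin_numE// ltey.
Qed.

End extended_limits.

Section extended_seminorm.
Context (R : realType) (V : zmodType).
Local Open Scope ereal_scope.

(** The triangle inequality is asked for on a subgroup only, because the Fourier
    integrals in the norms are additive only on integrable functions. *)
Record seminorm_on (D : set V) (N : V -> \bar R) : Prop := SeminormOn {
  seminorm_memB : forall a b, D a -> D b -> D (a - b)%R ;
  seminorm_ge0 : forall a, 0 <= N a ;
  seminorm0 : N 0%R = 0 ;
  seminormB : forall a b, D a -> D b -> N (a - b)%R <= N a + N b }.

Context (D S : set V) (N : V -> \bar R) (ND : seminorm_on D N) (SD : S `<=` D).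

Lemma seminorm_distC a b : D a -> D b -> N (a - b)%R = N (b - a)%R.
Proof.
suff H u v : D u -> D v -> N (u - v)%R <= N (v - u)%R.
  by move=> Da Db; apply/eqP; rewrite eq_le !H.
move=> Du Dv; have D0 : D 0%R by rewrite -(subrr u); exact: (seminorm_memB ND).
have := seminormB ND D0 (seminorm_memB ND Dv Du).
by rewrite (seminorm0 ND) add0e sub0r opprB.
Qed.

Lemma seminorm_triangle a b c : D a -> D b -> D c ->
  N (a - c)%R <= N (a - b)%R + N (b - c)%R.
Proof.
move=> Da Db Dc; rewrite (seminorm_distC Db Dc).
have := seminormB ND (seminorm_memB ND Da Db) (seminorm_memB ND Dc Db).
by rewrite opprB addrA subrK.
Qed.

Lemma seminorm_le_dist a b : D a -> D b -> N a <= N b + N (a - b)%R.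
Proof.
move=> Da Db; have D0 : D 0%R by rewrite -(subrr a); exact: (seminorm_memB ND).
by have := seminorm_triangle Da Db D0; rewrite !subr0 addeC.
Qed.

Lemma seminorm_dist2 a b a' b' : D a -> D b -> D a' -> D b' ->
  N (a - b)%R <= N (a' - b')%R + (N (a - a')%R + N (b - b')%R).
Proof.
move=> Da Db Da' Db'.
rewrite (le_trans (seminorm_triangle Da Da' Db))// addeCA leeD2l//.
by rewrite (le_trans (seminorm_triangle Da' Db' Db))// leeD2l// seminorm_distC.
Qed.

Implicit Types (u v w : nat -> V) (x y z : completion S N).

Lemma cauchy_mem u k : cauchy_seq S N u -> D (u k).
Proof. by case=> /(_ k) /SD. Qed.

Lemma representative_cauchy x : cauchy_seq S N (representative x).
Proof. by rewrite /representative; case: (cid2 _). Qed.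

Lemma classE x : class x = cauchy_class S N (representative x).
Proof. by rewrite /representative; case: (cid2 _). Qed.

Lemma representative_mem x k : D (representative x k).
Proof. exact/cauchy_mem/representative_cauchy. Qed.
Hint Resolve representative_mem : core.

Lemma cauchy_class_self u : cauchy_seq S N u -> cauchy_class S N u u.
Proof.
move=> cu; split => //; under eq_fun do rewrite subrr (seminorm0 ND).
exact: cvg_cst.
Qed.

Let dist_ge0 u v k : 0 <= N (u k - v k)%R.
Proof. exact: seminorm_ge0 ND _. Qed.

Lemma null_trans u v w : (forall k, D (u k)) -> (forall k, D (v k)) ->
  (forall k, D (w k)) -> N (u k - v k)%R @[k --> \oo] --> 0 ->
  N (v k - w k)%R @[k --> \oo] --> 0 -> N (u k - w k)%R @[k --> \oo] --> 0.
Proof.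
move=> Du Dv Dw /(cvge0P (dist_ge0 u v)) uv /(cvge0P (dist_ge0 v w)) vw.
apply/(cvge0P (dist_ge0 u w)) => e e0.
have e20 : (0 < e / 2)%R by rewrite divr_gt0.
apply: filterS2 (uv _ e20) (vw _ e20) => k uvk vwk.
rewrite (le_lt_trans (seminorm_triangle (Du k) (Dv k) (Dw k)))//.
by rewrite [e]splitr EFinD lteD.
Qed.

Lemma null_sym u v : (forall k, D (u k)) -> (forall k, D (v k)) ->
  N (u k - v k)%R @[k --> \oo] --> 0 -> N (v k - u k)%R @[k --> \oo] --> 0.
Proof. by move=> Du Dv; under eq_fun do rewrite seminorm_distC//. Qed.

Lemma completion_eq x y : class x = class y -> x = y.
Proof.
case: x => [cx px]; case: y => [cy py] /= E; subst cy.
by rewrite (Prop_irrelevance px py).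
Qed.

Lemma completion_null_eq x y :
  N (representative x k - representative y k)%R @[k --> \oo] --> 0 -> x = y.
Proof.
move=> xy; apply: completion_eq; rewrite !classE; apply/seteqP.
split => v [cv xv]; split => //; have Dv k : D (v k) by exact: cauchy_mem cv.
  by apply: (null_trans _ _ _ _ xv) => //; exact: null_sym.
exact: (null_trans _ _ _ xy xv).
Qed.

Lemma class_null x v : class x v -> N (representative x k - v k)%R @[k --> \oo] --> 0.
Proof. by rewrite classE => -[]. Qed.

Lemma class_cauchy x v : class x v -> cauchy_seq S N v.
Proof. by rewrite classE => -[]. Qed.

Lemma class_inj x y v : class x v -> class y v -> x = y.
Proof.
move=> xv yv; have Dv k : D (v k) by exact: cauchy_mem (class_cauchy xv).
apply: completion_null_eq; apply: (null_trans _ Dv _ (class_null xv)) => //.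
by apply: null_sym => //; exact: class_null.
Qed.

Lemma cvg_seminorm u : cauchy_seq S N u -> cvg (N (u k) @[k --> \oo]).
Proof.
move=> cu; apply: ge0_cauchy_cvg => [k|e e0]; first exact: seminorm_ge0 ND _.
have [_ /(_ e e0)[K KP]] := cu; exists K => i j Ki Kj.
rewrite (le_trans (seminorm_le_dist (cauchy_mem i cu) (cauchy_mem j cu)))//.
by rewrite leeD2l// ltW// KP.
Qed.

Lemma cvg_dist u v : cauchy_seq S N u -> cauchy_seq S N v ->
  cvg (N (u k - v k)%R @[k --> \oo]).
Proof.
move=> cu cv; apply: ge0_cauchy_cvg => // e e0.
have e20 : (0 < e / 2)%R by rewrite divr_gt0.
have [_ /(_ _ e20)[K KP]] := cu; have [_ /(_ _ e20)[L LP]] := cv.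
exists (maxn K L) => i j; rewrite !geq_max => /andP[Ki Li] /andP[Kj Lj].
have Du k := cauchy_mem k cu; have Dv k := cauchy_mem k cv.
rewrite (le_trans (seminorm_dist2 (Du i) (Dv i) (Du j) (Dv j)))//.
by rewrite leeD2l// [e]splitr EFinD leeD// ltW// ?KP ?LP.
Qed.

Lemma completion_dist_cvg x y :
  N (representative x k - representative y k)%R @[k --> \oo] --> completion_dist x y.
Proof. exact: cvg_dist (representative_cauchy x) (representative_cauchy y). Qed.

Lemma completion_norm_class x u : class x u ->
  N (u k) @[k --> \oo] --> completion_norm x.
Proof.
move=> xu; have Du k := cauchy_mem k (class_cauchy xu).
apply: (cvge_near_equal _ _ _ (cvg_seminorm (representative_cauchy x)) (class_null xu)) => // k.
- exact: seminorm_ge0 ND _.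
- exact: seminorm_ge0 ND _.
- exact: seminorm_le_dist.
- by rewrite seminorm_distC//; exact: seminorm_le_dist.
Qed.

Lemma completion_dist_class x y u v : class x u -> class y v ->
  N (u k - v k)%R @[k --> \oo] --> completion_dist x y.
Proof.
move=> xu yv; have Du k := cauchy_mem k (class_cauchy xu).
have Dv k := cauchy_mem k (class_cauchy yv).
have nul : N (representative x k - u k)%R + N (representative y k - v k)%R
    @[k --> \oo] --> 0.
  by rewrite -[0]adde0; apply: cvgeD => //; exact: class_null.
apply: (@cvge_near_equal _ (fun k => N (representative x k - representative y k)%R)
  _ (fun k => (N (representative x k - u k)%R + N (representative y k - v k)%R)%E) _
  _ _ _ (@completion_dist_cvg x y) nul) => // k.
- by rewrite adde_ge0.
- exact: seminorm_dist2.
- rewrite (seminorm_distC (representative_mem x k) (Du k)).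
  rewrite (seminorm_distC (representative_mem y k) (Dv k)).
  exact: seminorm_dist2.
Qed.

Lemma const_cauchy a : S a -> cauchy_seq S N (fun=> a).
Proof.
move=> Sa; split=> // e e0; exists 0%N => i j _ _.
by rewrite subrr (seminorm0 ND) lte_fin.
Qed.

Definition completion_of u (cu : cauchy_seq S N u) : completion S N :=
  Completion (ex_intro2 _ _ u cu (erefl (cauchy_class S N u))).

Lemma class_completion_of u (cu : cauchy_seq S N u) : class (completion_of cu) u.
Proof. exact: cauchy_class_self. Qed.

Lemma completion_dense x (e : R) : (0 < e)%R -> exists2 a, S a &
  forall y, is_embedding a y -> completion_dist x y < e%:E.
Proof.
move=> e0; have cx := representative_cauchy x.
have e20 : (0 < e / 2)%R by rewrite divr_gt0.
have [Sx /(_ _ e20)[K KP]] := cx.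
exists (representative x K) => // y ya.
have xy := completion_dist_class (eq_ind_r (@^~ _) (cauchy_class_self cx) (classE x)) ya.
apply: (@le_lt_trans _ _ (e / 2)%:E); last by rewrite lte_fin ltr_pdivrMr// ltr_pMr// ltr1n.
rewrite -(cvg_lim _ xy)//; apply: lime_le; first by apply/cvg_ex; exists (completion_dist x y).
by exists K => // k /= Kk; rewrite ltW// KP.
Qed.

End extended_seminorm.

Section isometric_extension.
Context (R : realType) (V W : zmodType).
Context (D S : set V) (N : V -> \bar R) (ND : seminorm_on D N) (SD : S `<=` D).
Context (D' S' : set W) (N' : W -> \bar R) (ND' : seminorm_on D' N') (SD' : S' `<=` D').
Context (A : V -> W) (SA : forall f, S f -> S' (A f)).
Context (NA : forall f, S f -> N' (A f) = N f).
Context (NAB : forall f g, S f -> S g -> N' (A f - A g) = N (f - g)).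
Local Open Scope ereal_scope.

Let image_cauchy u : cauchy_seq S N u -> cauchy_seq S' N' (A \o u).
Proof.
move=> [Su uc]; split=> [k|e e0]; first exact: SA.
have [K KP] := uc e e0; exists K => i j Ki Kj.
by rewrite /= NAB//; exact: KP.
Qed.

Let T (x : completion S N) : completion S' N' :=
  completion_of (image_cauchy (representative_cauchy x)).

Let class_T x u : class x u -> class (T x) (A \o u).
Proof.
move=> xu; have [Su _] := class_cauchy xu.
split; first exact: image_cauchy (class_cauchy xu).
have [Sx _] := representative_cauchy x.
under eq_fun do rewrite /= NAB//.
exact: class_null.
Qed.

Let class_representative (x : completion S N) : class x (representative x).
Proof. by rewrite classE; exact: (cauchy_class_self ND (representative_cauchy x)). Qed.

Let norm_T x : completion_norm x = completion_norm (T x).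
Proof.
have h1 := completion_norm_class ND SD (class_representative x).
have h2 := completion_norm_class ND' SD' (class_T (class_representative x)).
have E : (fun k => N' ((A \o representative x) k)) = fun k => N (representative x k).
  by apply/funext => k /=; rewrite NA//; have [] := representative_cauchy x.
by rewrite E in h2; exact: cvg_unique h1 h2.
Qed.

Let dist_T x y : completion_dist (T x) (T y) = completion_dist x y.
Proof.
have h1 := completion_dist_class ND SD (class_representative x) (class_representative y).
have h2 := completion_dist_class ND' SD' (class_T (class_representative x))
  (class_T (class_representative y)).
have E : (fun k => N' ((A \o representative x) k - (A \o representative y) k)%R) =
    fun k => N (representative x k - representative y k)%R.
  apply/funext => k /=; rewrite NAB//.
  - by have [] := representative_cauchy x.
  - by have [] := representative_cauchy y.
by rewrite E in h2; exact: cvg_unique h2 h1.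
Qed.

Let T_extends : continuous_extension A T.
Proof.
split=> [x e e0|f x]; first by exists e => // y; rewrite dist_T.
exact: class_T.
Qed.

Let T_unique T' : continuous_extension A T' -> T = T'.
Proof.
move=> [cT' eT']; apply/funext => x.
apply: (completion_null_eq ND' SD').
apply/cvge0P => [k|e e0]; first exact: seminorm_ge0 ND' _.
have e20 : (0 < e / 2)%R by rewrite divr_gt0.
have [d d0 dP] := cT' x _ e20.
have dm0 : (0 < Num.min d (e / 2))%R by rewrite lt_min d0.
have [a Sa aP] := completion_dense ND SD x dm0.
pose y := completion_of (const_cauchy ND Sa).
have ya : is_embedding a y by exact: (class_completion_of ND).
have xy := aP y ya.
have TT' : T' y = T y.
  by apply: (class_inj ND' SD' (eT' _ _ ya)); exact: class_T.
have h1 : completion_dist (T' x) (T y) < (e / 2)%:E.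
  by rewrite -TT'; apply: dP; rewrite (lt_le_trans xy)// lee_fin ge_min lexx.
have h2 : completion_dist (T x) (T y) < (e / 2)%:E.
  by rewrite dist_T (lt_le_trans xy)// lee_fin ge_min lexx orbT.
have near_lt z : completion_dist z (T y) < (e / 2)%:E -> \forall k \near \oo,
    N' (representative z k - representative (T y) k)%R < (e / 2)%:E.
  move=> zy; have := completion_dist_cvg ND' SD' (x := z) (y := T y).
  move=> /cvge_lt_near; apply => // k; exact: seminorm_ge0 ND' _.
apply: filterS2 (near_lt _ h2) (near_lt _ h1) => k k1 k2.
have Dr (z : completion S' N') := representative_mem SD' z k.
rewrite (le_lt_trans (seminorm_triangle ND' (Dr (T x)) (Dr (T y)) (Dr (T' x))))//.
by rewrite [e]splitr EFinD lteD// (seminorm_distC ND').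
Qed.

(** [A] maps Cauchy sequences to Cauchy sequences and equivalent ones to
    equivalent ones, hence acts on the completion; since constant sequences are
    dense, no other continuous map extends it. *)
Lemma isometric_extension : exists T : completion S N -> completion S' N',
  unique (continuous_extension A) T /\
  forall x, completion_norm x = completion_norm (T x).
Proof. by exists T; split; [split; [exact: T_extends|exact: T_unique]|exact: norm_T]. Qed.

End isometric_extension.

(** * Fourier transforms and the slice theorem *)

Section complex_integral.
Context d (T : measurableType d) (R : realType) (mu : {measure set T -> \bar R}).
Implicit Types (a h : T -> R) (g : T -> R[i]).

Lemma integrable_bounded_mul a h (K : R) :
  measurable_fun setT a -> (forall x, `|a x| <= K) ->
  mu.-integrable setT (EFin \o h) ->
  mu.-integrable setT (fun x => (a x * h x)%:E).
Proof.
move=> ma aK ih; have mh : measurable_fun setT h.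
  by apply/measurable_EFinP; exact: measurable_int ih.
have iKh : mu.-integrable setT (fun x => K%:E * `|(h x)%:E|)%E.
  by apply: integrableZl => //; exact: integrable_abse.
apply: (le_integrable _ _ _ iKh) => //.
  by apply/measurable_EFinP; exact: measurable_funM.
move=> x _ /=; rewrite lee_fin normrM (le_trans _ (ler_norm _))//.
by rewrite ler_wpM2r.
Qed.

Definition cintegrable g : Prop :=
  mu.-integrable setT (EFin \o (@complex.Re R \o g)) /\
  mu.-integrable setT (EFin \o (@complex.Im R \o g)).

Lemma Re_cisM (t : R) (z : R[i]) :
  complex.Re (cis t * z) = cos t * complex.Re z - sin t * complex.Im z.
Proof. by case: z => u v. Qed.

Lemma Im_cisM (t : R) (z : R[i]) :
  complex.Im (cis t * z) = cos t * complex.Im z + sin t * complex.Re z.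
Proof. by case: z => u v. Qed.

Lemma ReB (z w : R[i]) : complex.Re (z - w) = complex.Re z - complex.Re w.
Proof. by case: z => a b; case: w => c e. Qed.

Lemma ImB (z w : R[i]) : complex.Im (z - w) = complex.Im z - complex.Im w.
Proof. by case: z => a b; case: w => c e. Qed.

Section cis_mul.
Context (a : T -> R) (g : T -> R[i]).
Context (ma : measurable_fun setT a) (ig : cintegrable g).
Notation u := (@complex.Re R \o g).
Notation v := (@complex.Im R \o g).

Let mcos : measurable_fun setT (fun x => cos (a x)).
Proof.
by apply: (measurableT_comp _ ma); apply: continuous_measurable_fun; exact: continuous_cos.
Qed.

Let msin : measurable_fun setT (fun x => sin (a x)).
Proof.
by apply: (measurableT_comp _ ma); apply: continuous_measurable_fun; exact: continuous_sin.
Qed.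

Let icos h : mu.-integrable setT (EFin \o h) ->
  mu.-integrable setT (fun x => (cos (a x) * h x)%:E).
Proof. by apply: (@integrable_bounded_mul _ h 1 mcos) => x; rewrite ler_norml cos_geN1 cos_le1. Qed.

Let isin h : mu.-integrable setT (EFin \o h) ->
  mu.-integrable setT (fun x => (sin (a x) * h x)%:E).
Proof. by apply: (@integrable_bounded_mul _ h 1 msin) => x; rewrite ler_norml sin_geN1 sin_le1. Qed.

Lemma cintegrable_cisM : cintegrable (fun x => cis (a x) * g x).
Proof.
have [iu iv] := ig; split.
  rewrite (_ : _ \o _ = fun x => (cos (a x) * u x)%:E - (sin (a x) * v x)%:E)%E.
    by apply: integrableB => //; [exact: icos|exact: isin].
  by apply/funext => x; rewrite /comp Re_cisM EFinB.
rewrite (_ : _ \o _ = fun x => (cos (a x) * v x)%:E + (sin (a x) * u x)%:E)%E.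
  by apply: integrableD => //; [exact: icos|exact: isin].
by apply/funext => x; rewrite /comp Im_cisM EFinD.
Qed.

Lemma cintegral_cisM : cintegral mu (fun x => cis (a x) * g x) =
  Complex ((\int[mu]_x (cos (a x) * u x)) - (\int[mu]_x (sin (a x) * v x)))
          ((\int[mu]_x (cos (a x) * v x)) + (\int[mu]_x (sin (a x) * u x))).
Proof.
have [iu iv] := ig; rewrite /cintegral; congr Complex.
  rewrite -RintegralB; [|by []|exact: icos|exact: isin].
  by apply: eq_Rintegral => x _; exact: Re_cisM.
rewrite -RintegralD; [|by []|exact: icos|exact: isin].
by apply: eq_Rintegral => x _; exact: Im_cisM.
Qed.

End cis_mul.

Lemma cintegralB g (h : T -> R[i]) : cintegrable g -> cintegrable h ->
  cintegral mu (fun x => g x - h x) = cintegral mu g - cintegral mu h.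
Proof.
move=> [gr gi] [hr hi]; rewrite /cintegral.
apply/eqP; rewrite eq_complex ReB ImB /=; apply/andP; split; apply/eqP.
  rewrite -RintegralB; [|by []|exact: gr|exact: hr].
  by apply: eq_Rintegral => x _; exact: ReB.
rewrite -RintegralB; [|by []|exact: gi|exact: hi].
by apply: eq_Rintegral => x _; exact: ImB.
Qed.

Lemma cintegrableB g (h : T -> R[i]) : cintegrable g -> cintegrable h ->
  cintegrable (fun x => g x - h x).
Proof.
move=> [gr gi] [hr hi]; split.
  rewrite (_ : _ \o _ = (EFin \o (@complex.Re R \o g)) \- (EFin \o (@complex.Re R \o h)))%E.
    exact: integrableB.
  by apply/funext => x; rewrite /comp ReB EFinB.
rewrite (_ : _ \o _ = (EFin \o (@complex.Im R \o g)) \- (EFin \o (@complex.Im R \o h)))%E.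
  exact: integrableB.
by apply/funext => x; rewrite /comp ImB EFinB.
Qed.

End complex_integral.

Section modulus.
Context (R : realType).

Lemma cmodE (z : R[i]) : cmod z = Num.sqrt (complex.Re z ^+ 2 + complex.Im z ^+ 2).
Proof. by case: z. Qed.

Lemma cmod_ge0 (z : R[i]) : 0 <= cmod z.
Proof. by rewrite cmodE sqrtr_ge0. Qed.

Lemma cmodM (z w : R[i]) : cmod (z * w) = cmod z * cmod w.
Proof. exact: ComplexField.Normc.normcM. Qed.

Lemma cmod_leB (z w : R[i]) : cmod (z - w) <= cmod z + cmod w.
Proof.
have -> : cmod w = cmod (- w).
  by case: w => u v; rewrite !cmodE/= !sqrrN.
exact: le_normcD.
Qed.

Lemma measurable_cmod d (T : measurableType d) (g : T -> R[i]) :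
  measurable_fun setT (@complex.Re R \o g) -> measurable_fun setT (@complex.Im R \o g) ->
  measurable_fun setT (fun x => cmod (g x)).
Proof.
move=> mr mi.
rewrite (_ : (fun x => _) = fun x =>
    ((@complex.Re R \o g) x ^+ 2 + (@complex.Im R \o g) x ^+ 2) `^ 2^-1).
  apply: (measurableT_comp (measurable_powR _)).
  by apply: measurable_funD; exact: measurable_funX.
by apply/funext => x; rewrite cmodE powR12_sqrt// addr_ge0// sqr_ge0.
Qed.

End modulus.

Section fourier_slice.
Context (R : realType) (m : nat).
Notation n := m.+1.
Notation leb := (@lebesgue_measure R).
Notation mu := (lebesgue_rV R).
Implicit Types (f g : 'rV[R]_n -> R[i]).

Lemma integrable_radon_real (f : 'rV[R]_n -> R) theta : tame f -> enorm theta = 1 ->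
  leb.-integrable setT (fun tau => (radon_real f (tau, theta))%:E).
Proof.
move=> tf theta1; have mf := tame_measurable tf.
have := integrable_fubini_F (integrable_frame theta1 mf (tame_integrable tf)).
congr (integrable _ _ _); apply/funext => tau.
rewrite /fubini_F /radon_real fineK//.
by apply: integrable_fin_num => //; exact: integrable_frame_slice.
Qed.

Lemma ctame_cintegrable f : ctame f -> cintegrable (mu n) f.
Proof. by move=> [fr fi]; split; exact: tame_integrable. Qed.

Lemma ctameB f g : ctame f -> ctame g -> ctame (f - g).
Proof.
move=> [fr fi] [gr gi]; split.
  rewrite (_ : _ \o _ = fun x => (@complex.Re R \o f) x - (@complex.Re R \o g) x).
    exact: tameB.
  by apply/funext => x; exact: ReB.
rewrite (_ : _ \o _ = fun x => (@complex.Im R \o f) x - (@complex.Im R \o g) x).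
  exact: tameB.
by apply/funext => x; exact: ImB.
Qed.

Lemma radon_cintegrable f theta : ctame f -> enorm theta = 1 ->
  cintegrable leb (fun tau => radon f (tau, theta)).
Proof.
move=> [fr fi] theta1; split.
  rewrite (_ : _ \o _ = fun tau => (radon_real (@complex.Re R \o f) (tau, theta))%:E).
    exact: integrable_radon_real.
  by apply/funext => tau; rewrite /comp radon_unit.
rewrite (_ : _ \o _ = fun tau => (radon_real (@complex.Im R \o f) (tau, theta))%:E).
  exact: integrable_radon_real.
by apply/funext => tau; rewrite /comp radon_unit.
Qed.

Lemma radonB f g : ctame f -> ctame g -> radon (f - g) = radon f - radon g.
Proof.
move=> tf tg; apply/funext => z; change (radon (f - g) z = radon f z - radon g z).
have [z1|z1] := eqVneq (enorm z.2) 1; last first.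
  by rewrite /radon !(negPf z1) subr0.
have tfg := ctameB tf tg.
have [fr fi] := tf; have [gr gi] := tg.
rewrite !radon_unit//; apply/eqP; rewrite eq_complex ReB ImB /=.
apply/andP; split; apply/eqP; rewrite /radon_real.
  rewrite -RintegralB; [|by []|exact: integrable_frame_slice|exact: integrable_frame_slice].
  by apply: eq_Rintegral => y _; exact: ReB.
rewrite -RintegralB; [|by []|exact: integrable_frame_slice|exact: integrable_frame_slice].
by apply: eq_Rintegral => y _; exact: ImB.
Qed.

(** Integrating over all hyperplanes orthogonal to [theta] amounts to
    integrating over the space, and on each of them the phase [dotp x theta] is
    constant. *)
Lemma fourier_slice f (sigma : R) theta : ctame f -> enorm theta = 1 ->
  fourier1 (radon f) (sigma, theta) = fourier f (sigma *: theta).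
Proof.
move=> tf theta1; have [fr fi] := tf; rewrite /fourier1 /fourier; congr (_ * _).
have ms : measurable_fun [set: measurableTypeR R] (fun tau : R => sigma * tau).
  by apply: measurable_funM.
have md : measurable_fun [set: 'rV[R]_n] (fun x => dotp x (sigma *: theta)).
  by apply: measurable_dotp => //; exact: measurable_cst.
rewrite (cintegral_cisM ms (radon_cintegrable tf theta1)).
rewrite (cintegral_cisM md (ctame_cintegrable tf)).
have dE x : dotp x (sigma *: theta) = sigma * dotp x theta.
  by rewrite /dotp mulr_sumr; apply: eq_bigr => i _; rewrite mxE mulrCA.
have slice (h : 'rV[R]_n -> R) (phi : R -> R) (g : R -> R) : tame h ->
    measurable_fun [set: measurableTypeR R] phi -> (forall t, `|phi t| <= 1) ->
    (forall tau, g tau = radon_real h (tau, theta)) ->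
    \int[leb]_tau (phi (sigma * tau) * g tau) =
    \int[mu n]_x (phi (dotp x (sigma *: theta)) * h x).
  move=> th mphi phi1 gE; rewrite /Rintegral; congr fine.
  have := @integral_radon_real _ _ h theta (fun t => phi (sigma * t)) 1 th theta1
    (measurableT_comp mphi ms) (fun t => phi1 _).
  move=> E; transitivity (\int[leb]_tau (phi (sigma * tau) * radon_real h (tau, theta))%:E)%E.
    by apply: eq_integral => tau _; rewrite gE.
  by rewrite E; apply: eq_integral => x _; rewrite dE.
have mcos : measurable_fun [set: measurableTypeR R] (@cos R).
  by apply: continuous_measurable_fun; exact: continuous_cos.
have msin : measurable_fun [set: measurableTypeR R] (@sin R).
  by apply: continuous_measurable_fun; exact: continuous_sin.
have cos1 (t : R) : `|cos t| <= 1 by rewrite ler_norml cos_geN1 cos_le1.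
have sin1 (t : R) : `|sin t| <= 1 by rewrite ler_norml sin_geN1 sin_le1.
have rE tau : (@complex.Re R \o (fun tau => radon f (tau, theta))) tau =
    radon_real (@complex.Re R \o f) (tau, theta) by rewrite /comp radon_unit.
have iE tau : (@complex.Im R \o (fun tau => radon f (tau, theta))) tau =
    radon_real (@complex.Im R \o f) (tau, theta) by rewrite /comp radon_unit.
by congr Complex; congr (_ + _); try congr (- _); apply: slice.
Qed.

Lemma fourier1_off_sphere f z : enorm z.2 != 1 -> fourier1 (radon f) z = 0.
Proof.
move=> z1; rewrite /fourier1.
have -> : (fun tau => cis (z.1 * tau) * radon f (tau, z.2)) = fun=> 0.
  by apply/funext => tau; rewrite /radon /= ifN// mulr0.
rewrite /cintegral /= Rintegral_cst// mul0r.
by rewrite (_ : Complex 0 0 = 0)// mulr0.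
Qed.

End fourier_slice.

(** * Polar coordinates *)

Section polar.
Local Open Scope ereal_scope.
Context (R : realType).
Notation leb := (@lebesgue_measure R).
Notation mu := (lebesgue_rV R).

Lemma ge0_integral_mrestr d (T : measurableType d) (m : {measure set T -> \bar R})
    (D : set T) (mD : measurable D) (f : T -> \bar R) :
  measurable_fun setT f -> (forall x, 0 <= f x) ->
  \int[mrestr m mD]_x f x = \int[m]_(x in D) f x.
Proof.
move=> mf f0; have mC : measurable (~` D) by exact: measurableC.
rewrite (@ge0_negligible_integral _ _ _ (mrestr m mD) setT (~` D))//; last first.
  by rewrite /= /mrestr setICl measure0.
rewrite setTD setCK; apply: eq_measure_integral => A mA AD.
by rewrite /= /mrestr setIidl.
Qed.

Lemma measurable_ball n (r : R) : measurable [set x : 'rV[R]_n | 0 < enorm x <= r]%R.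
Proof.
have -> : [set x : 'rV[R]_n | 0 < enorm x <= r]%R = @enorm R n @^-1` `]0%R, r]%classic.
  by apply/seteqP; split => x; rewrite /= in_itv.
by rewrite -[X in measurable X]setTI; exact: measurable_enorm.
Qed.

Lemma ge0_integral_sphere n (G : 'rV[R]_n -> \bar R) :
  measurable_fun setT G -> (forall x, 0 <= G x) ->
  \int[@sphere_measure R n]_theta G theta =
  n%:R%:E * \int[mu n]_(x in [set x | 0 < enorm x <= 1]%R) G ((enorm x)^-1 *: x)%R.
Proof.
move=> mG G0.
rewrite (@ge0_integral_image _ _ _ _ _ (mrestr (mu n) (@measurable_ball n 1%R)) _
  _ (@measurable_normalize R n) n%:R%R G)//.
congr (_ * _); apply: ge0_integral_mrestr => //.
by apply: (measurableT_comp mG); exact: measurable_normalize.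
Qed.

Lemma measurable_halfline_power n (r : R) : measurable_fun [set: measurableTypeR R]
  (fun rho : R => if r <= rho then rho^-1 ^+ n else 0)%R.
Proof.
apply: measurable_fun_ifT => //.
- by apply: measurable_fun_ler => //; exact: measurable_cst.
- by apply: measurable_funX; exact: measurable_invr.
Qed.

Lemma integral_halfline_power n (r : R) : (0 < n)%N -> (0 < r)%R ->
  \int[leb]_rho (if r <= rho then rho^-1 ^+ n.+1 else 0)%:E = (n%:R^-1 * r^-1 ^+ n)%:E.
Proof.
move=> n0 r0.
have nR : (n%:R : R) != 0%R by rewrite pnatr_eq0 -lt0n.
pose F (x : R) : R := (- n%:R^-1 * (x^-1) ^+ n)%R.
have dF (x : R) : x != 0%R -> is_derive x (1%R : R) F (x^-1 ^+ n.+1)%R.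
  move=> x0; have dV : is_derive x (1%R : R) (fun x : R => x^-1)%R (- x ^- 2)%R.
    have := @is_deriveV R id x 1%R 1%R x0 (is_derive_id x 1%R).
    by move=> h; apply: is_derive_eq; rewrite scaler1.
  have dX := @is_deriveX _ _ _ n _ _ _ dV.
  have := @is_deriveZ _ _ _ _ (- n%:R^-1)%R _ _ _ dX.
  have -> : (- n%:R^-1 \*: ((fun x : R => x^-1) ^+ n) = F)%R.
    by apply/funext => y; rewrite /F /= exprfctE.
  move=> h; apply: (is_derive_eq h).
  rewrite /GRing.scale /= -(prednK n0) /= !exprS.
  by rewrite prednK//; field; rewrite nR x0.
have cF (x : R) : x != 0%R -> {for x, continuous F}.
  by move=> x0; apply: differentiable_continuous; apply/derivable1_diffP; have [] := dF x x0.
have pos (x : R) : (r <= x)%R -> x != 0%R by move=> rx; rewrite gt_eqF// (lt_le_trans r0).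
transitivity (\int[leb]_(rho in `[r, +oo[%classic) (rho^-1 ^+ n.+1)%:E).
  rewrite [RHS]integral_mkcond; apply: eq_integral => x _.
  by rewrite patchE mem_setE in_itv /= andbT; case: ifP.
rewrite (@ge0_continuous_FTC2y R _ F r 0%R).
- by rewrite sub0e /F -EFinN; congr EFin; rewrite mulNr opprK.
- by move=> x rx; rewrite exprn_ge0// invr_ge0 (le_trans (ltW r0)).
- have cinv (x : R) : (r <= x)%R -> {for x, continuous (fun x : R => x^-1 ^+ n.+1)%R}.
    move=> rx; apply: (@cvg_comp _ _ _ (fun x : R => x^-1)%R (fun y : R => y ^+ n.+1)%R).
      exact: (cvgV (pos x rx) cvg_id).
    exact: exprn_continuous.
  apply/continuous_within_itvcyP; split.
    by move=> x; rewrite in_itv/= andbT => rx; apply: cinv; exact: ltW.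
  by apply: cvg_at_right_filter; exact: cinv.
- have c0 : (x^-1)%R @[x --> +oo%R] --> (0%R : R).
    by apply/gtr0_cvgV0 => //; exact: nbhs_pinfty_gt.
  have c1 : (x^-1 ^+ n)%R @[x --> +oo%R] --> ((0 : R) ^+ n)%R.
    exact: (cvg_comp (fun x : R => x^-1)%R (fun y : R => y ^+ n)%R c0 (@exprn_continuous _ n 0%R)).
  rewrite expr0n gtn_eqF// mulr0n in c1.
  have c2 : (fun=> - n%:R^-1 : R)%R x @[x --> (+oo%R : set_system R)] --> (- n%:R^-1 : R)%R.
    exact: cvg_cst.
  have := cvgM c2 c1; rewrite mulr0; exact.
- by move=> x rx; have [] := dF x (pos x (ltW rx)).
- by apply: cvg_at_right_filter; apply: cF; exact: pos.
- move=> x; rewrite in_itv/= andbT => rx; rewrite derive1E.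
  by have := dF x (pos x (ltW rx)) => h; exact: derive_val.
Qed.

(** The two half-lines contribute equally. *)
Lemma integral_shell_power n (r : R) : (0 < n)%N -> (0 < r)%R ->
  \int[leb]_rho (if r <= `|rho| then `|rho|^-1 ^+ n.+1 else 0)%:E =
  (2 / n%:R * r^-1 ^+ n)%:E.
Proof.
move=> n0 r0.
pose g (x : R) : R := if (r <= x)%R then (x^-1 ^+ n.+1)%R else 0%R.
have mg : measurable_fun [set: measurableTypeR R] (EFin \o g).
  by apply/measurable_EFinP; exact: measurable_halfline_power.
have g0 x : 0 <= (g x)%:E.
  rewrite lee_fin /g; case: ifPn => // rx.
  by rewrite exprn_ge0// invr_ge0 (le_trans (ltW r0)).
have gN : \int[leb]_x (g (- x)%R)%:E = \int[leb]_x (g x)%:E.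
  rewrite [RHS](@ge0_integral_affine R (EFin \o g) (-1)%R 0%R) ?oppr_eq0 ?oner_eq0//.
  rewrite normrN1 mul1e; apply: eq_integral => x _.
  by rewrite /= mulN1r addr0.
transitivity (\int[leb]_x ((g x)%:E + (g (- x)%R)%:E)).
  apply: eq_integral => x _; rewrite -EFinD /g; congr EFin.
  have [x0|x0] := leP 0%R x.
    rewrite ger0_norm// [X in (_ + X)%R]ifF ?addr0//.
    by apply/negbTE; rewrite -ltNge (le_lt_trans _ r0)// oppr_le0.
  rewrite ltr0_norm// [X in (X + _)%R]ifF ?add0r//.
  by apply/negbTE; rewrite -ltNge (lt_trans x0).
rewrite ge0_integralD//; last first.
  have mN : measurable_fun [set: measurableTypeR R] (fun x : R => - x)%R.
    by apply: continuous_measurable_fun; exact: opp_continuous.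
  exact: (measurableT_comp mg mN).
rewrite gN integral_halfline_power// -EFinD; congr EFin.
by rewrite -mulrA mulr_natl mulr2n.
Qed.

Lemma lebesgue_rV_origin n : mu n.+1 [set x | enorm x = 0]%R = 0.
Proof.
have m1 : measurable [set x : 'rV[R]_n.+1 | enorm x = 0%R].
  rewrite (_ : [set x : 'rV[R]_n.+1 | enorm x = 0%R] = @enorm R n.+1 @^-1` [set 0%R])//.
  by rewrite -[X in measurable X]setTI; exact: measurable_enorm.
have m2 : measurable (@rV_cons R n @^-1` [set x : 'rV[R]_n.+1 | enorm x = 0%R]).
  by rewrite -[X in measurable X]setTI; exact: measurable_rV_cons.
have m3 : measurable ([set 0%R : measurableTypeR R] `*` [set: 'rV[R]_n]).
  exact: measurableX.
apply/eqP; rewrite eq_le measure_ge0 andbT /= /lebesgue_rV_step /pushforward.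
apply: (@le_trans _ _ ((leb \x mu n) ([set 0%R : measurableTypeR R] `*` [set: 'rV[R]_n]))).
  apply: le_measure; rewrite ?inE// => -[a y] /= /eqP; rewrite enorm_eq0 => /eqP ay0.
  split => //=; have : rV_cons (a, y) ord0 ord0 = a.
    rewrite /rV_cons (_ : ord0 = @lshift 1 n ord0); last exact/val_inj.
    by rewrite (row_mxEl a%:M y) mxE eqxx mulr1n.
  by rewrite ay0 mxE.
rewrite product_measure1E//.
by rewrite [X in X * _]lebesgue_measure_set1 mul0e.
Qed.

Section polar_formula.
Context (m : nat) (m0 : (0 < m)%N).
Notation n := m.+1.
Context (Phi : 'rV[R]_n -> \bar R) (mPhi : measurable_fun setT Phi).
Context (Phi0 : forall x, 0 <= Phi x).

Let J (x : 'rV[R]_n) : R := (if 0 < enorm x <= 1 then enorm x ^+ n else 0)%R.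
Let H (rho : R) (y : 'rV[R]_n) : R :=
  (if 0 < enorm y <= `|rho| then enorm y ^+ n * `|rho|^-1 ^+ n.+1 else 0)%R.

Let J_ge0 x : (0 <= J x)%R.
Proof. by rewrite /J; case: ifP => // _; rewrite exprn_ge0// enorm_ge0. Qed.

Let H_ge0 rho y : (0 <= H rho y)%R.
Proof.
by rewrite /H; case: ifP => // _; rewrite mulr_ge0// exprn_ge0// ?enorm_ge0// invr_ge0.
Qed.

Let measurable_J : measurable_fun setT J.
Proof.
apply: measurable_fun_ifT => //.
- apply: measurable_and.
    by apply: measurable_fun_ltr => //; exact: measurable_enorm.
  by apply: measurable_fun_ler => //; exact: measurable_enorm.
- by apply: measurable_funX; exact: measurable_enorm.
Qed.

Let measurable_H : measurable_fun [set: measurableTypeR R * 'rV[R]_n] (fun z => H z.1 z.2).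
Proof.
have me : measurable_fun [set: measurableTypeR R * 'rV[R]_n] (fun z => enorm z.2).
  exact: (measurableT_comp (@measurable_enorm R n) measurable_snd).
have mn : measurable_fun [set: measurableTypeR R * 'rV[R]_n] (fun z => `|z.1|%R : R).
  exact: (measurableT_comp (@normr_measurable R setT) measurable_fst).
apply: measurable_fun_ifT => //.
- by apply: measurable_and; [exact: measurable_fun_ltr|exact: measurable_fun_ler].
- apply: measurable_funM; apply: measurable_funX => //.
  exact: (measurableT_comp (@measurable_invr R) mn).
Qed.

Let measurable_dilated : measurable_fun [set: measurableTypeR R * 'rV[R]_n]
  (fun z => (J z.2 * `|z.1| ^+ m)%:E * Phi (z.1 *: z.2)).
Proof.
apply: emeasurable_funM.
  apply/measurable_EFinP; apply: measurable_funM.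
    exact: (measurableT_comp measurable_J measurable_snd).
  apply: measurable_funX.
  exact: (measurableT_comp (@normr_measurable R setT) measurable_fst).
by apply: (measurableT_comp mPhi); exact: measurable_scalerV measurable_fst measurable_snd.
Qed.

Let measurable_shell : measurable_fun [set: measurableTypeR R * 'rV[R]_n]
  (fun z => (H z.1 z.2)%:E * Phi z.2).
Proof.
apply: emeasurable_funM; first exact/measurable_EFinP.
exact: (measurableT_comp mPhi measurable_snd).
Qed.

(** The substitution sigma = rho |x|. *)
Let ray x : (0 < enorm x <= 1)%R ->
  \int[leb]_sigma ((`|sigma| ^+ m)%:E * Phi (sigma *: ((enorm x)^-1 *: x))%R) =
  \int[leb]_rho ((J x * `|rho| ^+ m)%:E * Phi (rho *: x)%R).
Proof.
move=> x1; have /andP[x0 _] := x1.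
have mphi : measurable_fun [set: measurableTypeR R]
    (fun sigma : R => (`|sigma| ^+ m)%:E * Phi (sigma *: ((enorm x)^-1 *: x))%R).
  apply: emeasurable_funM.
    by apply/measurable_EFinP; apply: measurable_funX; exact: normr_measurable.
  apply: (measurableT_comp mPhi).
  by apply: measurable_scalerV => //; exact: measurable_cst.
rewrite (@ge0_integral_affine R _ (enorm x) 0%R (lt0r_neq0 x0) mphi); last first.
  by move=> s; rewrite mule_ge0// lee_fin exprn_ge0.
rewrite -ge0_integralZl.
- apply: eq_integral => rho _; rewrite muleA -EFinM; congr (_%:E * Phi _).
    by rewrite /J x1 addr0 normrM (ger0_norm (ltW x0)) exprMn mulrA -exprS.
  by rewrite addr0 scalerA mulrAC divff ?gt_eqF// mul1r.
- exact: measurableT.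
- by apply: (measurableT_comp mphi); exact: (@measurable_affine R (enorm x) 0%R).
- by move=> s _; rewrite mule_ge0// lee_fin exprn_ge0.
- by rewrite lee_fin normr_ge0.
Qed.

(** The substitution y = rho x. *)
Let dilation rho :
  \int[mu n]_x ((J x * `|rho| ^+ m)%:E * Phi (rho *: x)%R) =
  \int[mu n]_y ((H rho y)%:E * Phi y).
Proof.
have [->|rho0] := eqVneq rho 0%R.
  apply: eq_integral => x _; rewrite normr0 expr0n gtn_eqF// mulr0.
  rewrite /H normr0; case: ifP; rewrite ?mul0e// => /andP[x0 x1].
  by have := lt_le_trans x0 x1; rewrite ltxx.
have mf : measurable_fun setT (fun x : 'rV[R]_n => (J x * `|rho| ^+ m)%:E * Phi (rho *: x)%R).
  exact: (measurableT_comp measurable_dilated (measurable_pair1 rho)).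
rewrite (@ge0_integral_rV_scale R n rho^-1%R _ _ mf) ?invr_eq0//; last first.
  by move=> x; rewrite mule_ge0// lee_fin mulr_ge0// exprn_ge0.
rewrite -ge0_integralZl.
- apply: eq_integral => y _; rewrite muleA -EFinM scalerA divff// scale1r.
  congr (_%:E * _); rewrite /J /H enormZ normrV ?unitfE//.
  have r0 : (0 < `|rho|)%R by rewrite normr_gt0.
  rewrite pmulr_rgt0 ?invr_gt0// mulrC ler_pdivrMl// mulr1.
  case: ifP; rewrite ?mul0r// => _.
  have rm : (`|rho| != 0)%R by rewrite gt_eqF.
  rewrite exprMn !exprVn !exprS; field.
  by rewrite ?rm ?expf_neq0.
- exact: measurableT.
- apply: (measurableT_comp mf); apply: measurable_scalerV; first exact: measurable_cst.
  exact: measurable_id.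
- by move=> x _; rewrite mule_ge0// lee_fin mulr_ge0// exprn_ge0.
- by rewrite lee_fin exprn_ge0.
Qed.

Let shell y : \int[leb]_rho ((H rho y)%:E * Phi y) =
  (if 0 < enorm y then 2 / n%:R else 0)%:E * Phi y.
Proof.
rewrite ge0_integralZr.
- congr (_ * _); case: ifPn => y0; last first.
    by rewrite integral0_eq// => rho _; rewrite /H (negPf y0).
  transitivity (\int[leb]_rho ((enorm y ^+ n)%:E *
      (if enorm y <= `|rho| then `|rho|^-1 ^+ n.+1 else 0)%:E)).
    by apply: eq_integral => rho _; rewrite -EFinM /H y0 /=; case: ifP; rewrite ?mulr0.
  rewrite ge0_integralZl.
  + rewrite integral_shell_power// -EFinM; congr EFin.
    by rewrite mulrCA -exprMn divff ?gt_eqF// expr1n mulr1.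
  + exact: measurableT.
  + apply/measurable_EFinP.
    apply: (measurableT_comp (measurable_halfline_power n.+1 (enorm y))).
    exact: normr_measurable.
  + by move=> rho _; rewrite lee_fin; case: ifP.
  + by rewrite lee_fin exprn_ge0// enorm_ge0.
- exact: measurableT.
- apply/measurable_EFinP; exact: (measurableT_comp measurable_H (measurable_pair2 y)).
- by move=> rho _; rewrite lee_fin.
- exact: Phi0.
Qed.

(** By the definition of the surface measure the left-hand side is an integral
    over pairs of a point x of the unit ball and of a real sigma.  Writing
    sigma = rho |x| and then y = rho x, the mass at y is the integral of
    |y|^n / |rho|^(n+1) over |rho| >= |y|, which does not depend on y. *)
Lemma polar :
  \int[@sphere_measure R n]_theta \int[leb]_sigma
    ((`|sigma| ^+ m)%:E * Phi (sigma *: theta)%R) =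
  2%:E * \int[mu n]_y Phi y.
Proof.
have mG : measurable_fun [set: 'rV[R]_n] (fun theta => \int[leb]_sigma
    ((`|sigma| ^+ m)%:E * Phi (sigma *: theta)%R)).
  apply: (@measurable_fun_fubini_tonelli_F _ _ _ _ _ leb
    (fun z : 'rV[R]_n * measurableTypeR R => (`|z.2| ^+ m)%:E * Phi (z.2 *: z.1)%R)).
    apply: emeasurable_funM.
      apply/measurable_EFinP; apply: measurable_funX.
      exact: (measurableT_comp (@normr_measurable R setT) measurable_snd).
    by apply: (measurableT_comp mPhi); exact: measurable_scalerV measurable_snd measurable_fst.
  by move=> z; rewrite mule_ge0// lee_fin exprn_ge0.
rewrite ge0_integral_sphere//; last first.
  by move=> x; apply: integral_ge0 => s _; rewrite mule_ge0// lee_fin exprn_ge0.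
rewrite integral_mkcond.
transitivity (n%:R%:E * \int[mu n]_x \int[leb]_rho
    ((J x * `|rho| ^+ m)%:E * Phi (rho *: x)%R)).
  apply: (congr1 (mule n%:R%:E)); apply: eq_integral => x _; rewrite patchE.
  case: ifPn => [/set_mem/ray//|/negP x1]; rewrite [RHS]integral0_eq// => rho _.
  rewrite /J ifF ?mul0r ?mul0e//; apply/negP => x1'; apply: x1; exact: mem_set.
rewrite (@fubini_tonelli _ _ _ _ _ (mu n) leb (fun z : 'rV[R]_n * measurableTypeR R =>
    (J z.1 * `|z.2| ^+ m)%:E * Phi (z.2 *: z.1)%R)); last 2 first.
- exact: (measurableT_comp measurable_dilated
    (measurable_fun_pair (@measurable_snd _ _ 'rV[R]_n (measurableTypeR R)) measurable_fst)).
- by move=> z; rewrite mule_ge0// lee_fin mulr_ge0// exprn_ge0.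
transitivity (n%:R%:E * \int[leb]_rho \int[mu n]_y ((H rho y)%:E * Phi y)).
  by apply: (congr1 (mule n%:R%:E)); apply: eq_integral => rho _; rewrite -dilation.
rewrite (@fubini_tonelli _ _ _ _ _ leb (mu n) (fun z : measurableTypeR R * 'rV[R]_n =>
    (H z.1 z.2)%:E * Phi z.2) measurable_shell); last first.
  by move=> z; rewrite mule_ge0// lee_fin.
transitivity (n%:R%:E * \int[mu n]_y ((2 / n%:R)%:E * Phi y)).
  apply: (congr1 (mule n%:R%:E)); apply: ge0_ae_eq_integral => //.
  - apply: (measurable_fun_fubini_tonelli_G _ measurable_shell).
    by move=> z; rewrite mule_ge0// lee_fin.
  - exact: emeasurable_funM.
  - by move=> y _; apply: integral_ge0 => rho _; rewrite mule_ge0// lee_fin.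
  - by move=> y _; rewrite mule_ge0// lee_fin divr_ge0.
  - exists [set x | enorm x = 0]%R; split.
    + rewrite (_ : mkset _ = @enorm R n @^-1` [set 0%R])//.
      by rewrite -[X in measurable X]setTI; exact: measurable_enorm.
    + exact: lebesgue_rV_origin.
    + move=> y /=; apply: contra_notP => y0 _; rewrite shell ifT//.
      by rewrite lt_neqAle eq_sym enorm_ge0 andbT; exact/eqP.
rewrite ge0_integralZl//.
by rewrite muleA -EFinM mulrCA divff ?mulr1// pnatr_eq0.
Qed.

End polar_formula.

End polar.

(** * The norm identity *)

Section Lnorm_nonneg.
Context d (T : measurableType d) (R : realType) (mu : {measure set T -> \bar R}).
Context (p : R).
Implicit Types u v w : T -> R.
Local Open Scope ereal_scope.

Lemma Lnorm_nonneg u : (forall x, 0 <= u x)%R ->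
  Lnorm mu p%:E (EFin \o u) = (\int[mu]_x (u x `^ p)%:E) `^ p^-1.
Proof.
move=> u0; rewrite Lnorm.unlock; apply: (congr1 (fun z => z `^ p^-1)).
by apply: eq_integral => x _; rewrite /= ger0_norm ?u0.
Qed.

Context (p1 : (1 <= p)%R).

Lemma Lnorm_weighted_triangle u v w (q : T -> R) :
  measurable_fun setT u -> measurable_fun setT v -> measurable_fun setT w ->
  measurable_fun setT q -> (forall x, 0 <= q x)%R -> (forall x, 0 <= u x)%R ->
  (forall x, u x <= v x + w x)%R ->
  Lnorm mu p%:E (EFin \o (fun x => q x * u x)%R) <=
  Lnorm mu p%:E (EFin \o (fun x => q x * v x)%R) +
  Lnorm mu p%:E (EFin \o (fun x => q x * w x)%R).
Proof.
move=> mu' mv mw mq q0 u0 uvw.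
have mqv : measurable_fun setT (fun x => q x * v x)%R by exact: measurable_funM.
have mqw : measurable_fun setT (fun x => q x * w x)%R by exact: measurable_funM.
apply: le_trans (minkowski_EFin mu mqv mqw p1).
have p0 : (0 < p)%R by rewrite (lt_le_trans ltr01).
have qu0 x : (0 <= q x * u x)%R by rewrite mulr_ge0.
have qvw x : (q x * u x <= q x * v x + q x * w x)%R by rewrite -mulrDr ler_wpM2l.
have qvw0 x : (0 <= q x * v x + q x * w x)%R by exact: le_trans (qvw x).
rewrite (Lnorm_nonneg qu0) (Lnorm_nonneg qvw0).
apply: gt0_ler_poweR; first by rewrite invr_ge0 ltW.
- by rewrite in_itv /= leey andbT integral_ge0// => x _; rewrite lee_fin powR_ge0.
- by rewrite in_itv /= leey andbT integral_ge0// => x _; rewrite lee_fin powR_ge0.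
apply: ge0_le_integral => //.
- by move=> x _; rewrite lee_fin powR_ge0.
- apply/measurable_EFinP; apply: (measurableT_comp (measurable_powR _)).
  exact: measurable_funM.
- apply/measurable_EFinP; apply: (measurableT_comp (measurable_powR _)).
  exact: measurable_funD.
- move=> x _; rewrite lee_fin; apply: ge0_ler_powR => //.
  + exact: ltW.
  + by rewrite nnegrE.
  + by rewrite nnegrE (le_trans (qu0 x)).
Qed.

End Lnorm_nonneg.

Section parameter_integral.
Context d1 d2 (T1 : measurableType d1) (T2 : measurableType d2) (R : realType).
Context (m2 : {sigma_finite_measure set T2 -> \bar R}).

Lemma measurable_param_Rintegral (f : T1 * T2 -> R) : measurable_fun setT f ->
  measurable_fun setT (fun x => \int[m2]_y f (x, y)).
Proof.
move=> mf; have mEf : measurable_fun setT (EFin \o f) by exact/measurable_EFinP.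
apply: (measurableT_comp (@fine_measurable R setT measurableT)).
rewrite (_ : (fun x => _) = (fun x => (\int[m2]_y ((EFin \o f)^\+ (x, y)))%E) \-
    (fun x => \int[m2]_y ((EFin \o f)^\- (x, y)))%E)%E.
  apply: emeasurable_funB; apply: measurable_fun_fubini_tonelli_F => //.
    exact: measurable_funepos.
  exact: measurable_funeneg.
apply/funext => x; rewrite [LHS]integralE.
by congr (_ - _)%E; apply: eq_integral => y _; rewrite ?funeposE ?funenegE.
Qed.

Lemma measurable_cmod_cintegral (g : T1 * T2 -> R[i]) :
  measurable_fun setT (@complex.Re R \o g) -> measurable_fun setT (@complex.Im R \o g) ->
  measurable_fun setT (fun x => cmod (cintegral m2 (fun y => g (x, y)))).
Proof.
by move=> mr mi; apply: measurable_cmod;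
  [exact: (measurable_param_Rintegral mr)|exact: (measurable_param_Rintegral mi)].
Qed.

End parameter_integral.

Lemma measurable_cisM d (T : measurableType d) (R : realType) (a : T -> R) (g : T -> R[i]) :
  measurable_fun setT a ->
  measurable_fun setT (@complex.Re R \o g) -> measurable_fun setT (@complex.Im R \o g) ->
  measurable_fun setT (@complex.Re R \o (fun x => cis (a x) * g x)) /\
  measurable_fun setT (@complex.Im R \o (fun x => cis (a x) * g x)).
Proof.
move=> ma mr mi.
have mcos : measurable_fun setT (fun x => cos (a x)).
  by apply: (measurableT_comp _ ma); apply: continuous_measurable_fun; exact: continuous_cos.
have msin : measurable_fun setT (fun x => sin (a x)).
  by apply: (measurableT_comp _ ma); apply: continuous_measurable_fun; exact: continuous_sin.
split.
  rewrite (_ : _ \o _ = fun x => cos (a x) * (@complex.Re R \o g) x -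
      sin (a x) * (@complex.Im R \o g) x).
    by apply: measurable_funB; exact: measurable_funM.
  by apply/funext => x; exact: Re_cisM.
rewrite (_ : _ \o _ = fun x => cos (a x) * (@complex.Im R \o g) x +
    sin (a x) * (@complex.Re R \o g) x).
  by apply: measurable_funD; exact: measurable_funM.
by apply/funext => x; exact: Im_cisM.
Qed.

Section weight.
Context (R : realType).
Implicit Types s t r : R.

Lemma weight_ge0 s t r : 0 <= weight s t r.
Proof. by rewrite mulr_ge0 ?powR_ge0. Qed.

Lemma measurable_weight s t : measurable_fun [set: measurableTypeR R] (weight s t).
Proof.
have m1 : measurable_fun [set: measurableTypeR R] (fun r : R => 1 + r ^+ 2).
  by apply: measurable_funD => //; exact: measurable_funX.
apply: measurable_funM; first exact: (measurableT_comp (measurable_powR _) m1).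
apply: (measurableT_comp (measurable_powR _)); apply: measurable_funM => //.
apply: (measurableT_comp (@measurable_invr R)).
exact: (measurableT_comp (measurable_powR _) m1).
Qed.

(** For a = n - 1 the factor r^a is the Jacobian of polar coordinates in R^n; the
    two shifts of exponents multiply the weight by r^(a/p), because the powers of
    1 + r^2 cancel. *)
Lemma weight_shift s t p a r : 0 < r -> p != 0 ->
  weight (s + a / p) (t + a / p) r `^ p = r `^ a * weight s t r `^ p.
Proof.
move=> r0 p0; set A := 1 + r ^+ 2; have A0 : 0 < A by rewrite addr_gt0// exprn_gt0.
pose B := A `^ (1 / 2); have B0 : 0 < B by exact: powR_gt0.
pose q := r / B; have q0 : 0 < q by rewrite divr_gt0.
have rq : r = q * B by rewrite /q divfK// gt_eqF.
have -> : weight (s + a / p) (t + a / p) r = r `^ (a / p) * weight s t r.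
  have -> : r `^ (a / p) = q `^ (a / p) * B `^ (a / p) by rewrite -powRM ?ltW// -rq.
  rewrite /weight -/A -/B -/q.
  rewrite mulrDl !powRD ?(gt_eqF A0) ?(gt_eqF q0) ?implybT//.
  have -> : a / p / 2 = 1 / 2 * (a / p) by rewrite mulrC mul1r.
  rewrite (powRrM A (1 / 2) (a / p)) -/B mulrACA [RHS]mulrC.
  by congr (_ * _); exact: mulrC.
rewrite powRM ?powR_ge0 ?weight_ge0//.
by rewrite -powRrM divfK.
Qed.

End weight.

Section norm_identity.
Context (R : realType) (m : nat) (m0 : (0 < m)%N).
Notation n := m.+1.
Notation leb := (@lebesgue_measure R).
Notation mu := (lebesgue_rV R).
Context (p s t : R) (p1 : 1 <= p).

Let p0 : p != 0. Proof. by rewrite gt_eqF// (lt_le_trans ltr01). Qed.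

Let a := (n%:R - 1) / p.

Lemma measurable_fourier (f : 'rV[R]_n -> R[i]) :
  measurable_fun setT (@complex.Re R \o f) -> measurable_fun setT (@complex.Im R \o f) ->
  measurable_fun setT (fun xi => cmod (fourier f xi)).
Proof.
move=> mr mi; rewrite /fourier; under eq_fun do rewrite cmodM.
apply: measurable_funM => //.
have mdot : measurable_fun [set: 'rV[R]_n * 'rV[R]_n] (fun z => dotp z.2 z.1).
  exact: measurable_dotp measurable_snd measurable_fst.
have mr2 := measurableT_comp mr (@measurable_snd _ _ 'rV[R]_n 'rV[R]_n).
have mi2 := measurableT_comp mi (@measurable_snd _ _ 'rV[R]_n 'rV[R]_n).
have [mr3 mi3] := measurable_cisM mdot mr2 mi2.
exact: (@measurable_cmod_cintegral _ _ _ _ _ (mu n)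
  (fun z : 'rV[R]_n * 'rV[R]_n => cis (dotp z.2 z.1) * f z.2)).
Qed.

Lemma measurable_fourier1 (g : R * 'rV[R]_n -> R[i]) :
  measurable_fun [set: measurableTypeR R * 'rV[R]_n] (@complex.Re R \o g) ->
  measurable_fun [set: measurableTypeR R * 'rV[R]_n] (@complex.Im R \o g) ->
  measurable_fun [set: 'rV[R]_n * measurableTypeR R]
    (fun z => cmod (fourier1 g (z.2, z.1))).
Proof.
move=> mr mi; rewrite /fourier1; under eq_fun do rewrite cmodM.
apply: measurable_funM => //.
have mph : measurable_fun [set: ('rV[R]_n * measurableTypeR R) * measurableTypeR R]
    (fun z => z.1.2 * z.2).
  apply: measurable_funM => //.
  exact: (measurableT_comp measurable_snd measurable_fst).
have mpair : measurable_fun [set: ('rV[R]_n * measurableTypeR R) * measurableTypeR R]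
    (fun z => (z.2, z.1.1) : measurableTypeR R * 'rV[R]_n).
  apply: measurable_fun_pair; first exact: measurable_snd.
  exact: (measurableT_comp measurable_fst measurable_fst).
have mr2 := measurableT_comp mr mpair.
have mi2 := measurableT_comp mi mpair.
have [mr3 mi3] := measurable_cisM mph mr2 mi2.
exact: (@measurable_cmod_cintegral _ _ _ _ _ leb
  (fun z : ('rV[R]_n * measurableTypeR R) * measurableTypeR R =>
    cis (z.1.2 * z.2) * g (z.2, z.1.1))).
Qed.

Lemma measurable_weight_enorm : measurable_fun [set: 'rV[R]_n]
  (fun xi => weight s t (enorm xi)).
Proof. exact: (measurableT_comp (@measurable_weight R s t) (@measurable_enorm R n)). Qed.

Lemma S_normE (f : 'rV[R]_n -> R[i]) : S_norm p s t f =
  ((\int[mu n]_xi ((weight s t (enorm xi) * cmod (fourier f xi)) `^ p)%:E) `^ p^-1)%E.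
Proof. by apply: Lnorm_nonneg => xi; rewrite mulr_ge0 ?weight_ge0 ?cmod_ge0. Qed.

(** By the slice theorem the norm of [radon f] is an integral of the Fourier
    transform of [f] along the lines through the origin, and the weight contains
    the Jacobian of polar coordinates. The factor 1/2 in the norm is there because
    (sigma, theta) and (-sigma, -theta) give the same point. *)
Lemma radon_norm (f : 'rV[R]_n -> R[i]) : ctame f ->
  R_norm p (s + a) (t + a) (radon f) = S_norm p s t f.
Proof.
move=> tf; rewrite S_normE /R_norm; congr (_ `^ _)%E.
pose Phi (xi : 'rV[R]_n) : \bar R :=
  ((weight s t (enorm xi) * cmod (fourier f xi)) `^ p)%:E.
have mF : measurable_fun setT (fun xi => weight s t (enorm xi) * cmod (fourier f xi)).
  apply: measurable_funM; first exact: measurable_weight_enorm.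
  by have [fr fi] := tf; apply: measurable_fourier; exact: tame_measurable.
have mPhi : measurable_fun setT Phi.
  by apply/measurable_EFinP; exact: (measurableT_comp (measurable_powR _) mF).
have Phi0 xi : (0 <= Phi xi)%E by rewrite lee_fin powR_ge0.
pose G theta : \bar R :=
  (\int[leb]_sigma ((`|sigma| ^+ m)%:E * Phi (sigma *: theta)%R))%E.
have mG : measurable_fun [set: 'rV[R]_n] G.
  apply: (@measurable_fun_fubini_tonelli_F _ _ _ _ _ leb
    (fun z : 'rV[R]_n * measurableTypeR R => (`|z.2| ^+ m)%:E * Phi (z.2 *: z.1)%R)%E).
    apply: emeasurable_funM.
      apply/measurable_EFinP; apply: measurable_funX.
      exact: (measurableT_comp (@normr_measurable R setT) measurable_snd).
    by apply: (measurableT_comp mPhi); exact: measurable_scalerV measurable_snd measurable_fst.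
  by move=> z; rewrite mule_ge0// lee_fin exprn_ge0.
have G0 theta : (0 <= G theta)%E.
  by apply: integral_ge0 => sigma _; rewrite mule_ge0// lee_fin exprn_ge0.
have slice theta : enorm theta = 1 ->
    (\int[leb]_sigma (weight (s + a) (t + a) `|sigma| `^ p *
      cmod (fourier1 (radon f) (sigma, theta)) `^ p)%:E)%E = G theta.
  move=> theta1.
  have mL : measurable_fun [set: measurableTypeR R] (fun sigma : R =>
      (weight (s + a) (t + a) `|sigma| `^ p *
       cmod (fourier f (sigma *: theta)) `^ p)%:E).
    apply/measurable_EFinP; apply: measurable_funM.
      apply: (measurableT_comp (measurable_powR _)).
      apply: (measurableT_comp (@measurable_weight R _ _)).
      exact: normr_measurable.
    apply: (measurableT_comp (measurable_powR _)).
    have [fr fi] := tf.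
    apply: (measurableT_comp (measurable_fourier (tame_measurable fr) (tame_measurable fi))).
    by apply: measurable_scalerV => //; exact: measurable_cst.
  have mR : measurable_fun [set: measurableTypeR R] (fun sigma : R =>
      ((`|sigma| ^+ m)%:E * Phi (sigma *: theta)%R)%E).
    apply: emeasurable_funM.
      by apply/measurable_EFinP; apply: measurable_funX; exact: normr_measurable.
    apply: (measurableT_comp mPhi).
    by apply: measurable_scalerV => //; exact: measurable_cst.
  under eq_integral do rewrite fourier_slice//.
  apply: ge0_ae_eq_integral => //.
  - by move=> sigma _; rewrite lee_fin mulr_ge0 ?powR_ge0.
  - by move=> sigma _; rewrite mule_ge0// lee_fin exprn_ge0.
  - exists [set 0]; split; [exact: measurable_set1|exact: lebesgue_measure_set1|].
    move=> sigma Hs; apply: contrapT => sigma0; apply: Hs => _.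
    have s0 : 0 < `|sigma| by rewrite normr_gt0; exact/eqP.
    rewrite /Phi -EFinM; congr EFin.
    rewrite weight_shift// enormZ theta1 mulr1 powRM ?weight_ge0 ?cmod_ge0// mulrA.
    by rewrite -natr1 addrK powR_mulrn.
have offsphere theta : enorm theta != 1 ->
    (\int[leb]_sigma (weight (s + a) (t + a) `|sigma| `^ p *
      cmod (fourier1 (radon f) (sigma, theta)) `^ p)%:E)%E = 0%E.
  move=> theta1; apply: integral0_eq => sigma _.
  by rewrite fourier1_off_sphere// cmodE /= !expr0n /= addr0 sqrtr0 powR0// mulr0.
transitivity ((2^-1)%:E * \int[@sphere_measure R n]_theta
    (if enorm theta == 1%R then G theta else 0))%E.
  apply: (congr1 (mule _)); apply: eq_integral => theta _.
  by have [/slice|/offsphere] := eqVneq (enorm theta) 1.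
have mG1 : measurable_fun [set: 'rV[R]_n]
    (fun theta => if enorm theta == 1%R then G theta else 0%E).
  apply: measurable_fun_ifT => //.
  by apply: measurable_fun_eqr => //; exact: measurable_enorm.
have -> : (\int[@sphere_measure R n]_theta (if enorm theta == 1%R then G theta else 0) =
    \int[@sphere_measure R n]_theta G theta)%E.
  rewrite !ge0_integral_sphere//; last by move=> theta; case: ifP.
  apply: (congr1 (mule _)); apply: eq_integral => x /set_mem /andP[x0 _].
  by rewrite enorm_normalize ?eqxx// -enorm_gt0.
rewrite polar// muleA -EFinM mulVf// mul1e.
by [].
Qed.

End norm_identity.

(** * The norms as seminorms *)

Section norm_domains.
Context (R : realType) (m : nat).
Notation n := m.+1.
Notation leb := (@lebesgue_measure R).
Notation mu := (lebesgue_rV R).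
Implicit Types (f g : 'rV[R]_n -> R[i]) (h k : R * 'rV[R]_n -> R[i]).

Lemma fourierB f g xi : ctame f -> ctame g ->
  fourier (f - g) xi = fourier f xi - fourier g xi.
Proof.
move=> tf tg; rewrite /fourier -mulrBr; congr (_ * _).
have md : measurable_fun [set: 'rV[R]_n] (fun x => dotp x xi).
  by apply: measurable_dotp => //; exact: measurable_cst.
rewrite -(cintegralB (cintegrable_cisM md (ctame_cintegrable tf))
  (cintegrable_cisM md (ctame_cintegrable tg))).
by congr cintegral; apply/funext => x; rewrite -mulrBr.
Qed.

Lemma ctame_measurable_fourier f : ctame f ->
  measurable_fun setT (fun xi => cmod (fourier f xi)).
Proof. by move=> [fr fi]; apply: measurable_fourier; exact: tame_measurable. Qed.

Lemma cintegral0 d (T : measurableType d) (nu : {measure set T -> \bar R}) (f : T -> R[i]) :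
  (forall x, f x = 0) -> cintegral nu f = 0.
Proof.
move=> f0; have -> : f = fun=> 0 by exact/funext.
by rewrite /cintegral /= Rintegral_cst// mul0r.
Qed.

(** A subgroup which contains the Schwartz functions of the cylinder and on which
    [fourier1] is additive. *)
Definition slice_integrable h : Prop :=
  [/\ measurable_fun [set: measurableTypeR R * 'rV[R]_n] (@complex.Re R \o h),
      measurable_fun [set: measurableTypeR R * 'rV[R]_n] (@complex.Im R \o h) &
      forall theta, cintegrable leb (fun tau => h (tau, theta))].

Lemma slice_integrableB h k : slice_integrable h -> slice_integrable k ->
  slice_integrable (h - k).
Proof.
move=> [hr hi ih] [kr ki ik]; split.
- rewrite (_ : _ \o _ = fun z => (@complex.Re R \o h) z - (@complex.Re R \o k) z).
    exact: measurable_funB.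
  by apply/funext => z; exact: ReB.
- rewrite (_ : _ \o _ = fun z => (@complex.Im R \o h) z - (@complex.Im R \o k) z).
    exact: measurable_funB.
  by apply/funext => z; exact: ImB.
- by move=> theta; exact: cintegrableB.
Qed.

Lemma fourier1B h k z : slice_integrable h -> slice_integrable k ->
  fourier1 (h - k) z = fourier1 h z - fourier1 k z.
Proof.
move=> [_ _ ih] [_ _ ik]; rewrite /fourier1 -mulrBr; congr (_ * _).
have ms : measurable_fun [set: measurableTypeR R] (fun tau : R => z.1 * tau).
  by apply: measurable_funM.
rewrite -(cintegralB (cintegrable_cisM ms (ih z.2)) (cintegrable_cisM ms (ik z.2))).
by congr cintegral; apply/funext => tau; rewrite -mulrBr.
Qed.

(** On the cylinder [h] coincides with [homog0 h], which is continuous off the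
    axis; the bounds of order 0 and 2 in the offset make it integrable. *)
Lemma cyl_schwartz_real_slices (h : R * 'rV[R]_n -> R) :
  cyl_schwartz_real h -> (forall z, enorm z.2 != 1 -> h z = 0) ->
  measurable_fun [set: measurableTypeR R * 'rV[R]_n] h /\
  forall theta, leb.-integrable setT (fun tau => (h (tau, theta))%:E).
Proof.
move=> [smooth rapid] h0.
have novs : {in [::], forall v : R * 'rV[R]_n, cyl_dirs v} by [].
have hE z : enorm z.2 = 1 -> homog0 h z = h z.
  by move=> z1; rewrite /homog0 z1 invr1 scale1r; case: z z1.
pose U := [set z : measurableTypeR R * 'rV[R]_n | 0 < enorm z.2].
have me : measurable_fun [set: measurableTypeR R * 'rV[R]_n] (fun z => enorm z.2).
  exact: (measurableT_comp (@measurable_enorm R n) measurable_snd).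
have mU : measurable U.
  rewrite (_ : U = (fun z : measurableTypeR R * 'rV[R]_n => enorm z.2) @^-1` `]0, +oo[%classic).
    by rewrite -[X in measurable X]setTI; exact: me.
  by apply/seteqP; split => z; rewrite /= in_itv /= andbT.
have mH : measurable_fun U (homog0 h : measurableTypeR R * 'rV[R]_n -> R).
  apply: measurable_continuous_pair => // z Uz; have z0 : z.2 != 0 by rewrite -enorm_gt0.
  by have [] := smooth [::] novs z z0.
have mh : measurable_fun [set: measurableTypeR R * 'rV[R]_n] h.
  rewrite (_ : h = fun z : measurableTypeR R * 'rV[R]_n =>
    if enorm z.2 == 1 then (homog0 h \_ U) z else 0).
    apply: measurable_fun_ifT => //; last exact/(measurable_restrictT _ mU).
    exact: measurable_fun_eqr.
  apply/funext => z; have [z1|/h0//] := eqVneq (enorm z.2) 1.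
  by rewrite patchE mem_set ?hE// /U /= z1.
split=> // theta.
have mslice : measurable_fun [set: measurableTypeR R] (fun tau : R => h (tau, theta)).
  exact: (measurableT_comp mh (measurable_pair2 theta)).
have [theta1|theta1] := eqVneq (enorm theta) 1; last first.
  under eq_fun do rewrite h0//.
  exact: integrable0.
have [C0 hC0] := rapid [::] novs 0%N.
have [C2 hC2] := rapid [::] novs 2%N.
have imaj : leb.-integrable setT (fun tau : R => (C0 + C2)%:E * ((1 + tau ^+ 2)^-1)%:E)%E.
  apply: integrableZl => //; apply/integrableP; split.
    by apply/measurable_EFinP; exact: measurable_oneDsqrV.
  rewrite (_ : \int[_]_(_ in _) _ = pi%:E)%E ?ltry// -integral_oneDsqr.
  by apply: eq_integral => tau _; rewrite gee0_abs// lee_fin invr_ge0 ltW// onePsqr_gt0.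
apply: (le_integrable _ _ _ imaj) => //; first exact/measurable_EFinP.
move=> tau _; rewrite -EFinM !abse_EFin lee_fin.
have h1 := hC0 tau theta theta1; have h2 := hC2 tau theta theta1.
rewrite /= expr0 mul1r hE// in h1; rewrite /= hE// real_normK ?num_real// in h2.
rewrite (le_trans _ (ler_norm _))// ler_pdivlMr ?onePsqr_gt0//.
by rewrite mulrDr mulr1 lerD// mulrC.
Qed.

Lemma cyl_schwartz_slice_integrable h : cyl_schwartz h -> slice_integrable h.
Proof.
move=> [hr hi h0].
have [mr ir] : _ := cyl_schwartz_real_slices hr (fun z z1 => congr1 (@complex.Re R) (h0 z z1)).
have [mi ii] := cyl_schwartz_real_slices hi (fun z z1 => congr1 (@complex.Im R) (h0 z z1)).
by split => // theta; split; [exact: ir|exact: ii].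
Qed.

End norm_domains.

Section seminorms.
Context (R : realType) (m : nat).
Notation n := m.+1.
Notation leb := (@lebesgue_measure R).
Notation mu := (lebesgue_rV R).
Context (p s t : R) (p1 : 1 <= p).
Implicit Types (f g : 'rV[R]_n -> R[i]) (h k : R * 'rV[R]_n -> R[i]).

Let p0 : p != 0. Proof. by rewrite gt_eqF// (lt_le_trans ltr01). Qed.

Lemma S_norm_seminorm : seminorm_on (@ctame R n) (S_norm p s t).
Proof.
split.
- by move=> f g; exact: ctameB.
- by move=> f; exact: Lnorm_ge0.
- rewrite -(@Lnorm0 _ _ _ (mu n) p%:E) ?eqe//; apply: eq_Lnorm => xi.
  rewrite /fourier cintegral0 => [|x]; last exact: mulr0.
  by rewrite mulr0 cmodE /= !expr0n /= addr0 sqrtr0 mulr0.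
- move=> f g tf tg; apply: Lnorm_weighted_triangle => //.
  + exact: (ctame_measurable_fourier (ctameB tf tg)).
  + exact: ctame_measurable_fourier.
  + exact: ctame_measurable_fourier.
  + exact: measurable_weight_enorm.
  + by move=> xi; exact: weight_ge0.
  + by move=> xi; exact: cmod_ge0.
  + by move=> xi; rewrite fourierB//; exact: cmod_leB.
Qed.

(** Here n is the factor in the surface measure and 1/2 the one in the norm. *)
Let cone_weight (z : 'rV[R]_n * measurableTypeR R) : R :=
  if 0 < enorm z.1 <= 1 then (n%:R / 2) `^ p^-1 * weight s t `|z.2| else 0.

Let cone_modulus h (z : 'rV[R]_n * measurableTypeR R) : R :=
  cmod (fourier1 h (z.2, (enorm z.1)^-1 *: z.1)).

Let cone_weight_ge0 z : 0 <= cone_weight z.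
Proof. by rewrite /cone_weight; case: ifP => // _; rewrite mulr_ge0 ?powR_ge0 ?weight_ge0. Qed.

Let measurable_cone_weight : measurable_fun setT cone_weight.
Proof.
have me : measurable_fun [set: 'rV[R]_n * measurableTypeR R] (fun z => enorm z.1).
  exact: (measurableT_comp (@measurable_enorm R n) measurable_fst).
apply: measurable_fun_ifT => //.
- by apply: measurable_and; [exact: measurable_fun_ltr|exact: measurable_fun_ler].
- apply: measurable_funM => //.
  apply: (measurableT_comp (@measurable_weight R s t)).
  exact: (measurableT_comp (@normr_measurable R setT) measurable_snd).
Qed.

Let measurable_cone_modulus h : slice_integrable h -> measurable_fun setT (cone_modulus h).
Proof.
move=> [hr hi _]; apply: (measurableT_comp (measurable_fourier1 hr hi)
  (g := fun z : 'rV[R]_n * measurableTypeR R => ((enorm z.1)^-1 *: z.1, z.2))).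
apply: measurable_fun_pair; last exact: measurable_snd.
exact: (measurableT_comp (@measurable_normalize R n) measurable_fst).
Qed.

(** Carrying the integral over the sphere back to the unit ball makes the norm
    an Lp norm for a product measure, so that Minkowski's inequality applies. *)
Lemma R_normE h : slice_integrable h ->
  R_norm p s t h =
  Lnorm (mu n \x leb)%E p%:E (EFin \o (fun z => cone_weight z * cone_modulus h z)).
Proof.
move=> ih; have mh := measurable_cone_modulus ih.
have mu0 z : 0 <= cone_weight z * cone_modulus h z by rewrite mulr_ge0 ?cmod_ge0.
rewrite Lnorm_nonneg// /R_norm; apply: (congr1 (fun x => (x `^ p^-1)%E)).
have [hr hi _] := ih; have mF := measurable_fourier1 hr hi.
pose k0 (z : 'rV[R]_n * measurableTypeR R) : \bar R :=
  (weight s t `|z.2| `^ p * cmod (fourier1 h (z.2, z.1)) `^ p)%:E.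
have mk0 : measurable_fun setT k0.
  apply/measurable_EFinP; apply: measurable_funM.
    apply: (measurableT_comp (measurable_powR _)).
    apply: (measurableT_comp (@measurable_weight R s t)).
    exact: (measurableT_comp (@normr_measurable R setT) measurable_snd).
  exact: (measurableT_comp (measurable_powR _) mF).
have k00 z : (0 <= k0 z)%E by rewrite lee_fin mulr_ge0 ?powR_ge0.
pose K theta : \bar R := (\int[leb]_sigma k0 (theta, sigma))%E.
have mK : measurable_fun setT K by exact: measurable_fun_fubini_tonelli_F.
have K0 theta : (0 <= K theta)%E by apply: integral_ge0.
transitivity ((2^-1)%:E * \int[@sphere_measure R n]_theta K theta)%E; first by [].
rewrite ge0_integral_sphere// muleA -EFinM.
have mp : measurable_fun setT (fun z => ((cone_weight z * cone_modulus h z) `^ p)%:E).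
  apply/measurable_EFinP; apply: (measurableT_comp (measurable_powR _)).
  exact: measurable_funM.
rewrite (@fubini_tonelli1 _ _ _ _ _ (mu n) leb _ mp); last first.
  by move=> z; rewrite lee_fin powR_ge0.
have mKn : measurable_fun [set: 'rV[R]_n] (fun x => K ((enorm x)^-1 *: x)).
  exact: (measurableT_comp mK (@measurable_normalize R n)).
rewrite -ge0_integralZl;
  [|exact: measurable_ball|exact: measurable_funTS|by move=> ? _; exact: K0|by rewrite lee_fin].
rewrite integral_mkcond; apply: eq_integral => x _; rewrite patchE.
case: ifPn => [/set_mem /= x1|/negP x1]; last first.
  rewrite /fubini_F integral0_eq// => sigma _; rewrite /cone_weight ifF ?mul0r ?powR0//.
  by apply/negP => x1'; apply: x1; exact: mem_set.
have mKx : measurable_fun [set: measurableTypeR R]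
    (fun sigma : R => k0 ((enorm x)^-1 *: x, sigma)).
  exact: (measurableT_comp mk0 (measurable_pair1 _)).
rewrite /fubini_F /K -ge0_integralZl;
  [|exact: measurableT|exact: mKx|by move=> ? _; exact: k00|by rewrite lee_fin].
apply: eq_integral => sigma _; rewrite /k0 -EFinM; congr EFin.
rewrite /cone_weight x1 powRM ?cmod_ge0 ?mulr_ge0 ?powR_ge0 ?weight_ge0//.
rewrite powRM ?powR_ge0 ?weight_ge0// -powRrM mulVf// powRr1 ?divr_ge0//.
by rewrite mulrA [2^-1 * _]mulrC.
Qed.

Lemma R_norm_seminorm : seminorm_on (@slice_integrable R m) (R_norm p s t).
Proof.
split.
- exact: slice_integrableB.
- by move=> h; exact: poweR_ge0.
- rewrite /R_norm (_ : (\int[_]_theta _)%E = 0%E).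
    by rewrite mule0 poweR0r// invr_neq0.
  apply: integral0_eq => theta _; apply: integral0_eq => sigma _.
  rewrite /fourier1 cintegral0 => [|x]; last exact: mulr0.
  by rewrite mulr0 cmodE /= !expr0n /= addr0 sqrtr0 powR0// mulr0.
- move=> h k ih ik; have ihk := slice_integrableB ih ik.
  rewrite !R_normE//; apply: Lnorm_weighted_triangle => //.
  + exact: measurable_cone_modulus.
  + exact: measurable_cone_modulus.
  + exact: measurable_cone_modulus.
  + by move=> z; exact: cmod_ge0.
  + by move=> z; rewrite /cone_modulus fourier1B//; exact: cmod_leB.
Qed.

End seminorms.

Theorem theorem2 (R : realType) (n : nat) (p s t : R) :
  (2 <= n)%N -> 1 <= p -> - (n%:R / p) < t ->
  exists radon_ext : S_space n p s t ->
      R_space n p (s + (n%:R - 1) / p) (t + (n%:R - 1) / p),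
    unique (continuous_extension (@radon R n)) radon_ext /\
    forall f : S_space n p s t,
      completion_norm f = completion_norm (radon_ext f).
Proof.
case: n => // m m0 p1 _.
have SD := @schwartz_ctame R m.+1.
have SD' := @cyl_schwartz_slice_integrable R m.
have N1 := S_norm_seminorm m s t p1.
have N2 := R_norm_seminorm m (s + (m.+1%:R - 1) / p) (t + (m.+1%:R - 1) / p) p1.
apply: (isometric_extension N1 SD N2 SD' (@radon_cyl_schwartz R m)).
- by move=> f /SD; exact: radon_norm.
- by move=> f g /SD tf /SD tg; rewrite -radonB//; apply: radon_norm => //; exact: ctameB.
Qed.
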